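(* Let $\Omega\subseteq\mathbb{R}^d$, $d\in\{2,3\}$. Let $\psi=\psi(\phi,\nabla\phi,\theta)$ be the free energy density, $s=-\partial_\theta\psi$ the entropy density, $\mu=\nabla\cdot\partial_{\nabla\phi}\psi-\partial_\phi\psi$ the chemical potential, and $e=\psi+\theta s$ the internal energy density. Let $\eta(\phi,\theta)>0$ be the friction parameter, $\nu$ the constant viscosity, and $k(\phi,\theta)>0$ the thermal conductivity. Assume Fourier's law $q=k(\phi,\theta)\nabla\theta$ and set $j=q/\theta$. Consider smooth solutions with $\theta>0$ satisfying the boundary conditions listed in the context. (i) Case (A1): suppose $(\phi,u,\theta)$ satisfies $$\partial_t\phi+u\cdot\nabla\phi=0,\quad -\eta(u\cdot\nabla\phi)\nabla\phi=\mu\nabla\phi+s\nabla\theta,\quad \theta\big(\partial_t s+\nabla\cdot(us)\big)=\theta\nabla\cdot j+\theta\Delta^*,$$ with rate of entropy production $\Delta^*$ given by $$\theta\Delta^*=|u\cdot\nabla\phi|^2\eta(\phi,\theta)+\frac{k(\phi,\theta)|\nabla\theta|^2}{\theta}.$$ Then the total energy $E^{tot}(t)=\int_\Omega e\,dx$ is conserved, i.e. $\frac{d}{dt}E^{tot}(t)=0$. (ii) Case (A2): suppose $(\phi,u,\theta)$ satisfies $$\partial_t\phi+u\cdot\nabla\phi=0,\quad -\eta(u\cdot\nabla\phi)\nabla\phi=\mu\nabla\phi,\quad \theta\,\partial_t s=\theta\nabla\cdot j+\theta\Delta^*,$$ with $$\theta\Delta^*=|u\cdot\nabla\phi|^2\eta(\phi,\theta)+\frac{k(\phi,\theta)|\nabla\theta|^2}{\theta}.$$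 Then $E^{tot}(t)=\int_\Omega e\,dx$ is conserved. (iii) Case (A3): suppose $(\phi,u,v,p,\theta)$ satisfies $$\partial_t\phi+u\cdot\nabla\phi=0,\quad -\eta\big((u-v)\cdot\nabla\phi\big)\nabla\phi=\mu\nabla\phi,$$ $$\partial_t v+(v\cdot\nabla)v+\nabla p=-\mu\nabla\phi+\nu\Delta v-s\nabla\theta,\quad\nabla\cdot v=0,$$ $$\theta\big(\partial_t s+\nabla\cdot(vs)\big)=\theta\nabla\cdot j+\theta\Delta^*,$$ with $$\theta\Delta^*=|(u-v)\cdot\nabla\phi|^2\eta(\phi,\theta)+\nu|\nabla v|^2+\frac{k(\phi,\theta)|\nabla\theta|^2}{\theta}.$$ Then $E^{tot}(t)=\int_\Omega e\,dx+\int_\Omega\frac12|v|^2\,dx$ is conserved.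
   Context: $\Omega$ is a domain with or without boundary. The variable $\phi$ is a phase function, $\theta>0$ is the absolute temperature, $u$ is the velocity transporting $\phi$, $v$ is the macroscopic background velocity, and $p$ is the pressure (Lagrange multiplier of incompressibility). The labels (A1), (A2), (A3) refer to the kinematics of the temperature: transported with $u$, on a fixed background, and transported with $v$, respectively. They determine the form of the equations listed in each case. All functions are sufficiently smooth on $\overline\Omega\times(0,T)$. $\psi(\phi,\nabla\phi,\theta)$ is a smooth function of its arguments. The model choice is $$\psi=\frac{\epsilon}{2}|\nabla\phi|^2+\frac1\epsilon W(\phi)-\chi(\epsilon)\frac{\lambda}{\theta_c}(\theta-\theta_c)g(\phi)+c_v\theta(1-\log\theta),$$ with constants $\epsilon,\chi(\epsilon),\lambda,\theta_c,c_v$ and smooth functions $W,g$. The quantities $s,\mu,e$ are evaluated along the solution. Boundary conditions on $\partial\Omega$ (outer normal $n$): $\partial_{\nabla\phi}\psi\cdot n=0$ (for the model free energy above this is $\nabla\phi\cdot n=0$), $q\cdot n=0$ (i.e. $\nabla\theta\cdot n=0$), and $u\cdot n=0$. In case (iii), in addition, $v\cdot n=0$.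
   Formalization: Case (iii) also assumes ν(∂_n v)·v=0 on ∂Ω (v·n=0 alone fails for a rotating ball); for unbounded Ω the energy density is assumed integrable with dominated time derivative and the energy flux integrable; ∂Ω is taken C². *)

(* Defs.v *)
From HB Require Import structures.
From mathcomp Require Import all_boot all_order all_algebra.
From mathcomp Require Import all_classical all_reals all_analysis.

Set Implicit Arguments.
Unset Strict Implicit.
Unset Printing Implicit Defensive.

Import Order.TTheory GRing.Theory Num.Theory.
Import numFieldNormedType.Exports.

Local Open Scope classical_set_scope.
Local Open Scope ring_scope.

(* Lebesgue measure on R^n: the library has the product sigma-algebra on
   [n.-tuple R] but no measure on it, so it is built by transporting
   [lebesgue_measure \x leb n] along [(a, s) |-> a :: s]. *)
Section lebesgue_tuple.
Context {R : realType}.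
Notation mR := (measurableTypeR R).

Definition tcons n (z : mR * n.-tuple mR) : n.+1.-tuple mR :=
  [the n.+1.-tuple mR of z.1 :: z.2].

Lemma measurable_tcons n : measurable_fun setT (@tcons n).
Proof.
by apply: measurable_cons; [exact: measurable_fst|exact: measurable_snd].
Qed.

Section step.
Variables (n : nat) (m : {sigma_finite_measure set (n.-tuple mR) -> \bar R}).

Definition leb_step : set (n.+1.-tuple mR) -> \bar R :=
  pushforward ((@lebesgue_measure R) \x m)%E (@tcons n).

Let preimage_tcons A : measurable A -> measurable (@tcons n @^-1` A).
Proof. by move=> mA; rewrite -[_ @^-1` _]setTI; exact: measurable_tcons. Qed.

Let leb_step0 : leb_step set0 = 0%E.
Proof. by rewrite /leb_step /pushforward preimage_set0 measure0. Qed.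

Let leb_step_ge0 A : (0 <= leb_step A)%E.
Proof. by rewrite /leb_step /pushforward; exact: measure_ge0. Qed.

Let leb_step_sigma_additive : semi_sigma_additive leb_step.
Proof.
move=> F mF tF mUF; rewrite /leb_step /pushforward preimage_bigcup.
apply: measure_semi_sigma_additive.
- by move=> i; exact: preimage_tcons.
- apply/trivIsetP => /= i j _ _ ij; rewrite -preimage_setI.
  by move/trivIsetP : tF => /(_ _ _ _ _ ij) ->//; rewrite preimage_set0.
- by rewrite -preimage_bigcup; exact: preimage_tcons.
Qed.

HB.instance Definition _ := isMeasure.Build _ _ _ leb_step
  leb_step0 leb_step_ge0 leb_step_sigma_additive.

Let leb_step_sigma_finite : sigma_finite setT leb_step.
Proof.
have /sigma_finiteP[F [TF ndF Foo]] : sigma_finite setT (@lebesgue_measure R).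
  exact: sigma_finiteT.
have /sigma_finiteP[G [TG ndG Goo]] : sigma_finite setT m.
  exact: sigma_finiteT.
pose unc (s : n.+1.-tuple mR) : mR * n.-tuple mR :=
  (tnth s ord0, [tuple of behead s]).
have uncK : cancel (@tcons n) unc.
  by move=> [a s]; congr pair; exact: val_inj.
have munc : measurable_fun setT unc.
  apply/measurable_fun_pairP; split; first exact: measurable_tnth.
  exact: measurable_behead.
exists (fun k => unc @^-1` (F k `*` G k)).
  apply/esym; rewrite -subTset => s _.
  have [i _ Fi] : (\bigcup_i F i) (unc s).1 by rewrite -TF.
  have [j _ Gj] : (\bigcup_i G i) (unc s).2 by rewrite -TG.
  exists (maxn i j) => //; split.
    by move: Fi; exact/subsetPset/ndF/leq_maxl.
  by move: Gj; exact/subsetPset/ndG/leq_maxr.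
move=> k; have [mF Fk] := Foo k; have [mG Gk] := Goo k; split.
  by rewrite -[_ @^-1` _]setTI; apply: munc => //; exact: measurableX.
rewrite /leb_step /pushforward -comp_preimage.
rewrite (_ : unc \o _ = id) ?preimage_id; last first.
  by rewrite funeqE => z; exact: uncK.
by rewrite product_measure1E// lte_mul_pinfty// ge0_fin_numE.
Qed.

HB.instance Definition _ := Measure_isSigmaFinite.Build _ _ _ leb_step
  leb_step_sigma_finite.

End step.

Fixpoint lebesgue_tuple n : {sigma_finite_measure set (n.-tuple mR) -> \bar R} :=
  if n is k.+1 then leb_step (lebesgue_tuple k)
  else \d_([tuple] : 0.-tuple mR).

End lebesgue_tuple.

Definition row_of_tuple {R : realType} {d} (s : d.-tuple (measurableTypeR R)) :
  'rV[R]_d := \row_i tnth s i.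

Definition integral_rV {R : realType} {d} (A : set 'rV[R]_d) (f : 'rV[R]_d -> R)
  : R := (\int[lebesgue_tuple d]_(s in row_of_tuple @^-1` A) f (row_of_tuple s))%R.

Definition integrable_rV {R : realType} {d} (A : set 'rV[R]_d)
    (f : 'rV[R]_d -> R) : Prop :=
  (lebesgue_tuple d).-integrable (row_of_tuple @^-1` A)
    (fun s => (f (row_of_tuple s))%:E).

Fixpoint Ck {R : realType} {V W : normedModType R} (k : nat) (U : set V)
    (f : V -> W) : Prop :=
  if k is m.+1 then
    (forall x, U x -> differentiable f x) /\
    (forall v, Ck m U (fun x => 'D_v f x))
  else forall x, U x -> {for x, continuous f}.

Section calculus.
Context {R : realType} {d : nat}.
Notation E := 'rV[R]_d.
Implicit Types (f : E -> R) (F v : E -> E) (x : E).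

(* The norm [`|x|] of the library on ['rV_d] is the sup norm; the Euclidean
   structure is introduced here. *)
Definition dot (a b : E) : R := \sum_i a 0 i * b 0 i.
Definition sqnorm (a : E) : R := dot a a.

Definition ebase (i : 'I_d) : E := delta_mx 0 i.
Definition component F (i : 'I_d) : E -> R := fun x => F x 0 i.
Definition partial (i : 'I_d) f x : R := 'D_(ebase i) f x.
Definition grad f x : E := \row_i partial i f x.
Definition divergence F x : R := \sum_i partial i (component F i) x.
Definition laplacian F x : E := \row_i divergence (grad (component F i)) x.
(* (v . grad) F *)
Definition advection v F x : E := \row_i dot (v x) (grad (component F i) x).
(* |grad F|^2 = sum over i, j of (d_j F_i)^2 *)
Definition sqnorm_grad F x : R := \sum_i sqnorm (grad (component F i) x).

Definition dt {W : normedModType R} (f : R -> E -> W) (t : R) x : W :=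
  derive1 (f^~ x) t.

End calculus.

(* A domain is either an open connected set with (possibly empty) C^2
   boundary, or, as a bounded domain without boundary, the flat torus. Fields
   on the torus of periods [L] are periodic fields on R^d; they are integrated
   over a fundamental cell. *)
Section domains.
Context {R : realType} {d : nat}.
Notation E := 'rV[R]_d.

Definition boundary (Om : set E) : set E := closure Om `\` interior Om.

(* Near [x] the set [Om] is the sublevel [rho < 0] of a C^2 function with
   nonzero gradient at [x]; the outer unit normal is grad rho / |grad rho|. *)
Definition outer_normal (Om : set E) (x n : E) : Prop :=
  exists (U : set E) (rho : E -> R),
    [/\ open U, U x, Ck 2 U rho, Om `&` U = [set y | rho y < 0] `&` U
      & grad rho x != 0 /\
        n = (Num.sqrt (sqnorm (grad rho x)))^-1 *: grad rho x].

Variant spatial_domain := OpenDomain of set E | FlatTorus of E.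

Definition region (D : spatial_domain) : set E :=
  match D with OpenDomain Om => Om | FlatTorus _ => setT end.

Definition cell (D : spatial_domain) : set E :=
  match D with
  | OpenDomain Om => Om
  | FlatTorus L => [set x | forall i, 0 <= x 0 i < L 0 i]
  end.

Definition regular_domain (D : spatial_domain) : Prop :=
  match D with
  | OpenDomain Om =>
      [/\ open Om, connected Om, Om !=set0
        & forall x, boundary Om x -> exists n, outer_normal Om x n]
  | FlatTorus L => forall i, 0 < L 0 i
  end.

Definition bounded_domain (D : spatial_domain) : Prop :=
  match D with OpenDomain Om => bounded_set Om | FlatTorus _ => True end.

Definition periodic {W : Type} (D : spatial_domain) (T : R) (f : R -> E -> W) :
    Prop :=
  match D with
  | OpenDomain _ => True
  | FlatTorus L => forall t x i, 0 < t < T ->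
      f t (x + L 0 i *: ebase i) = f t x
  end.

(* C^k up to the boundary: C^k on a neighbourhood of ]0, T[ x closure *)
Definition smooth_field {W : normedModType R} (k : nat) (D : spatial_domain)
    (T : R) (f : R -> E -> W) : Prop :=
  periodic D T f /\
  exists U : set (R * E),
    [/\ open U, (forall t x, 0 < t < T -> closure (region D) x -> U (t, x))
      & Ck k U (fun z => f z.1 z.2)].

Definition no_flux (D : spatial_domain) (T : R) (F : R -> E -> E) : Prop :=
  forall t x n, 0 < t < T -> boundary (region D) x ->
    outer_normal (region D) x n -> dot (F t x) n = 0.

Definition space_integral (D : spatial_domain) (f : E -> R) : R :=
  integral_rV (cell D) f.

Definition conserved (T : R) (Etot : R -> R) : Prop :=
  forall t, 0 < t < T -> is_derive t 1 Etot 0.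

(* Conditions at infinity, only used for unbounded domains: the density [e] has
   a finite integral which can be differentiated under the integral sign, and
   the flux [J] is integrable. *)
Definition dominated_density (D : spatial_domain) (T : R) (e : R -> E -> R) :
    Prop :=
  forall t, 0 < t < T ->
    integrable_rV (cell D) (e t) /\
    exists2 G : E -> R, integrable_rV (cell D) G &
      \forall tau \near t, forall x, cell D x -> `|dt e tau x| <= G x.

Definition integrable_flux (D : spatial_domain) (T : R) (J : R -> E -> E) :
    Prop :=
  forall t i, 0 < t < T -> integrable_rV (cell D) (component (J t) i).

End domains.
Arguments spatial_domain : clear implicits.

Section model.
Context {R : realType} {d : nat}.
Notation E := 'rV[R]_d.
Variables (D : spatial_domain R d) (T : R).
(* free energy density, friction parameter, heat conductivity, viscosity *)
Variables (psi : R -> E -> R -> R) (eta kappa : R -> R -> R) (nu : R).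
Variables (phi theta : R -> E -> R).

Definition free_energy t x : R := psi (phi t x) (grad (phi t) x) (theta t x).

Definition dpsi_dphi t x : R :=
  derive1 (fun a => psi a (grad (phi t) x) (theta t x)) (phi t x).
Definition dpsi_dgrad t x : E :=
  grad (fun w => psi (phi t x) w (theta t x)) (grad (phi t) x).
Definition dpsi_dtheta t x : R :=
  derive1 (psi (phi t x) (grad (phi t) x)) (theta t x).

Definition entropy t x : R := - dpsi_dtheta t x.
Definition chem_pot t x : R := divergence (dpsi_dgrad t) x - dpsi_dphi t x.
Definition internal_energy t x : R := free_energy t x + theta t x * entropy t x.

(* Fourier's law, with the sign convention q = k grad theta *)
Definition heat_flux t x : E :=
  kappa (phi t x) (theta t x) *: grad (theta t) x.
Definition entropy_flux t x : E := (theta t x)^-1 *: heat_flux t x.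

Definition friction t x : R := eta (phi t x) (theta t x).
Definition heat_dissipation t x : R :=
  kappa (phi t x) (theta t x) * sqnorm (grad (theta t) x) / theta t x.

Definition solves_A1 (u : R -> E -> E) (Delta : R -> E -> R) : Prop :=
  forall t x, 0 < t < T -> region D x ->
  [/\ dt phi t x + dot (u t x) (grad (phi t) x) = 0,
      - (friction t x * dot (u t x) (grad (phi t) x)) *: grad (phi t) x
        = chem_pot t x *: grad (phi t) x + entropy t x *: grad (theta t) x,
      theta t x * (dt entropy t x + divergence (fun y => entropy t y *: u t y) x)
        = theta t x * divergence (entropy_flux t) x + theta t x * Delta t x
    & theta t x * Delta t x
        = `|dot (u t x) (grad (phi t) x)| ^+ 2 * friction t x
          + heat_dissipation t x].

Definition solves_A2 (u : R -> E -> E) (Delta : R -> E -> R) : Prop :=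
  forall t x, 0 < t < T -> region D x ->
  [/\ dt phi t x + dot (u t x) (grad (phi t) x) = 0,
      - (friction t x * dot (u t x) (grad (phi t) x)) *: grad (phi t) x
        = chem_pot t x *: grad (phi t) x,
      theta t x * dt entropy t x
        = theta t x * divergence (entropy_flux t) x + theta t x * Delta t x
    & theta t x * Delta t x
        = `|dot (u t x) (grad (phi t) x)| ^+ 2 * friction t x
          + heat_dissipation t x].

Definition solves_A3 (u v : R -> E -> E) (p : R -> E -> R)
    (Delta : R -> E -> R) : Prop :=
  forall t x, 0 < t < T -> region D x ->
  [/\ dt phi t x + dot (u t x) (grad (phi t) x) = 0,
      - (friction t x * dot (u t x - v t x) (grad (phi t) x)) *: grad (phi t) x
        = chem_pot t x *: grad (phi t) x,
      dt v t x + advection (v t) (v t) x + grad (p t) x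
        = - (chem_pot t x *: grad (phi t) x) + nu *: laplacian (v t) x
          - entropy t x *: grad (theta t) x /\ divergence (v t) x = 0,
      theta t x * (dt entropy t x + divergence (fun y => entropy t y *: v t y) x)
        = theta t x * divergence (entropy_flux t) x + theta t x * Delta t x
    & theta t x * Delta t x
        = `|dot (u t x - v t x) (grad (phi t) x)| ^+ 2 * friction t x
          + nu * sqnorm_grad (v t) x + heat_dissipation t x].

(* nu times the sum over i of v_i grad v_i; its normal component is the power
   nu (d_n v) . v of the viscous stress at the boundary. Under v . n = 0 alone
   this power need not vanish and energy need not be conserved: with nu > 0, in
   a rigidly rotating ball v . n = 0 and laplacian v = 0, but the heat source
   nu |grad v|^2 is positive. It vanishes for no slip (v = 0) and for free slip
   (d_n v parallel to n). *)
Definition viscous_work (v : R -> E -> E) t x : E :=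
  nu *: \sum_i v t x 0 i *: grad (component (v t) i) x.

Definition kinetic_energy (v : R -> E -> E) t x : R := 2^-1 * sqnorm (v t x).

Definition energy_flux_A1 (u : R -> E -> E) t x : E :=
  (theta t x * entropy t x) *: u t x - heat_flux t x
  - dt phi t x *: dpsi_dgrad t x.

Definition energy_flux_A2 t x : E :=
  - heat_flux t x - dt phi t x *: dpsi_dgrad t x.

Definition energy_flux_A3 (v : R -> E -> E) (p : R -> E -> R) t x : E :=
  (theta t x * entropy t x + kinetic_energy v t x + p t x) *: v t x
  - heat_flux t x - dt phi t x *: dpsi_dgrad t x - viscous_work v t x.

Definition total_energy t : R := space_integral D (internal_energy t).

Definition total_energy_A3 (v : R -> E -> E) t : R :=
  space_integral D (internal_energy t) + space_integral D (kinetic_energy v t).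

Definition admissible_state : Prop :=
  [/\ smooth_field 2 D T phi, smooth_field 2 D T theta,
      (forall t x, 0 < t < T -> closure (region D) x -> 0 < theta t x),
      no_flux D T dpsi_dgrad & no_flux D T heat_flux].

End model.

(* Main.v *)
Require Import Defs.
From HB Require Import structures.
From mathcomp Require Import all_boot all_order all_algebra.
From mathcomp Require Import all_classical all_reals all_analysis.
From mathcomp Require Import measurable_realfun ring lra.

(** Along a solution the energy density satisfies a local conservation law
    [dt e = - div J], where [J] is [energy_flux_A1], [energy_flux_A2] or
    [energy_flux_A3] and where [e] includes the kinetic energy in the third case. It comes
    from the Gibbs relation [dt_internal_energy],
      [dt e = div (dt phi * dpsi_dgrad) - dt phi * mu + theta * dt s].
    The entropy equation replaces the last term by divergences and by the dissipation, of
    which the heat part is absorbed by [divergence_entropy_flux]. The transport equation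
    turns [- dt phi * mu] into [mu * (u . grad phi)], and the force balance, multiplied by
    [u] or by [u - v], cancels this term against the friction. With a background flow the
    momentum equation multiplied by [v] contributes the rate of the kinetic energy, while
    [divergence_viscous_work] combines the viscous heating and the viscous power. These
    are the lemmas [balance_A1], [balance_A2], [balance_A3].

    Every summand of [J] contains a field whose normal component vanishes on the boundary,
    so [J] is tangential there. What remains is that a tangential field has no net flux,
    [divergence_tangential], so that the energy is constant by differentiation under the
    integral sign ([conservation]).

    For tangential fields the flux theorem needs no surface measure. Near a boundary point
    the domain is [rho < 0], and [J] is multiplied by a cutoff [step (- k rho)] that rises
    from 0 to 1 in a layer of width of order [1 / k]. The result has compact support, and
    integrating along lines ([integral_lines0]) shows that its total divergence vanishes.
    The derivative of the cutoff contributes at most [k |J . grad rho|] in the layer.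
    This is bounded, since [J . grad rho] vanishes on the level set [rho = 0] and is
    therefore of order [|rho|] ([flux_density_le]), and it tends to 0 pointwise as [k]
    grows. So dominated convergence gives the claim for fields supported near one point
    ([no_net_boundary]), a finite cover by bumps gives it for compact supports
    ([no_net_compact]), and expanding cutoffs give it for integrable fields on unbounded
    domains. On the flat torus integration along lines and periodicity suffice
    ([integral_partial_periodic]). On bounded domains continuity up to the boundary
    provides the dominations by compactness ([bounded_dominated]). *)

Set Implicit Arguments.
Unset Strict Implicit.
Unset Printing Implicit Defensive.

Import Order.TTheory GRing.Theory Num.Theory.
Import numFieldNormedType.Exports.

Local Open Scope classical_set_scope.
Local Open Scope ring_scope.

(** * Calculus of C^k maps *)

Section Ck_general.
Context {R : realType} {V W : normedModType R}.
Implicit Types (f g : V -> W) (U : set V).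

Lemma Ck_sub k U U' f : U' `<=` U -> Ck k U f -> Ck k U' f.
Proof.
elim: k f => [|k IH] f UU' /=; first by move=> h x /UU'; exact: h.
by move=> [h1 h2]; split=> [x /UU'|v]; [exact: h1|exact: IH].
Qed.

Lemma Ck_differentiable k U f x : Ck k.+1 U f -> U x -> differentiable f x.
Proof. by move=> [h _]; exact: h. Qed.

Lemma Ck_derivable k U f x v : Ck k.+1 U f -> U x -> derivable f x v.
Proof. by move=> [h _] Ux; exact/diff_derivable/h. Qed.

Lemma Ck_derive k U f v : Ck k.+1 U f -> Ck k U (fun x => 'D_v f x).
Proof. by move=> [_]; exact. Qed.

Lemma Ck_continuous k U f x : Ck k U f -> U x -> {for x, continuous f}.
Proof.
by case: k => [h Ux|k [h _] Ux]; [exact: h|exact/differentiable_continuous/h].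
Qed.

(** Near [x] the difference of [f] and [g] vanishes, so it is negligible and has
    zero differential. *)
Lemma near_eq_differentiable f g x :
  (\near x, f x = g x) -> differentiable f x -> differentiable g x.
Proof.
move=> fg /diff_locallyP[cdf fE].
have h0 : (g - f) \o shift x = cst ((g - f) x) + (\0 : V -> W) +o_0 id.
  apply/eqaddoP => _/posnumP[e].
  have fgx : g x - f x = 0 by rewrite (nbhs_singleton fg) subrr.
  have : \forall y \near 0, f (y + x) = g (y + x).
    by move: fg; rewrite (near_shift 0 x)/= subr0.
  apply: filterS => y fgy.
  rewrite [X in `|X|](_ : _ = (g (y + x) - f (y + x)) - ((g x - f x) + 0))//.
  by rewrite fgy fgx !subrr addr0 subr0 normr0 mulr_ge0.
have dh : differentiable (g - f) x.
  have dE : 'd (g - f) x = (\0 : V -> W) :> (V -> W).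
    apply: (@diff_unique _ _ _ _ (\0 : {linear V -> W})) => //.
    exact: cst_continuous.
  by apply/diff_locallyP; rewrite dE; split=> //; exact: cst_continuous.
have -> : g = f + (g - f) by rewrite addrC subrK.
by apply: differentiableD => //; apply/diff_locallyP.
Qed.

Lemma Ck_near_eq k U f g :
  (forall x, U x -> \near x, f x = g x) -> Ck k U f -> Ck k U g.
Proof.
elim: k f g => [|k IH] f g fg /=.
  move=> h x Ux; rewrite /prop_for /continuous_at -(nbhs_singleton (fg _ Ux)).
  by apply: cvg_trans (h _ Ux); apply: near_eq_cvg; exact: fg.
move=> [h1 h2]; split=> [x Ux|v].
  exact: near_eq_differentiable (fg _ Ux) (h1 _ Ux).
apply: IH (h2 v) => x Ux; near=> y; apply: near_eq_derive.
by near: y; apply: (near_join (fg _ Ux)).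
Unshelve. all: by end_near. Qed.

Lemma Ck_ext_open k U f g : open U ->
  (forall x, U x -> f x = g x) -> Ck k U f -> Ck k U g.
Proof.
move=> oU fg; apply: Ck_near_eq => x Ux.
by near=> y; apply: fg; near: y; exact: open_nbhs_nbhs.
Unshelve. all: by end_near. Qed.

(** The values of ['D_v f] outside [U] do not matter for continuity at points of
    [U] because [U] is open. *)
Lemma Ck1_intro U f (df : V -> V -> W) : open U ->
  (forall x, U x -> differentiable f x) ->
  (forall v x, U x -> 'D_v f x = df v x) ->
  (forall v x, U x -> {for x, continuous (df v)}) -> Ck 1 U f.
Proof.
move=> oU h1 h2 h3; split => // v.
by apply: (@Ck_ext_open 0 _ (df v)) => // x Ux; [rewrite h2|exact: h3].
Qed.

End Ck_general.
Arguments Ck_derivable {R V W k U f x} v _ _.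
Arguments Ck_derive {R V W k U f} v _.

Lemma cvg_sumr {R : realType} {T : Type} (F : set_system T) {FF : Filter F}
    (I : finType) (f : I -> T -> R) (l : I -> R) :
  (forall i, f i x @[x --> F] --> l i) ->
  (\sum_i f i x) @[x --> F] --> \sum_i l i.
Proof.
move=> fl; have -> : (fun x => \sum_i f i x) = \sum_i f i by rewrite fct_sumE.
by elim/big_rec2: _ => [|i g h _ ih]; [exact: cvg_cst|exact: cvgD].
Qed.

Section Ck1_algebra.
Context {R : realType} {V : normedModType R}.
Variable U : set V.
Hypothesis oU : open U.
Implicit Types (f g : V -> R).

Lemma Ck1_cst (W : normedModType R) (a : W) : Ck 1 U (fun _ => a).
Proof.
apply: (@Ck1_intro _ _ _ _ _ (fun _ _ => 0)) => //.
- by move=> v x _; rewrite derive_cst.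
- by move=> v x _; exact: cst_continuous.
Qed.

Lemma Ck1D f g : Ck 1 U f -> Ck 1 U g -> Ck 1 U (fun x => f x + g x).
Proof.
move=> hf hg.
apply: (@Ck1_intro _ _ _ _ _ (fun v x => 'D_v f x + 'D_v g x)) => // [x Ux|v x Ux|v x Ux].
- exact: differentiableD (Ck_differentiable hf Ux) (Ck_differentiable hg Ux).
- rewrite -[LHS]/('D_v (f + g) x) deriveD//; first exact: (Ck_derivable v hf Ux).
  exact: (Ck_derivable v hg Ux).
- by apply: cvgD; [exact: (Ck_derive v hf)|exact: (Ck_derive v hg)].
Qed.

Lemma Ck1M f g : Ck 1 U f -> Ck 1 U g -> Ck 1 U (fun x => f x * g x).
Proof.
move=> hf hg.
apply: (@Ck1_intro _ _ _ _ _ (fun v x => f x * 'D_v g x + g x * 'D_v f x))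
  => // [x Ux|v x Ux|v x Ux].
- exact: differentiableM (Ck_differentiable hf Ux) (Ck_differentiable hg Ux).
- rewrite -[LHS]/('D_v (f * g) x) deriveM//; first exact: (Ck_derivable v hf Ux).
  exact: (Ck_derivable v hg Ux).
- by apply: cvgD; apply: cvgM; [exact: (Ck_continuous hf)|exact: (Ck_derive v hg)
   |exact: (Ck_continuous hg)|exact: (Ck_derive v hf)].
Qed.

Lemma Ck1N f : Ck 1 U f -> Ck 1 U (fun x => - f x).
Proof.
move=> hf; have := Ck1M (Ck1_cst (-1 : R)) hf.
by congr Ck; apply/funext => x; rewrite mulN1r.
Qed.

Lemma Ck1B f g : Ck 1 U f -> Ck 1 U g -> Ck 1 U (fun x => f x - g x).
Proof. by move=> hf hg; apply: Ck1D hf (Ck1N hg). Qed.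

Lemma Ck1_sum (I : finType) (F : I -> V -> R) :
  (forall i, Ck 1 U (F i)) -> Ck 1 U (fun x => \sum_i F i x).
Proof.
move=> hF; have -> : (fun x => \sum_i F i x) = \sum_i F i by rewrite fct_sumE.
elim/big_rec: _ => [|i g _ hg]; first exact: (Ck1_cst (0 : R)).
exact: (Ck1D (hF i) hg).
Qed.

Lemma Ck1V f : (forall x, U x -> f x != 0) -> Ck 1 U f -> Ck 1 U (fun x => (f x)^-1).
Proof.
move=> f0 hf.
apply: (@Ck1_intro _ _ _ _ _ (fun v x => - f x ^- 2 * 'D_v f x)) => // [x Ux|v x Ux|v x Ux].
- exact: differentiableV (Ck_differentiable hf Ux) (f0 _ Ux).
- by rewrite deriveV//; [exact: f0|exact: (Ck_derivable v hf Ux)].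
- apply: cvgM; last exact: (Ck_derive v hf).
  apply: cvgN; apply: cvgV; first by rewrite expf_neq0// f0.
  by apply: cvgM; exact: (Ck_continuous hf).
Qed.

End Ck1_algebra.

Section chain_rule.
Context {R : realType} {V X : normedModType R} {I : finType}.
Variables (b : I -> X) (c : I -> V -> R).
Let F (z : V) : X := \sum_i c i z *: b i.

Lemma diff_coordinates (x : V) : (forall i, differentiable (c i) x) ->
  differentiable F x /\ forall v, 'd F x v = \sum_i 'D_v (c i) x *: b i.
Proof.
move=> dc.
have hi i : is_diff x (fun z => c i z *: b i) (fun v => 'd (c i) x v *: b i).
  by apply: DiffDef; [exact: differentiableZl|exact: diffZl].
have FE : F = \sum_i (fun z => c i z *: b i) by rewrite fct_sumE.
suff [dF ->] : is_diff x F (\sum_i (fun v => 'd (c i) x v *: b i)).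
  split => // v; rewrite fct_sumE; apply: eq_bigr => i _.
  by rewrite deriveE.
rewrite FE; elim/big_rec2: _ => [|i g h _ ih]; first exact: is_diff_cst.
exact: is_diffD.
Qed.

Variables (U : set V) (U' : set X) (g : X -> R).
Hypotheses (oU : open U) (hc : forall i, Ck 1 U (c i)) (hg : Ck 1 U' g)
  (UU' : forall x, U x -> U' (F x)).

(** The inner map is given by its coordinates [c] along fixed vectors [b], so that
    only the directional derivatives of [g] along the [b i] occur, and continuity of
    these is what [Ck 1] provides. *)
Lemma derive_comp_coordinates v x : U x ->
  'D_v (fun z => g (F z)) x = \sum_i 'D_v (c i) x * 'D_(b i) g (F x).
Proof.
move=> Ux.
have [dF dFE] := diff_coordinates (fun i => Ck_differentiable (hc i) Ux).
have dg := Ck_differentiable hg (UU' Ux).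
rewrite deriveE; last exact: (differentiable_comp dF dg).
rewrite (diff_comp dF dg) /= dFE linear_sum; apply: eq_bigr => i _.
by rewrite linearZ (deriveE (b i) dg).
Qed.

Lemma Ck1_comp_coordinates : Ck 1 U (fun z => g (F z)).
Proof.
apply: (@Ck1_intro _ _ _ _ _ (fun v x => \sum_i 'D_v (c i) x * 'D_(b i) g (F x)))
  => // [x Ux|v x Ux|v x Ux].
- have [dF _] := diff_coordinates (fun i => Ck_differentiable (hc i) Ux).
  exact: (differentiable_comp dF (Ck_differentiable hg (UU' Ux))).
- exact: derive_comp_coordinates.
- have [dF _] := diff_coordinates (fun i => Ck_differentiable (hc i) Ux).
  apply: (@cvg_sumr R V (nbhs x) _ I (fun i x => 'D_v (c i) x * 'D_(b i) g (F x))) => i.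
  apply: cvgM; first exact: (Ck_derive v (hc i)).
  apply: (@continuous_comp _ _ _ F (fun y => 'D_(b i) g y)).
    exact: differentiable_continuous.
  exact: (Ck_derive (b i) hg _ (UU' Ux)).
Qed.

End chain_rule.

Section affine.
Context {R : realType}.

(** The two difference quotients are the same function of [h]. *)
Lemma growth_affine (X V W : normedModType R) (L : X -> V) (G : V -> W) x e v :
  (forall h : R, L (h *: e + x) = h *: v + L x) ->
  'D_e (G \o L) x = 'D_v G (L x) /\
  (derivable G (L x) v -> derivable (G \o L) x e).
Proof.
move=> LE; rewrite /derive /derivable /=.
suff -> : (fun h => h^-1 *: ((G \o L \o shift x) (h *: e) - G (L x))) =
          (fun h => h^-1 *: ((G \o shift (L x)) (h *: v) - G (L x))) by [].
by apply/funext => h /=; rewrite LE.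
Qed.

Lemma derive_affine (X V W : normedModType R) (L : X -> V) (G : V -> W) x e v :
  (forall h : R, L (h *: e + x) = h *: v + L x) ->
  'D_e (fun y => G (L y)) x = 'D_v G (L x).
Proof. by move=> /(growth_affine G)[]. Qed.

(** Used for the restriction of a function of time and space to a slice. *)
Lemma Ck_affine (X V W : normedModType R) (L : X -> V) (l : X -> V) k U
    (G : V -> W) :
  (forall x, differentiable L x) ->
  (forall (h : R) e x, L (h *: e + x) = h *: l e + L x) ->
  Ck k U G -> Ck k (L @^-1` U) (fun y => G (L y)).
Proof.
move=> dL LE; elim: k G => [|k IH] G /=.
  move=> h x Ux; apply: (@continuous_comp _ _ _ L G).
    exact: differentiable_continuous.
  exact: h.
move=> [h1 h2]; split=> [x Ux|e].
  exact: (differentiable_comp (dL x) (h1 _ Ux)).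
have -> : (fun x => 'D_e (fun y => G (L y)) x) = (fun x => 'D_(l e) G (L x)).
  by apply/funext => x; apply: derive_affine => h; exact: LE.
exact: (IH (fun y => 'D_(l e) G y) (h2 (l e))).
Qed.

Lemma MVT_line (V : normedModType R) (G : V -> R) (p u : V) (h : R) : 0 < h ->
  (forall s, 0 <= s <= h -> differentiable G (s *: u + p)) ->
  exists2 s, 0 < s < h & G (h *: u + p) - G p = 'D_u G (s *: u + p) * h.
Proof.
move=> h0 dG.
pose L (s : R) : V := s *: u + p.
have LE (s k : R) : L (k *: (1 : R) + s) = k *: u + L s.
  by rewrite /L scalerDl addrA scaler1.
have dGL s : 0 <= s <= h -> is_derive s 1 (G \o L) ('D_u G (L s)).
  move=> hs; have [h1 h2] := growth_affine G (LE s).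
  by rewrite -h1; apply: DeriveDef => //; apply: h2; exact/diff_derivable/dG.
have [||s sh] := @MVT R (G \o L) (fun s => 'D_u G (L s)) 0 h h0.
- by move=> s; rewrite in_itv/= => /andP[s0 sh]; apply: dGL; rewrite !ltW.
- apply: (@derivable_within_continuous _ _ _ `[0, h]) => s; rewrite in_itv/= => hs.
  by case: (dGL s hs).
rewrite subr0 /= {1 2}/L scale0r add0r => E; exists s => //.
Qed.

(** The mean value theorem is used twice: along [w] for
    [y |-> F (h v + y) - F y], then along [v] for ['D_w F]. *)
Lemma second_difference (V : normedModType R) (U : set V) (F : V -> R) (z v w : V) (h : R) :
  0 < h -> Ck 2 U F ->
  (forall s t, 0 <= s <= h -> 0 <= t <= h -> U (s *: v + (t *: w + z))) ->
  exists s t, [/\ 0 <= s <= h, 0 <= t <= h &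
    F (h *: v + (h *: w + z)) - F (h *: v + z) - F (h *: w + z) + F z =
    'D_v (fun y => 'D_w F y) (s *: v + (t *: w + z)) * h * h].
Proof.
move=> h0 [dF d2F] hU.
pose sh y := h *: v + y.
have hh : 0 <= h <= h by rewrite lexx ltW.
have z0 : 0 <= (0 : R) <= h by rewrite lexx ltW.
have dsh y : differentiable sh y by exact: differentiableD.
have Ut t : 0 <= t <= h -> U (t *: w + z).
  by move=> ht; have := hU _ _ z0 ht; rewrite scale0r add0r.
have d1 t : 0 <= t <= h -> differentiable (F \o sh) (t *: w + z).
  by move=> ht; apply: differentiable_comp => //; apply: dF; exact: hU.
have d2 t : 0 <= t <= h -> differentiable F (t *: w + z).
  by move=> ht; apply: dF; exact: Ut.
have [|t /andP[t0 th]] := @MVT_line _ ((F \o sh) - F) z w h h0.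
  by move=> s hs; apply: differentiableB; [exact: d1|exact: d2].
have ht : 0 <= t <= h by rewrite !ltW.
rewrite deriveB; [|exact/diff_derivable/d1|exact/diff_derivable/d2].
rewrite (@derive_affine _ _ _ sh F _ w w); last first.
  by move=> k; rewrite /sh addrCA.
have [|s /andP[s0 sh'] E2] := @MVT_line _ (fun y => 'D_w F y) (t *: w + z) v h h0.
  by move=> s hs; have [+ _] := d2F w; apply; exact: hU.
rewrite /sh E2 /= => E; exists s, t; split => //; first by rewrite !ltW.
rewrite -E !fctE /=.
rewrite /sh; ring.
Qed.

(** Symmetry of second derivatives: the second difference of [F] over a small
    parallelogram does not depend on the order of the sides, and it is a nearby value of
    either mixed derivative. *)
Lemma derive_comm (V : normedModType R) (U : set V) (F : V -> R) (z v w : V) :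
  open U -> Ck 2 U F -> U z ->
  'D_v (fun y => 'D_w F y) z = 'D_w (fun y => 'D_v F y) z.
Proof.
move=> oU hF Uz; apply/eqP; rewrite -subr_eq0 -normr_le0.
apply/ler_addgt0Pr => _/posnumP[e]; rewrite add0r.
have c2 a b : {for z, continuous (fun y => 'D_a (fun x => 'D_b F x) y)}.
  exact: (Ck_derive a (Ck_derive b hF) _ Uz).
have e2 : 0 < e%:num / 2 by rewrite divr_gt0.
have near2 a b : \forall y \near z,
    `|'D_a (fun x => 'D_b F x) z - 'D_a (fun x => 'D_b F x) y| < e%:num / 2.
  have /cvgrPdist_lt := c2 a b; exact.
have : \forall y \near z, [/\ U y,
    `|'D_v (fun x => 'D_w F x) z - 'D_v (fun x => 'D_w F x) y| < e%:num / 2 &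
    `|'D_w (fun x => 'D_v F x) z - 'D_w (fun x => 'D_v F x) y| < e%:num / 2].
  have nU : nbhs z U by exact: open_nbhs_nbhs.
  by apply: filterS3 nU (near2 v w) (near2 w v) => y.
move=> /nbhs_ballP[r /= r0 hr].
pose h := r / (1 + `|v| + `|w|).
have N0 : 0 < 1 + `|v| + `|w| by rewrite -addrA ltr_pwDl.
have h0 : 0 < h by rewrite divr_gt0.
have hb a b s t : h * (`|a| + `|b|) < r -> 0 <= s <= h -> 0 <= t <= h ->
    ball z r (s *: a + (t *: b + z)).
  move=> hab /andP[s0 sh] /andP[t0 th]; rewrite -ball_normE /ball_ /=.
  rewrite distrC addrA addrK (le_lt_trans (ler_normD _ _))//.
  rewrite (le_lt_trans _ hab)// !normrZ !ger0_norm// mulrDr.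
  by rewrite lerD// ler_wpM2r.
have hvw : h * (`|v| + `|w|) < r.
  rewrite /h mulrAC ltr_pdivrMr// ltr_pM2l//; lra.
have hwv : h * (`|w| + `|v|) < r by rewrite addrC.
have [|s [t [hs ht E1]]] := @second_difference V U F z v w h h0 hF.
  by move=> s t hs ht; have [] := hr _ (hb v w s t hvw hs ht).
have [|s' [t' [hs' ht' E2]]] := @second_difference V U F z w v h h0 hF.
  by move=> s' t' hs' ht'; have [] := hr _ (hb w v s' t' hwv hs' ht').
have [_ A1 _] := hr _ (hb v w s t hvw hs ht).
have [_ _ A2] := hr _ (hb w v s' t' hwv hs' ht').
move: A1 A2 E1 E2; set a := 'D_v _ z; set c := 'D_v _ _; set b := 'D_w _ z.
set c' := 'D_w _ _; clearbody a b c c' => A1 A2 E1 E2.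
have E : c * h * h = c' * h * h.
  by rewrite -E1 -E2 (addrCA (h *: v)); congr (_ + _); rewrite addrAC.
have {E} cc' : c = c' by apply: (mulIf (lt0r_neq0 h0)); exact: (mulIf (lt0r_neq0 h0)) E.
(* c is a common value of both mixed derivatives near z *)
rewrite [e%:num]splitr -(subrKA c) (le_trans (ler_normD _ _))//.
by rewrite lerD// ?(ltW A1)// cc' distrC ltW.
Qed.

End affine.

Lemma CkU {R : realType} {V W : normedModType R} k (U U' : set V) (f : V -> W) :
  Ck k U f -> Ck k U' f -> Ck k (U `|` U') f.
Proof.
elim: k f => [|k IH] f /=; first by move=> h h' x [/h|/h'].
by move=> [h1 h2] [h1' h2']; split=> [x [/h1|/h1']//|v]; exact: IH.
Qed.

Lemma CkS {R : realType} {V W : normedModType R} k (U : set V) (f : V -> W) :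
  Ck k.+1 U f = ((forall x, U x -> differentiable f x) /\
                 forall v, Ck k U (fun x => 'D_v f x)).
Proof. by []. Qed.

Lemma Ck0E {R : realType} {V W : normedModType R} (U : set V) (f : V -> W) :
  Ck 0 U f = (forall x, U x -> {for x, continuous f}).
Proof. by []. Qed.

Lemma Ck_pred {R : realType} {V W : normedModType R} k (U : set V) (f : V -> W) :
  Ck k.+1 U f -> Ck k U f.
Proof.
elim: k f => [|k IH] f; first by move=> h; rewrite Ck0E => x; exact: Ck_continuous h.
by rewrite CkS => -[h1 h2]; rewrite CkS; split => // v; apply: IH; exact: h2.
Qed.

Opaque Ck derive.

(** Near a point outside [C] the product vanishes identically, whatever [g] does
    there. *)
Lemma Ck1_cutoff {R : realType} {V : normedModType R} (U C : set V)
    (b g : V -> R) : open U -> closed C -> C `<=` U ->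
  Ck 1 setT b -> (forall x, ~ C x -> b x = 0) -> Ck 1 U g ->
  Ck 1 setT (fun x => b x * g x).
Proof.
move=> oU cC CU hb b0 hg.
rewrite (_ : setT = U `|` ~` C); last first.
  by apply/esym; rewrite -subTset => x _; have [/CU|] := pselect (C x); [left|right].
apply: (@CkU _ _ _ 1 U (~` C)).
  exact: (@Ck1M _ _ U oU b g (Ck_sub (@subsetT _ U) hb) hg).
have oC : open (~` C) by exact: closed_openC.
apply: (@Ck_ext_open _ _ _ 1 _ (fun _ => 0) _ oC); last exact: Ck1_cst.
by move=> x nCx; rewrite b0// mul0r.
Qed.

(** * Lebesgue measure and integration by lines *)

Section lebesgue_tuple_facts.
Context {R : realType}.
Notation mR := (measurableTypeR R).

Lemma measurable_row_box n (c : 'I_n -> R) (e : R) :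
  measurable [set s : n.-tuple mR | forall i, `|tnth s i - c i| < e].
Proof.
rewrite (_ : mkset _ = \bigcap_(i in [set: 'I_n])
    ((fun s : n.-tuple mR => tnth s i) @^-1` `]c i - e, c i + e[%classic)); last first.
  apply/seteqP; split=> [s /= h i _ /=|s /= h i].
    by rewrite in_itv/= -ltr_distl.
  by have := h i I; rewrite /= in_itv/= -ltr_distl.
apply: fin_bigcap_measurable; first exact: finite_finset.
move=> i _; rewrite -[X in measurable X]setTI.
by apply: (@measurable_tnth _ mR n i) => //; exact: measurable_itv.
Qed.

(** An open set is the union of the countably many boxes with rational centre and
    radius [1 / (k + 1)] that it contains. *)
Lemma open_measurable_row n (A : set 'rV[R]_n) :
  open A -> measurable (row_of_tuple @^-1` A).
Proof.
move=> oA.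
pose box (q : 'rV[rat]_n * nat) : set (n.-tuple mR) :=
  [set s | forall i, `|tnth s i - ratr (q.1 0 i)| < q.2.+1%:R^-1].
rewrite (_ : _ @^-1` _ = \bigcup_(q in [set: 'rV[rat]_n * nat])
    (if `[< box q `<=` row_of_tuple @^-1` A >] then box q else set0)); last first.
  apply/seteqP; split=> [s /= As|s [q _]]; last by case: asboolP => // + /[dup] h; apply.
  have /nbhs_ballP[e /= e0 he] : nbhs (row_of_tuple s) A by exact: open_nbhs_nbhs.
  have [k hk] : exists k, k.+1%:R^-1 < e / 2.
    have := @ltr_add_invr R 0 (e / 2); rewrite divr_gt0// => /(_ isT)[k].
    by rewrite add0r; exists k.
  have q_ i : {q : rat | `|tnth s i - ratr q| < k.+1%:R^-1}.
    apply/cid; have : tnth s i - k.+1%:R^-1 < tnth s i + k.+1%:R^-1 :> R.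
      by rewrite ltrD2l gtrN.
    by move=> /rat_in_itvoo[q]; rewrite in_itv/= -ltr_distl distrC => hq; exists q.
  exists (\row_i sval (q_ i), k) => //.
  have hbox : box (\row_i sval (q_ i), k) `<=` row_of_tuple @^-1` A.
    move=> s' /= hs'; apply: he; split=> // i j.
    rewrite !mxE /ball /=.
    have := hs' j; rewrite mxE => h1; have h2 := svalP (q_ j).
    rewrite (le_lt_trans (ler_distD (ratr (sval (q_ j))) _ _))//.
    rewrite [e]splitr ltrD//; first exact: lt_trans h2 hk.
    by rewrite distrC (lt_trans h1).
  rewrite asboolT//= => i; rewrite mxE; exact: (svalP (q_ i)).
apply: countable_bigcupT_measurable => //= q.
by case: asboolP => // _; exact: measurable_row_box.
Qed.

Lemma measurable_fun_row n (U : set 'rV[R]_n) (f : 'rV[R]_n -> R) : open U ->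
  (forall x, U x -> {for x, continuous f}) ->
  measurable_fun (row_of_tuple @^-1` U) (fun s : n.-tuple mR => f (row_of_tuple s)).
Proof.
move=> oU cf; apply: (measurability _ (RGenOpens.measurableE R)).
move=> _ [_ [a [b ->] <-]].
rewrite (_ : _ `&` _ = row_of_tuple @^-1` (U `&` f @^-1` `]a, b[%classic))//.
apply: open_measurable_row; rewrite openE => x [Ux fx].
apply: filterI; first exact: open_nbhs_nbhs.
by apply: (cf _ Ux); apply: open_nbhs_nbhs; split => //; exact: interval_open.
Qed.

Definition tbox n (M : R) : set (n.-tuple mR) :=
  [set s | forall i, `|tnth s i| <= M].

Lemma measurable_tbox n M : measurable (@tbox n M).
Proof.
rewrite (_ : tbox M = \bigcap_(i in [set: 'I_n])
    ((fun s : n.-tuple mR => tnth s i) @^-1` `[- M, M]%classic)); last first.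
  apply/seteqP; split=> [s /= h i _ /=|s /= h i].
    by rewrite in_itv/= -ler_norml; exact: h.
  by have := h i I; rewrite /= in_itv/= -ler_norml.
apply: fin_bigcap_measurable; first exact: finite_finset.
move=> i _; rewrite -[X in measurable X]setTI.
by apply: (@measurable_tnth _ mR n i) => //; exact: measurable_itv.
Qed.

Lemma tbox_finite n M : (lebesgue_tuple n (@tbox n M) < +oo)%E.
Proof.
elim: n => [|n IH] /=; first by rewrite diracE; case: (_ \in _); rewrite ltry.
rewrite /leb_step /pushforward.
rewrite (_ : _ @^-1` _ = `[- M, M]%classic `*` @tbox n M); last first.
  apply/seteqP; split=> [[a s] /= h|[a s] /= [ha hs] i].
    split; first by rewrite in_itv/= -ler_norml; exact: (h ord0).
    by move=> i /=; have := h (lift ord0 i); rewrite tnthS.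
  have [j ->|->] := unliftP ord0 i; first by rewrite tnthS; exact: hs.
  by move: ha; rewrite in_itv/= -ler_norml tnth0.
rewrite product_measure1E//; last exact: measurable_tbox.
rewrite lte_mul_pinfty//.
rewrite ge0_fin_numE// [X in (X < _)%E](@lebesgue_measure_itv R `[- M, M]) /=.
by  case: ifP; rewrite ?ltry// -EFinB ltry.
Qed.

End lebesgue_tuple_facts.

Section lines.
Context {R : realType}.
Notation mR := (measurableTypeR R).

Lemma integrable_bounded_tbox d (T : measurableType d)
    (mu : {measure set T -> \bar R}) (A : set T) (g : T -> R) (C : R) :
  measurable A -> (mu A < +oo)%E -> measurable_fun setT g ->
  (forall s, `|g s| <= C) -> (forall s, ~ A s -> g s = 0) ->
  mu.-integrable setT (EFin \o g).
Proof.
move=> mA Aoo mg gC g0.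
have -> : EFin \o g = (EFin \o g) \_ A.
  apply/funext => s; rewrite patchE; case: ifPn => // /negP nAs /=.
  by rewrite g0// => As; apply: nAs; rewrite inE.
apply/(integrable_mkcond _ mA).
apply: measurable_bounded_integrable => //; first exact: measurable_funS mg.
exists C; split; first exact: num_real.
by move=> x Cx s _ /=; rewrite (le_trans (gC s))// ltW.
Qed.

Definition tset n (s : n.-tuple mR) (i : 'I_n) (a : mR) : n.-tuple mR :=
  [tuple (if j == i then a else tnth s j) | j < n].

Lemma tset0 n (x a : mR) (s : n.-tuple mR) :
  tset (tcons (x, s)) ord0 a = tcons (a, s).
Proof.
apply: eq_from_tnth => j; rewrite tnth_mktuple.
by have [k ->|->] := unliftP ord0 j; rewrite ?eqxx ?tnth0// !tnthS.
Qed.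

Lemma tset_lift n (x a : mR) (s : n.-tuple mR) i :
  tset (tcons (x, s)) (lift ord0 i) a = tcons (x, tset s i a).
Proof.
apply: eq_from_tnth => j; rewrite tnth_mktuple.
have [k ->|->] := unliftP ord0 j; last by rewrite !tnth0.
by rewrite !tnthS (inj_eq lift_inj) tnth_mktuple.
Qed.

(** Fubini's theorem with the [i]-th coordinate integrated first. The induction
    peels off one coordinate at a time, as in the construction of the measure. *)
Lemma integral_lines0 n (g : n.-tuple mR -> R) (i : 'I_n) (M C : R) :
  measurable_fun setT g -> (forall s, `|g s| <= C) ->
  (forall s, ~ tbox M s -> g s = 0) ->
  (forall s, \int[@lebesgue_measure R]_a (g (tset s i a))%:E = 0)%E ->
  (\int[lebesgue_tuple n]_s (g s)%:E = 0)%E.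
Proof.
elim: n g i => [|n IH] g i mg gC g0 gi; first by case: i gi.
have mtc : measurable_fun setT (@tcons R n) := @measurable_tcons R n.
have mgt : measurable_fun setT (g \o @tcons R n) by exact: measurableT_comp.
have ig : ((@lebesgue_measure R) \x (lebesgue_tuple n))%E.-integrable setT
    (EFin \o (g \o @tcons R n)).
  apply: (@integrable_bounded_tbox _ _ _ (@tcons R n @^-1` tbox M) _ C) => //=.
  - rewrite -[X in measurable X]setTI; apply: mtc => //; exact: measurable_tbox.
  - exact: (@tbox_finite R n.+1 M).
  - by move=> s hs; apply: g0.
transitivity (\int[((@lebesgue_measure R) \x (lebesgue_tuple n))]_z
   (g (tcons z))%:E)%E.
  rewrite /= /leb_step integral_pushforward//=; first exact/measurable_EFinP.
have [j ij|i0] := unliftP ord0 i.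
  rewrite -integral12_prod_meas1//; apply: integral0_eq => x _.
  apply: (IH (fun s => g (tcons (x, s))) j) => //.
  - apply: (measurableT_comp mgt); exact: pair1_measurable.
  - move=> s hs; apply: g0 => h; apply: hs => k.
    by have := h (lift ord0 k); rewrite tnthS.
  - move=> s; rewrite -[RHS](gi (tcons (x, s))).
    by apply: eq_integral => a _; rewrite ij tset_lift.
rewrite -integral21_prod_meas1//; apply: integral0_eq => y _.
rewrite -[RHS](gi (tcons (0, y))).
by apply: eq_integral => a _; rewrite i0 tset0.
Qed.

End lines.

Section partial_integrals.
Context {R : realType}.
Notation mR := (measurableTypeR R).

Lemma rV_norm_le n (x : 'rV[R]_n) (M : R) : 0 <= M ->
  `|x| <= M <-> forall j, `|x 0 j| <= M.
Proof.
move=> M0; rewrite [`|x|]/Num.Def.normr/= mx_normrE; split=> [h j|h].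
  by apply: le_trans h; exact: (@le_bigmax _ _ _ 0 (fun ij => `|x ij.1 ij.2|) (0, j)).
by apply: bigmax_le => // -[i j] _ /=; rewrite ord1.
Qed.

Lemma rV_coord_le n (x : 'rV[R]_n) j : `|x 0 j| <= `|x|.
Proof. by apply: (rV_norm_le x (normr_ge0 x)).1. Qed.

Arguments rV_coord_le {n} x j.

Lemma tbox_row n (s : n.-tuple mR) (M : R) : 0 <= M ->
  tbox M s <-> `|row_of_tuple s| <= M.
Proof.
move=> M0; rewrite rV_norm_le//; split=> h i; first by rewrite mxE; exact: h.
by have := h i; rewrite mxE.
Qed.

Lemma compact_norm_le n (M : R) : compact [set x : 'rV[R]_n | `|x| <= M].
Proof.
apply: bounded_closed_compact.
  by exists M; split; [exact: num_real|move=> N MN x /= h; rewrite (le_trans h)// ltW].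
rewrite (_ : mkset _ = (fun x : 'rV[R]_n => `|x|) @^-1` [set y | y <= M])//.
by apply: closed_comp; [move=> x _; exact: norm_continuous|exact: closed_le].
Qed.

Lemma compact_le (T : topologicalType) (K : set T) (f : T -> R) : compact K ->
  (forall x, K x -> {for x, continuous f}) ->
  exists2 C, 0 <= C & forall x, K x -> `|f x| <= C.
Proof.
move=> cK cf.
have [->|K0] := eqVneq K set0; first by exists 0.
have cfK : {within K, continuous (fun x => `|f x|)}.
  apply: continuous_in_subspaceT => x /set_mem Kx.
  by apply: (@continuous_comp _ _ _ f); [exact: cf|exact: norm_continuous].
have [|c cc hc] := compact_EVT_max _ cK cfK; first exact/set0P.
by exists `|f c| => // x Kx; apply: hc; rewrite inE.
Qed.

Lemma bounded_supp n (f : 'rV[R]_n -> R) M : continuous f ->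
  (forall x, M < `|x| -> f x = 0) -> exists2 C, 0 <= C & forall x, `|f x| <= C.
Proof.
move=> cf f0.
have [|C C0 hC] := @compact_le _ _ f (@compact_norm_le n M) => [x _|]; first exact: cf.
exists C => // x; have [xM|/f0->] := leP `|x| M; first exact: hC.
by rewrite normr0.
Qed.

Lemma partial_supp n (f : 'rV[R]_n -> R) i M :
  (forall x, M < `|x| -> f x = 0) -> forall x, M < `|x| -> partial i f x = 0.
Proof.
move=> f0 x Mx; rewrite /partial (@near_eq_derive _ _ _ f (fun _ => 0)).
  exact: derive_cst.
have : nbhs x ((fun y => `|y|) @^-1` [set y : R | M < y]).
  apply: open_nbhs_nbhs; split=> //; apply: open_comp; last exact: open_gt.
  by move=> y _; exact: norm_continuous.
by apply: filterS => y; exact: f0.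
Qed.

Lemma integral_derive_line (V : normedModType R) (f : V -> R) (p u : V) (a b : R) :
  a < b -> Ck 1 setT f ->
  (\int[@lebesgue_measure R]_(s in `[a, b]) ('D_u f (s *: u + p))%:E =
   (f (b *: u + p) - f (a *: u + p))%:E)%E.
Proof.
move=> ab hf.
pose L (s : R) := s *: u + p.
have LE (s k : R) : L (k *: (1 : R) + s) = k *: u + L s.
  by rewrite /L scalerDl addrA scaler1.
have cL : continuous L.
  by move=> s; apply: cvgD; [exact: scalel_continuous|exact: cvg_cst].
have dfL s : derivable (f \o L) s 1.
  by have [_] := growth_affine f (LE s); apply; exact: (Ck_derivable _ hf).
have cfL : continuous (f \o L).
  by move=> s; apply/differentiable_continuous/derivable1_diffP.
have cD : {within `[a, b], continuous (fun s => 'D_u f (s *: u + p))}.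
  apply: continuous_subspaceT => s.
  apply: (@continuous_comp _ _ _ L (fun x => 'D_u f x)); first exact: cL.
  by have := Ck_derive u hf; rewrite Ck0E; exact.
have DfL : {in `]a, b[, derive1 (f \o L) =1 (fun s => 'D_u f (s *: u + p))}.
  by move=> s _; rewrite derive1E; exact: (derive_affine _ (LE s)).
have dfLR : derivable_oo_LRcontinuous (f \o L) a b.
  by split => [s _||]; [exact: dfL|exact/cvg_at_right_filter/cfL
    |exact/cvg_at_left_filter/cfL].
by rewrite (continuous_FTC2 ab cD dfLR DfL) -EFinB.
Qed.

Lemma row_tset n (s : n.-tuple mR) i a :
  row_of_tuple (tset s i a) = a *: ebase i + row_of_tuple (tset s i 0).
Proof.
apply/rowP => j; rewrite !mxE !tnth_mktuple eqxx /=.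
by case: (j == i); rewrite ?mulr1 ?addr0 ?mulr0 ?add0r.
Qed.

Lemma Ck1_partial_continuous n U (f : 'rV[R]_n -> R) i x : Ck 1 U f -> U x ->
  {for x, continuous (partial i f)}.
Proof. by move=> /(Ck_derive (ebase i)); rewrite Ck0E; exact. Qed.

(** Along a line parallel to the [i]-th axis the integral is the difference of two
    values of [f] outside its support. *)
Lemma integral_partial_supp n (f : 'rV[R]_n -> R) i M : Ck 1 setT f ->
  (forall x, M < `|x| -> f x = 0) ->
  (\int[lebesgue_tuple n]_s (partial i f (row_of_tuple s))%:E = 0)%E.
Proof.
move=> hf f0.
wlog M0 : M f0 / 0 <= M => [h|].
  by apply: (h `|M|) => // x hx; apply: f0; rewrite (le_lt_trans (ler_norm _) hx).
have cp : continuous (partial i f).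
  by move=> x; exact: (Ck1_partial_continuous hf I).
have p0 := @partial_supp n f i M f0.
have [C C0 hC] := bounded_supp cp p0.
apply: (@integral_lines0 _ _ _ i M C) => //.
- rewrite -[setT]/(row_of_tuple @^-1` setT); apply: measurable_fun_row.
    exact: openT.
  by move=> x _; exact: cp.
- move=> s nb; apply: p0; rewrite ltNge; apply/negP => h; apply: nb.
  by have [_] := tbox_row s M0; apply.
move=> s; pose p := row_of_tuple (tset s i 0).
under eq_integral do rewrite row_tset -/p.
have hL a : M + 1 <= `|a| -> f (a *: ebase i + p) = 0.
  move=> Ma; apply: f0; rewrite (lt_le_trans _ (rV_coord_le _ i))//.
  rewrite !mxE !tnth_mktuple !eqxx mulr1 addr0; apply: lt_le_trans Ma; lra.
transitivity (\int[@lebesgue_measure R]_(a in `[(- (M + 1))%R, (M + 1)%R])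
    (partial i f (a *: ebase i + p)%R)%:E)%E.
  rewrite [RHS]integral_mkcond; apply: eq_integral => a _; rewrite patchE.
  case: ifPn => // /negP; rewrite inE /= in_itv/= -ler_norml => na.
  rewrite p0// (lt_le_trans _ (rV_coord_le _ i))//.
  rewrite !mxE !tnth_mktuple !eqxx mulr1 addr0; move/negP : na; rewrite -ltNge; lra.
rewrite integral_derive_line//; last lra.
by rewrite !hL ?subrr ?normrN ?ger0_norm//; lra.
Qed.

Lemma cell_torus_le n (L x : 'rV[R]_n) : cell (FlatTorus L) x -> `|x| <= `|L|.
Proof.
move=> cx; have [_] := rV_norm_le x (normr_ge0 L); apply=> j.
have /andP[x0 xL] := cx j.
by rewrite ger0_norm// (le_trans (ltW xL))// (le_trans (ler_norm _))// rV_coord_le.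
Qed.

Lemma measurable_cell_torus n (L : 'rV[R]_n) :
  measurable (row_of_tuple @^-1` (cell (FlatTorus L)) : set (n.-tuple mR)).
Proof.
rewrite (_ : _ @^-1` _ = \bigcap_(i in [set: 'I_n])
  ((fun s : n.-tuple mR => tnth s i) @^-1` `[0, L 0 i[%classic)); last first.
  apply/seteqP; split=> [s /= h j _ /=|s /= h j].
    by rewrite in_itv/=; have := h j; rewrite mxE.
  by have := h j I; rewrite /= in_itv/= mxE.
apply: fin_bigcap_measurable; first exact: finite_finset.
move=> j _; rewrite -[X in measurable X]setTI.
by apply: (@measurable_tnth _ mR n j) => //; exact: measurable_itv.
Qed.

(** Along a line parallel to the [i]-th axis the integral over a period is the
    difference of two equal values of [f]. *)
Lemma integral_partial_periodic n (f : 'rV[R]_n -> R) i (L : 'rV[R]_n) :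
  Ck 1 setT f -> (forall i, 0 < L 0 i) ->
  (forall x, f (x + L 0 i *: ebase i) = f x) ->
  (\int[lebesgue_tuple n]_(s in row_of_tuple @^-1` (cell (FlatTorus L)))
     (partial i f (row_of_tuple s))%:E = 0)%E.
Proof.
move=> hf L0 fper.
have cp : continuous (partial i f).
  by move=> x; exact: (Ck1_partial_continuous hf I).
pose M := `|L|.
have cellM := cell_torus_le (L := L).
have mcell := measurable_cell_torus L.
have [C C0 hC] := @compact_le _ _ (partial i f) (@compact_norm_le n M)
  (fun x _ => cp x).
have mp : measurable_fun setT (fun s : n.-tuple mR => partial i f (row_of_tuple s)).
  rewrite -[setT]/(row_of_tuple @^-1` setT); apply: measurable_fun_row.
    exact: openT.
  by move=> x _; exact: cp.
pose g := (fun s : n.-tuple mR => partial i f (row_of_tuple s)) \_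
  (row_of_tuple @^-1` (cell (FlatTorus L))).
rewrite integral_mkcond.
transitivity (\int[lebesgue_tuple n]_s (g s)%:E)%E.
  by apply: eq_integral => s _; rewrite /g !patchE; case: ifP.
apply: (@integral_lines0 _ _ _ i M C) => //.
- by apply/(measurable_restrictT _ mcell); exact: measurable_funS mp.
- move=> s; rewrite /g patchE; case: ifPn => [|_]; last by rewrite normr0.
  by rewrite inE => /cellM; exact: hC.
- move=> s nb; rewrite /g patchE; case: ifPn => //; rewrite inE => /cellM h.
  by exfalso; apply: nb; have [_] := tbox_row s (normr_ge0 L); apply.
move=> s; pose p := row_of_tuple (tset s i 0).
have pE a j : row_of_tuple (tset s i a) 0 j = if j == i then a else tnth s j.
  by rewrite mxE tnth_mktuple.
have [hs|hs] := pselect (forall j, j != i -> 0 <= tnth s j < L 0 j); last first.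
  apply: integral0_eq => a _; rewrite /g patchE; case: ifPn => //; rewrite inE /= => h.
  by exfalso; apply: hs => j ji; have := h j; rewrite pE (negbTE ji).
transitivity (\int[@lebesgue_measure R]_(a in `[0%R, (L 0 i)%R[)
    (partial i f (a *: ebase i + p)%R)%:E)%E.
  rewrite [RHS]integral_mkcond; apply: eq_integral => a _.
  rewrite /g !patchE row_tset -/p.
  have -> : (tset s i a \in row_of_tuple @^-1` cell (FlatTorus L)) =
            (a \in `[0, L 0 i[%classic).
    apply/idP/idP; rewrite !inE /= in_itv/= => h.
      by have := h i; rewrite pE eqxx.
    by move=> j; rewrite pE; case: eqP => [->//|/eqP]; exact: hs.
  by case: ifP.
rewrite integral_itv_bndo_bndc; last first.
  have cl : continuous (fun a : R => partial i f (a *: ebase i + p)).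
    move=> a; apply: (@continuous_comp _ _ _ (fun a : R => a *: ebase i + p)); last exact: cp.
    by apply: cvgD; [exact: scalel_continuous|exact: cvg_cst].
  apply/measurable_EFinP; exact: measurable_funS (continuous_measurable_fun cl).
by rewrite integral_derive_line// scale0r add0r [L 0 i *: _ + _]addrC fper subrr.
Qed.

End partial_integrals.

(** * Cutoff functions *)

Section smooth_step.
Context {R : realType}.
Implicit Types s : R.

Definition pos (s : R) : R := Num.max s 0.

Lemma pos_continuous : continuous pos.
Proof.
move=> s; have -> : pos = fun y => (y + 0 + `|y - 0|) / 2.
  by apply/funext => y; rewrite /pos maxr_absE.
apply: cvgM; last exact: cvg_cst.
apply: cvgD; first by apply: cvgD; [exact: cvg_id|exact: cvg_cst].
by apply: cvg_norm; apply: cvgB; [exact: cvg_id|exact: cvg_cst].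
Qed.

(** At [0] the difference quotient is [pos h], which tends to [0]. *)
Lemma is_derive_pos2 s : is_derive s 1 (fun y => y * pos y) (2 * pos s).
Proof.
have [s0|s0|->] := ltgtP s 0.
- apply: (@near_eq_is_derive _ _ _ (fun _ => 0)); last first.
    by rewrite /pos (max_r (ltW s0)) mulr0; exact: is_derive_cst.
  near=> y; have y0 : y < 0 by near: y; exact: lt_nbhsl.
  by rewrite /pos (max_r (ltW y0)) mulr0.
- apply: (@near_eq_is_derive _ _ _ (fun y : R => y * y)); last first.
    rewrite /pos (max_l (ltW s0)); apply: is_derive_eq.
    by rewrite !scaler1; ring.
  near=> y; have y0 : 0 < y by near: y; exact: lt_nbhsr.
  by rewrite /pos (max_l (ltW y0)).
have h : h^-1 *: ((h *: (1 : R) + 0) * pos (h *: (1 : R) + 0) - 0 * pos 0)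
    @[h --> (0 : R)^'] --> (0 : R).
  have p0 : pos h @[h --> (0 : R)^'] --> (0 : R).
    apply: cvg_within_filter; have := @pos_continuous 0.
    by rewrite /continuous_at {2}/pos maxxx.
  apply: cvg_trans p0; apply: near_eq_cvg; near=> h.
  have h0 : h != 0 by near: h; exact: nbhs_dnbhs_neq.
  by rewrite mul0r subr0 addr0 [h *: _]mulr1 -[h^-1 *: _]/(h^-1 * _) mulrA mulVf// mul1r.
by rewrite /pos maxxx mulr0; apply: DeriveDef;
  [apply/cvg_ex; exists 0|apply/cvg_lim].
Unshelve. all: by end_near. Qed.

(** The quadratic spline with second derivative [4] on [[0, 1/2]] and [-4] on
    [[1/2, 1]], written with positive parts so that its regularity reduces to that of
    [s * pos s] at [0]. *)
Definition step (s : R) : R :=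
  2 * (s * pos s) - 4 * ((s - 1 / 2) * pos (s - 1 / 2))
  + 2 * ((s - 1) * pos (s - 1)).

Definition dstep (s : R) : R :=
  4 * pos s - 8 * pos (s - 1 / 2) + 4 * pos (s - 1).

Lemma is_derive_step s : is_derive s 1 step (dstep s).
Proof.
have sh (c : R) : is_derive s 1 (fun y => (y - c) * pos (y - c)) (2 * pos (s - c)).
  have LE (k : R) : (k *: (1 : R) + s) - c = k *: (1 : R) + (s - c) by rewrite addrA.
  have [E1 E2] := growth_affine (L := fun y => y - c) (fun y : R => y * pos y) LE.
  have [D1 D2] := is_derive_pos2 (s - c).
  by rewrite -D2; apply: DeriveDef; [exact: (E2 D1)|exact: E1].
have := sh 0; rewrite subr0; under eq_fun do rewrite subr0.
move=> h0.
have -> : step = 2 \*: (fun y => y * pos y) - 4 \*: (fun y => (y - 1 / 2) * pos (y - 1 / 2))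
    + 2 \*: (fun y => (y - 1) * pos (y - 1)) by [].
have h1 := sh (1 / 2); have h2 := sh 1.
apply: is_derive_eq.
rewrite /dstep /GRing.scale /=; ring.
Qed.

Lemma step0 s : s <= 0 -> step s = 0.
Proof. by move=> s0; rewrite /step /pos !max_r ?mulr0; lra. Qed.
Lemma step1 s : 1 <= s -> step s = 1.
Proof. by move=> s0; rewrite /step /pos !max_l; [field|lra..]. Qed.
Lemma dstep0 s : s <= 0 -> dstep s = 0.
Proof. by move=> s0; rewrite /dstep /pos !max_r; lra. Qed.
Lemma dstep1 s : 1 <= s -> dstep s = 0.
Proof. by move=> s0; rewrite /dstep /pos !max_l; [field|lra..]. Qed.

(** The pairs are the values of [step] and [dstep] on the four pieces. *)
Lemma step_cases s (P : R -> R -> Prop) :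
  (s <= 0 -> P 0 0) -> (0 <= s <= 1 / 2 -> P (2 * s * s) (4 * s)) ->
  (1 / 2 <= s <= 1 -> P (1 - 2 * (1 - s) * (1 - s)) (4 - 4 * s)) ->
  (1 <= s -> P 1 0) -> P (step s) (dstep s).
Proof.
move=> h1 h2 h3 h4.
have [s0|s0] := leP s 0; first by rewrite step0// dstep0//; exact: h1.
have [s1|s1] := leP 1 s; first by rewrite step1// dstep1//; exact: h4.
rewrite /step /dstep /pos (max_l (ltW s0)) (@max_r _ _ (s - 1)); last lra.
have [sh|sh] := leP s (1 / 2).
  rewrite max_r; last lra; rewrite !mulr0 !addr0 !subr0 mulrA.
  by apply: h2; rewrite (ltW s0).
rewrite max_l; last lra.
have := h3 _; rewrite (ltW sh) (ltW s1) => /(_ isT).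
by congr P; field.
Qed.

Lemma step_le1 s : `|step s| <= 1.
Proof.
apply: (@step_cases s (fun a _ => `|a| <= 1)) => h.
- by rewrite normr0.
- rewrite ger0_norm; nra.
- rewrite ger0_norm; nra.
- by rewrite normr1.
Qed.

Lemma dstep_le s : `|dstep s| <= 2.
Proof.
apply: (@step_cases s (fun _ a => `|a| <= 2)) => h.
- by rewrite normr0.
- rewrite ger0_norm; lra.
- rewrite ger0_norm; lra.
- by rewrite normr0.
Qed.

(** Bounds the derivative of [step (k * r)] in [r] by [2 / |r|], uniformly in [k]. *)
Lemma dstepM_le s : `|dstep s * s| <= 2.
Proof.
have [s1|s1] := leP 1 s; first by rewrite dstep1// mul0r normr0.
have [s0|s0] := leP s 0; first by rewrite dstep0// mul0r normr0.
rewrite normrM (le_trans _ (dstep_le s))// ler_piMr// ger0_norm ltW//.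
Qed.

Lemma dstep_continuous : continuous dstep.
Proof.
have h (c : R) : continuous (fun s => pos (s - c)).
  move=> s; apply: (@continuous_comp _ _ _ (fun s => s - c) pos).
    by apply: cvgB; [exact: cvg_id|exact: cvg_cst].
  exact: pos_continuous.
move=> s; apply: cvgD; last by apply: cvgM; [exact: cvg_cst|exact: h].
by apply: cvgB; apply: cvgM; [exact: cvg_cst|exact: pos_continuous|exact: cvg_cst
  |exact: h].
Qed.

Lemma Ck1_step : Ck 1 setT step.
Proof.
have ds s : differentiable step s.
  by apply/derivable1_diffP; have [] := is_derive_step s.
apply: (@Ck1_intro _ _ _ _ _ (fun v s => v * dstep s)) => //.
- exact: openT.
- move=> v s _; have [_ <-] := is_derive_step s.
  by rewrite !deriveE// -[in LHS](mulr1 v) [LHS]linearZ.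
- by move=> v s _; apply: cvgM; [exact: cvg_cst|exact: dstep_continuous].
Qed.

End smooth_step.

Section scalar_chain_rule.
Context {R : realType} {V : normedModType R}.
Variables (U : set V) (U' : set R) (c : V -> R) (g : R -> R).
Hypotheses (oU : open U) (hc : Ck 1 U c) (hg : Ck 1 U' g)
  (UU' : forall x, U x -> U' (c x)).

Let cE : (fun z => g (c z)) = (fun z => g (\sum_(i < 1) c z *: (1 : R))).
Proof. by apply/funext => z; rewrite big_ord1 [_ *: _]mulr1. Qed.

Lemma Ck1_comp : Ck 1 U (fun z => g (c z)).
Proof.
rewrite cE.
apply: (@Ck1_comp_coordinates R V R 'I_1 (fun _ => (1 : R)) (fun _ => c) U U' g
  oU (fun _ => hc) hg).
by move=> x Ux; rewrite big_ord1 [_ *: _]mulr1; exact: UU'.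
Qed.

Lemma derive_comp1 v x : U x ->
  'D_v (fun z => g (c z)) x = 'D_v c x * 'D_1 g (c x).
Proof.
move=> Ux; rewrite cE.
rewrite (@derive_comp_coordinates R V R 'I_1 (fun _ => (1 : R)) (fun _ => c) U U' g
  (fun _ => hc) hg) //.
  by rewrite big_ord1 big_ord1 [_ *: _]mulr1.
by move=> y Uy; rewrite big_ord1 [_ *: _]mulr1; exact: UU'.
Qed.

End scalar_chain_rule.

Section derive_rules.
Context {R : realType} {V : normedModType R}.
Implicit Types (f g : V -> R) (x v : V).

Lemma derive_sumr n (f : 'I_n -> V -> R) x v :
  (forall i, derivable (f i) x v) ->
  'D_v (fun y => \sum_i f i y) x = \sum_i 'D_v (f i) x.
Proof.
move=> df; rewrite -derive_sum//; congr derive.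
by rewrite fct_sumE.
Qed.

Lemma derive_mul f g x v : derivable f x v -> derivable g x v ->
  'D_v (fun y => f y * g y) x = f x * 'D_v g x + g x * 'D_v f x.
Proof. exact: deriveM. Qed.

Lemma derive_add f g x v : derivable f x v -> derivable g x v ->
  'D_v (fun y => f y + g y) x = 'D_v f x + 'D_v g x.
Proof. exact: deriveD. Qed.

Lemma derive_opp f x v : derivable f x v ->
  'D_v (fun y => - f y) x = - 'D_v f x.
Proof. exact: deriveN. Qed.

Lemma derive_sub f g x v : derivable f x v -> derivable g x v ->
  'D_v (fun y => f y - g y) x = 'D_v f x - 'D_v g x.
Proof. exact: deriveB. Qed.

Lemma derivable_cstf (k : R) x v : derivable (fun _ : V => k) x v.
Proof. exact: derivable_cst. Qed.

Lemma derive_cstf (k : R) x v : 'D_v (fun _ : V => k) x = 0.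
Proof. exact: derive_cst. Qed.

Lemma derivable_mul f g x v : derivable f x v -> derivable g x v ->
  derivable (fun y => f y * g y) x v.
Proof. exact: derivableM. Qed.

End derive_rules.
Arguments derivable_cstf {R V} k x v.
Arguments derive_cstf {R V} k x v.

Lemma derive_dirZ {R : realType} {V : normedModType R} (f : V -> R) (x v : V)
    (k : R) : differentiable f x -> 'D_(k *: v) f x = k * 'D_v f x.
Proof. by move=> df; rewrite !deriveE// linearZ. Qed.

Lemma near_gt {R : realType} {T : topologicalType} (f : T -> R) x (c : R) :
  {for x, continuous f} -> c < f x -> \forall y \near x, c < f y.
Proof. by move=> cf; exact: (@cvgr_gt _ _ _ _ f (f x) cf c). Qed.

Lemma near_lt {R : realType} {T : topologicalType} (f : T -> R) x (c : R) :
  {for x, continuous f} -> f x < c -> \forall y \near x, f y < c.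
Proof. by move=> cf; exact: (@cvgr_lt _ _ _ _ f (f x) cf c). Qed.

Lemma for_continuous_norm {R : realType} {T : topologicalType} (f : T -> R) x :
  {for x, continuous f} -> {for x, continuous (fun y => `|f y|)}.
Proof.
by move=> cf; apply: (@continuous_comp _ _ _ f); [exact: cf|exact: norm_continuous].
Qed.

Section fields.
Context {R : realType} {d : nat}.
Notation E := 'rV[R]_d.
Implicit Types (x y v : E) (b : E -> R) (G : E -> E).

Lemma derive_coord v x j : 'D_v (fun y : E => y 0 j) x = v 0 j.
Proof.
have h : derivable (id : E -> E) x v by exact: derivable_id.
have := @derive_mx _ _ 1 d (id : E -> E) x v h.
by rewrite derive_id => /matrixP/(_ 0 j); rewrite mxE => ->.
Qed.

Lemma Ck1_coord (U : set E) j : open U -> Ck 1 U (fun y : E => y 0 j).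
Proof.
move=> oU; apply: (@Ck1_intro _ _ _ _ _ (fun v _ => v 0 j)) => //.
- by move=> x _; exact: differentiable_coord.
- by move=> v x _; exact: derive_coord.
- by move=> v x _; exact: cst_continuous.
Qed.

Lemma sqnorm_ge_coord x j : x 0 j ^+ 2 <= sqnorm x.
Proof.
rewrite /sqnorm /dot (bigD1 j)//= -expr2 lerDl sumr_ge0// => k _.
by rewrite -expr2 sqr_ge0.
Qed.

Lemma sqnorm_ge_norm x r : 0 <= r -> sqnorm x <= r ^+ 2 -> `|x| <= r.
Proof.
move=> r0 h; apply/rV_norm_le => // j.
rewrite -(@ler_pXn2r _ 2) ?nnegrE// real_normK ?num_real//.
exact: le_trans (sqnorm_ge_coord _ _) h.
Qed.

Lemma sqnorm_ge0 x : 0 <= sqnorm x.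
Proof. by apply: sumr_ge0 => j _; rewrite -expr2 sqr_ge0. Qed.

Lemma dotZl (k : R) x y : dot (k *: x) y = k * dot x y.
Proof. by rewrite /dot mulr_sumr; apply: eq_bigr => i _; rewrite mxE mulrA. Qed.
Lemma dotZr (k : R) x y : dot x (k *: y) = k * dot x y.
Proof. by rewrite /dot mulr_sumr; apply: eq_bigr => i _; rewrite mxE mulrCA. Qed.
Lemma dotDl x y z : dot (x + y) z = dot x z + dot y z.
Proof. by rewrite /dot -big_split; apply: eq_bigr => i _; rewrite mxE mulrDl. Qed.
Lemma dotNl x y : dot (- x) y = - dot x y.
Proof. by rewrite -scaleN1r dotZl mulN1r. Qed.
Lemma dotBl x y z : dot (x - y) z = dot x z - dot y z.
Proof. by rewrite dotDl dotNl. Qed.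
Lemma dotC x y : dot x y = dot y x.
Proof. by apply: eq_bigr => i _; rewrite mulrC. Qed.

(** The Euclidean square norm is a polynomial. Since it dominates the square of the
    sup norm, the support lies in the ball of radius [r] of the sup norm. *)
Definition bump (x : E) (r : R) (y : E) : R :=
  step (2 - (2 / r ^+ 2) * sqnorm (y - x)).

Lemma Ck1_sqnorm (x : E) : Ck 1 setT (fun y => sqnorm (y - x)).
Proof.
apply: Ck1_sum => [|i]; first exact: openT.
have h : Ck 1 setT (fun y : E => (y - x) 0 i).
  have -> : (fun y : E => (y - x) 0 i) = fun y : E => y 0 i - x 0 i.
    by apply/funext => y; rewrite !mxE.
  by apply: Ck1B; [exact: openT|exact/Ck1_coord/openT|exact/Ck1_cst/openT].
exact: (Ck1M openT h h).
Qed.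

Lemma derive_sqnorm (x v y : E) :
  'D_v (fun y => sqnorm (y - x)) y = 2 * dot (y - x) v.
Proof.
have cE i : (fun y : E => (y - x) 0 i) = fun y : E => y 0 i - x 0 i.
  by apply/funext => z; rewrite !mxE.
have hC i : derivable (fun y : E => (y - x) 0 i) y v.
  rewrite cE; apply: derivableB; last exact: derivable_cst.
  exact/diff_derivable/differentiable_coord.
rewrite /sqnorm /dot derive_sumr => [|i]; last exact: derivableM.
rewrite mulr_sumr; apply: eq_bigr => i _.
rewrite derive_mul// cE derive_sub; last exact: derivable_cst.
  by rewrite derive_coord derive_cst !mxE; ring.
exact/diff_derivable/differentiable_coord.
Qed.

Lemma Ck1_bump x r : Ck 1 setT (bump x r).
Proof.
have hc : Ck 1 setT (fun y => 2 - (2 / r ^+ 2) * sqnorm (y - x)).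
  exact: (Ck1B openT (Ck1_cst openT (2 : R))
    (Ck1M openT (Ck1_cst openT (2 / r ^+ 2 : R)) (Ck1_sqnorm x))).
exact: (Ck1_comp openT hc Ck1_step (fun _ _ => I)).
Qed.

Lemma partial_bump x r i y : partial i (bump x r) y =
  - (4 / r ^+ 2 * (y - x) 0 i) * dstep (2 - (2 / r ^+ 2) * sqnorm (y - x)).
Proof.
pose k := 2 / r ^+ 2; pose q (z : E) := sqnorm (z - x).
have hq : derivable q y (ebase i) := Ck_derivable (ebase i) (Ck1_sqnorm x) (I : setT y).
have hk := derivable_cstf k y (ebase i).
have E1 := derive_mul hk hq.
have E2 := derive_sub (derivable_cstf 2 y (ebase i)) (derivable_mul hk hq).
have hc : Ck 1 setT (fun y => 2 - k * q y).
  exact: (Ck1B openT (Ck1_cst openT (2 : R)) (Ck1M openT (Ck1_cst openT (k : R)) (Ck1_sqnorm x))).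
have E3 := @derive_comp1 _ _ setT setT _ step hc Ck1_step (fun _ _ => I) (ebase i) y I.
have [_ E4] := is_derive_step (2 - k * q y).
rewrite [LHS]E3 E4 E2 E1 !derive_cstf derive_sqnorm mulr0 addr0 sub0r.
have -> : dot (y - x) (ebase i) = (y - x) 0 i.
  rewrite /dot (bigD1 i)//= big1 ?addr0 => [|j ji].
    by rewrite [ebase i _ _]mxE !eqxx mulr1.
  by rewrite [ebase i _ _]mxE eqxx (negbTE ji) mulr0.
by congr (- _ * _); rewrite /k; ring.
Qed.

Lemma bump1 x r y : 0 < r -> 2 * sqnorm (y - x) <= r ^+ 2 -> bump x r y = 1.
Proof.
move=> r0 h; apply: step1; have r20 : 0 < r ^+ 2 by rewrite exprn_gt0.
have : 2 / r ^+ 2 * sqnorm (y - x) <= 1 by rewrite mulrAC ler_pdivrMr// mul1r.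
lra.
Qed.

Lemma bump0_arg x r y : 0 < r -> r < `|y - x| ->
  2 - 2 / r ^+ 2 * sqnorm (y - x) <= 0.
Proof.
move=> r0 h; have r20 : 0 < r ^+ 2 by rewrite exprn_gt0.
suff : r ^+ 2 <= sqnorm (y - x).
  move=> h2; rewrite subr_le0 -mulrA ler_peMr//.
  by rewrite mulrC ler_pdivlMr// mul1r.
rewrite leNgt; apply/negP => /ltW /(sqnorm_ge_norm (ltW r0)).
by rewrite leNgt h.
Qed.

Lemma bump0 x r y : 0 < r -> r < `|y - x| -> bump x r y = 0.
Proof. by move=> r0 h; apply/step0/bump0_arg. Qed.

Lemma bump_le1 x r y : `|bump x r y| <= 1.
Proof. exact: step_le1. Qed.

(** The bound does not depend on [r], so that one integrable function dominates
    [J . grad (bump 0 r)] for all [r]. *)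
Lemma partial_bump_le i r y : 1 <= r -> `|partial i (bump 0 r) y| <= 8.
Proof.
move=> r1; have r0 : 0 < r by lra.
have r20 : 0 < r ^+ 2 by rewrite exprn_gt0.
rewrite partial_bump subr0.
have [h|h] := leP `|y| r; last first.
  have := @bump0_arg 0 r y r0; rewrite subr0 => /(_ h) /dstep0 ->.
  by rewrite mulr0 normr0.
rewrite normrM normrN normrM (ger0_norm (ltW _)) ?divr_gt0//.
have h1 : 4 / r ^+ 2 * `|y 0 i| <= 4.
  rewrite mulrAC ler_pdivrMr// ler_pM2l// (le_trans (rV_coord_le _ _))//.
  by rewrite (le_trans h)// expr2 ler_peMr// ltW.
have := dstep_le (2 - 2 / r ^+ 2 * sqnorm y).
have := normr_ge0 (dstep (2 - 2 / r ^+ 2 * sqnorm y)).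
have : 0 <= 4 / r ^+ 2 * `|y 0 i| by rewrite mulr_ge0// ltW// divr_gt0.
nra.
Qed.

Lemma partial_bump0 i r y : 0 < r -> 2 * sqnorm y <= r ^+ 2 ->
  partial i (bump 0 r) y = 0.
Proof.
move=> r0 h; have r20 : 0 < r ^+ 2 by rewrite exprn_gt0.
rewrite partial_bump subr0 dstep1 ?mulr0//.
have : 2 / r ^+ 2 * sqnorm y <= 1 by rewrite mulrAC ler_pdivrMr// mul1r.
lra.
Qed.

Lemma divergence_scale b G y :
  (forall i, derivable b y (ebase i)) ->
  (forall i, derivable (component G i) y (ebase i)) ->
  divergence (fun y => b y *: G y) y =
  b y * divergence G y + dot (G y) (grad b y).
Proof.
move=> db dG; rewrite /divergence /dot mulr_sumr -big_split; apply: eq_bigr => i _.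
rewrite [grad b y 0 i]mxE; have E := derive_mul (db i) (dG i).
transitivity ('D_(ebase i) (fun z => b z * component G i z) y); last exact: E.
congr derive; apply/funext => z; exact: mxE.
Qed.

End fields.

(** * Tangential fields have no net flux *)

Section divergence_integrals.
Context {R : realType} {d : nat}.
Notation mR := (measurableTypeR R).
Notation E := 'rV[R]_d.
Implicit Types (x y v : E) (b : E -> R) (G : E -> E) (U A : set E).

Lemma divergence_continuous U G x : (forall i, Ck 1 U (component G i)) -> U x ->
  {for x, continuous (divergence G)}.
Proof.
move=> hG Ux.
apply: (@cvg_sumr R E (nbhs x) _ _ (fun i y => partial i (component G i) y)) => i.
exact: (Ck1_partial_continuous (hG i) Ux).
Qed.

Lemma divergence_supp G M : (forall x, M < `|x| -> G x = 0) ->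
  forall x, M < `|x| -> divergence G x = 0.
Proof.
move=> G0 x Mx; apply: big1 => i _.
apply: (@partial_supp _ _ (component G i) i M) => // y My.
by rewrite /component G0// mxE.
Qed.

(** On the compact set [closure A], cut at norm [M], the function [g] is bounded. *)
Lemma integrable_compact_supp U A (g : E -> R) (M : R) :
  open U -> closure A `<=` U -> measurable (row_of_tuple @^-1` A : set (d.-tuple mR)) ->
  (forall x, U x -> {for x, continuous g}) ->
  (forall x, A x -> M < `|x| -> g x = 0) -> integrable_rV A g.
Proof.
move=> oU AU mA cg g0.
wlog M0 : M g0 / 0 <= M => [h|].
  apply: (h `|M|) => // x Ax hx; apply: g0 => //.
  by rewrite (le_lt_trans (ler_norm _) hx).
pose K := [set x : E | `|x| <= M] `&` closure A.
have cK : compact K.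
  by apply: compact_closedI; [exact: compact_norm_le|exact: closed_closure].
have [C C0 hC] := @compact_le _ _ K g cK (fun x Kx => cg x (AU _ Kx.2)).
have gC x : A x -> `|g x| <= C.
  move=> Ax; have [xM|/(g0 _ Ax)->] := leP `|x| M; last by rewrite normr0.
  by apply: hC; split => //; exact: subset_closure.
have mU : measurable (row_of_tuple @^-1` U : set (d.-tuple mR)).
  exact: open_measurable_row.
have mg : measurable_fun (row_of_tuple @^-1` A)
    (fun s : d.-tuple mR => g (row_of_tuple s)).
  apply: (measurable_funS mU _ (measurable_fun_row oU cg)).
  by move=> s As; apply: AU; exact: subset_closure.
rewrite /integrable_rV; apply/(integrable_mkcond _ mA).
pose h := (fun s : d.-tuple mR => g (row_of_tuple s)) \_ (row_of_tuple @^-1` A).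
have -> : (fun s : d.-tuple mR => (g (row_of_tuple s))%:E) \_ (row_of_tuple @^-1` A)
    = EFin \o h.
  by apply/funext => s; rewrite /h /= !patchE; case: ifP.
apply: (@integrable_bounded_tbox _ _ _ _ (tbox M) _ C).
- exact: measurable_tbox.
- exact: tbox_finite.
- exact/(measurable_restrictT _ mA).
- move=> s; rewrite /h patchE; case: ifPn => [|_]; last by rewrite normr0.
  by rewrite inE; exact: gC.
- move=> s nb; rewrite /h patchE; case: ifPn => //; rewrite inE => As.
  apply: g0 => //; rewrite ltNge; apply/negP => hs; apply: nb.
  by have [_] := tbox_row s M0; apply.
Qed.

Lemma integral_divergence_supp G M : (forall i, Ck 1 setT (component G i)) ->
  (forall x, M < `|x| -> G x = 0) ->
  (\int[lebesgue_tuple d]_s (divergence G (row_of_tuple s))%:E = 0)%E.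
Proof.
move=> hG G0.
have Gi0 i x : M < `|x| -> component G i x = 0.
  by move=> Mx; rewrite /component G0// mxE.
have int_i i : (lebesgue_tuple d).-integrable setT
    (fun s : d.-tuple mR => (partial i (component G i) (row_of_tuple s))%:E).
  have := @integrable_compact_supp setT setT (partial i (component G i)) M.
  rewrite /integrable_rV preimage_setT; apply => //.
  - exact: openT.
  - by move=> x _; exact: (Ck1_partial_continuous (hG i) I).
  - by move=> x _; exact: (@partial_supp _ _ (component G i) i M (Gi0 i)).
under eq_integral => s _ do rewrite /divergence -sumEFin.
rewrite integral_sum//; apply: big1 => i _.
exact: (@integral_partial_supp R d (component G i) i M (hG i) (Gi0 i)).
Qed.

End divergence_integrals.

Section balls.
Context {R : realType} {V : normedModType R}.
Implicit Types (x y : V) (r : R).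

Lemma dist_continuous x : continuous (fun y : V => `|y - x|).
Proof.
by move=> y; apply: cvg_norm; apply: cvgB; [exact: cvg_id|exact: cvg_cst].
Qed.

Lemma closed_dist_le x r : closed [set y : V | `|y - x| <= r].
Proof.
apply: (closed_comp (f := fun y : V => `|y - x|) (D := [set y : R | y <= r])).
  by move=> y _; exact: dist_continuous.
exact: closed_le.
Qed.

Lemma near_dist_gt x r y : r < `|y - x| -> \forall z \near y, r < `|z - x|.
Proof.
move=> ry; apply: (open_nbhs_nbhs (A := [set z : V | r < `|z - x|])); split => //.
apply: (open_comp (f := fun y : V => `|y - x|) (D := [set y : R | r < y])).
  by move=> z _; exact: dist_continuous.
exact: open_gt.
Qed.

Lemma norm_gt_dist x r y : r + `|x| < `|y| -> r < `|y - x|.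
Proof.
move=> h; rewrite -(ltrD2r `|x|) (lt_le_trans h)//.
by rewrite -[in leLHS](subrK x y) ler_normD.
Qed.

End balls.

Section local_flux.
Context {R : realType} {d : nat}.
Notation mR := (measurableTypeR R).
Notation E := 'rV[R]_d.
Variables (Om U : set E) (J : E -> E).
Hypotheses (oOm : open Om) (oU : open U) (OmU : closure Om `<=` U).
Hypothesis hJ : forall i, Ck 1 U (component J i).
Implicit Types (x y v n : E) (b : E -> R).

Lemma divergence_near0 (G : E -> E) x : (\near x, G x = 0) -> divergence G x = 0.
Proof.
move=> G0; apply: big1 => i _.
rewrite /partial (@near_eq_derive _ _ _ _ (fun _ => 0)); first exact: derive_cst.
by apply: filterS G0 => y Gy; rewrite /component Gy mxE.
Qed.

Lemma component_scale b i : component (fun y => b y *: J y) i =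
  fun y => b y * component J i y.
Proof. by apply/funext => y; rewrite /component mxE. Qed.

(** By the divergence theorem this integral is the net flux of [b J] out of [Om]. *)
Definition no_net b : Prop :=
  (\int[lebesgue_tuple d]_(s in row_of_tuple @^-1` Om)
    (divergence (fun y => (b y *: J y)%R) (row_of_tuple s))%:E = 0)%E.

(** Here [b J], extended by zero, is a C^1 field of compact support in [Om]. *)
Lemma no_net_interior x : Om x -> exists2 r, 0 < r &
  forall b, Ck 1 setT b -> (forall y, r < `|y - x| -> b y = 0) -> no_net b.
Proof.
move=> Omx; have /nbhs_ballP[e /= e0 he] : nbhs x Om by exact: open_nbhs_nbhs.
exists (e / 2); first by rewrite divr_gt0.
move=> b hb b0; set C := [set y : E | `|y - x| <= e / 2].
have COm : C `<=` Om.
  move=> y /= yx; apply: he; rewrite -ball_normE /ball_ /= distrC (le_lt_trans yx)//.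
  by rewrite ltr_pdivrMr// ltr_pMr// ltr1n.
have nC y : ~ C y -> e / 2 < `|y - x| by move=> /negP; rewrite -ltNge.
have hG i : Ck 1 setT (component (fun y => b y *: J y) i).
  rewrite component_scale; apply: (Ck1_cutoff oOm (@closed_dist_le _ _ x (e / 2)) COm hb).
    by move=> y /nC; exact: b0.
  by apply: (@Ck_sub _ _ _ 1 U) (hJ i) => y Omy; apply: OmU; exact: subset_closure.
rewrite /no_net integral_mkcond.
rewrite -[RHS](@integral_divergence_supp _ _ (fun y => b y *: J y) (e / 2 + `|x|) hG).
  apply: eq_integral => s _; rewrite patchE; case: ifPn => // /negP; rewrite inE => nOm.
  rewrite divergence_near0//.
  have /near_dist_gt : e / 2 < `|row_of_tuple s - x|.
    by apply: nC => /COm.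
  by apply: filterS => y /b0 ->; rewrite scale0r.
by move=> y /norm_gt_dist /b0 ->; rewrite scale0r.
Qed.

Hypothesis tang : forall x n, boundary Om x -> outer_normal Om x n ->
  dot (J x) n = 0.

(** Where [rho = 0] the gradient of [rho] is normal to the boundary, so that the flux
    density [J . grad rho] vanishes. In a direction [u] in which [rho] grows at a rate at
    least [c], the level set [rho = 0] is reached from [y] after a length at most
    [|rho y| / c], and on the way the flux density changes at a bounded rate. *)
Lemma flux_density_le x (U0 : set E) (rho : E -> R) :
  boundary Om x -> open U0 -> U0 x -> Ck 2 U0 rho ->
  Om `&` U0 = [set y | rho y < 0] `&` U0 -> grad rho x != 0 ->
  exists r K, [/\ 0 < r, 0 <= K, [set y : E | `|y - x| <= r] `<=` U0 `&` U &
    forall y, `|y - x| <= r -> rho y < 0 ->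
      `|dot (J y) (grad rho y)| <= K * `|rho y|].
Proof.
move=> [clx nix] oU0 U0x hrho OmE grad0.
pose V := U0 `&` U.
have oV : open V by exact: openI.
have Vx : V x by split => //; exact: OmU.
have hrho2 : Ck 2 V rho by apply: (@Ck_sub _ _ _ 2 U0) hrho => y [].
have hrho1 := Ck_pred hrho2.
have hD v : Ck 1 V (fun y => 'D_v rho y) := Ck_derive v hrho2.
(* the direction in which rho grows *)
have [u [i [k [k0 uE]]] Du0] : exists2 u : E,
    exists i (k : R), k != 0 /\ u = k *: ebase i & 0 < 'D_u rho x.
  have [i gi] : exists i, grad rho x 0 i != 0.
    apply/existsP; rewrite -negb_forall; apply: contra grad0 => /forallP h.
    by apply/eqP/rowP => i; rewrite [RHS]mxE; apply/eqP; exact: h.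
  have gE : grad rho x 0 i = 'D_(ebase i) rho x by rewrite mxE.
  exists (grad rho x 0 i *: ebase i); first by exists i, (grad rho x 0 i).
  have dx : differentiable rho x := Ck_differentiable hrho1 Vx.
  rewrite derive_dirZ// -gE.
  by rewrite lt0r mulf_neq0//= -expr2 sqr_ge0.
pose f y := dot (J y) (grad rho y).
have fE : f = fun y => \sum_j component J j y * 'D_(ebase j) rho y.
  by apply/funext => y; apply: eq_bigr => j _; rewrite [grad rho y 0 j]mxE.
have hf : Ck 1 V f.
  rewrite fE; apply: (Ck1_sum oV) => j; apply: (Ck1M oV) (hD _).
  by apply: (@Ck_sub _ _ _ 1 U) (hJ j) => y [].
pose c := 'D_u rho x / 2; pose L := `|'D_u f x| + 1.
have c0 : 0 < c by rewrite divr_gt0.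
have L0 : 0 < L by rewrite ltr_wpDl.
have nV : \forall y \near x, V y by exact: open_nbhs_nbhs.
have nD : \forall y \near x, c < 'D_u rho y.
  apply: near_gt; first exact: (Ck_continuous (hD u) Vx).
  by rewrite /c ltr_pdivrMr// ltr_pMr// ltr1n.
have nL : \forall y \near x, `|'D_u f y| < L.
  apply: (@near_lt _ _ (fun y => `|'D_u f y|)); last by rewrite /L ltrDl.
  exact: for_continuous_norm (Ck_continuous (Ck_derive u hf) Vx).
have /nbhs_ballP[r1 /= r10 h1] : \forall y \near x, [/\ V y, c < 'D_u rho y & `|'D_u f y| < L].
  by apply: filterS3 nV nD nL => y.
have B1 y : `|y - x| < r1 -> [/\ V y, c < 'D_u rho y & `|'D_u f y| < L].
  by move=> yx; apply: h1; rewrite -ball_normE /ball_ /= distrC.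
have negOm y : U0 y -> rho y < 0 -> Om y.
  by move=> Uy ry; have : ([set y | rho y < 0] `&` U0) y by []; rewrite -OmE => -[].
have Omneg y : U0 y -> Om y -> rho y < 0.
  by move=> Uy Oy; have : (Om `&` U0) y by []; rewrite OmE => -[].
have crho y : V y -> {for y, continuous rho} := Ck_continuous hrho1.
have rhox : rho x = 0.
  apply/eqP; rewrite eq_le !leNgt; apply/andP; split; apply/negP => rx.
    have [y [Oy [Vy ry]]] : Om `&` [set y | V y /\ 0 < rho y] !=set0.
      apply: clx; have np : \forall y \near x, 0 < rho y.
        exact: near_gt (crho _ Vx) rx.
      by apply: filterS2 nV np => y.
    by have := Omneg y Vy.1 Oy; rewrite ltNge (ltW ry).
  by apply: nix; apply: open_nbhs_nbhs; split => //; exact: negOm.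
(* |u| may exceed 1, so lengths along u are measured with N > |u| *)
pose N := `|u| + 1; have N0 : 0 < N by rewrite ltr_wpDl.
have uN : `|u| < N by rewrite ltrDl.
(* the level set rho = 0 lies in the boundary, where J is tangential *)
have onlevel z : `|z - x| < r1 -> rho z = 0 -> f z = 0.
  move=> zr rz; have [Vz Dz _] := B1 z zr.
  have gz : grad rho z != 0.
    apply/eqP => g0; have : 'D_u rho z = 0.
      have dz : differentiable rho z := Ck_differentiable hrho1 Vz.
      rewrite uE derive_dirZ//.
      have -> : 'D_(ebase i) rho z = grad rho z 0 i by rewrite mxE.
      by rewrite g0 mxE mulr0.
    by move=> D0; move: Dz; rewrite D0 ltNge (ltW c0).
  have bz : boundary Om z.
    split; last first.
      by move=> /interior_subset Oz; have := Omneg z Vz.1 Oz; rewrite rz ltxx.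
    move=> B Bz; have nz : \forall w \near z, B w /\ `|w - x| < r1.
      apply: filterI => //; apply: open_nbhs_nbhs; split => //.
      apply: (open_comp (f := fun y : E => `|y - x|) (D := [set y : R | y < r1])).
        by move=> y _; exact: dist_continuous.
      exact: open_lt.
    have /nbhs_ballP[e /= e0 he] := nz.
    pose t := e / (2 * N); have t0 : 0 < t by rewrite divr_gt0// mulr_gt0.
    have tN : t * N < e.
      by rewrite /t invfM mulrA mulfVK ?gt_eqF// ltr_pdivrMr// ltr_pMr// ltr1n.
    pose w := z - t *: u.
    have wz s : 0 <= s <= t -> B (s *: u + w) /\ `|(s *: u + w) - x| < r1.
      move=> /andP[s0 st]; apply: he; rewrite -ball_normE /ball_ /= /w.
      rewrite [X in `|X|](_ : _ = (t - s) *: u); last first.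
        by rewrite scalerBl opprD opprB addrCA [z + _]addrC subrK addrC.
      rewrite normrZ ger0_norm ?subr_ge0//; apply: le_lt_trans tN.
      by rewrite ler_pM ?subr_ge0// ?gerBl// ltW.
    have [|s /andP[s0 st] E] := @MVT_line _ _ rho w u t t0.
      by move=> s /wz[_ /B1[Vs _ _]]; exact: (Ck_differentiable hrho1 Vs).
    have [_ /B1[_ Ds _]] : B (s *: u + w) /\ `|(s *: u + w) - x| < r1.
      by apply: wz; rewrite !ltW.
    have z0 : 0 <= (0 : R) <= t by rewrite lexx ltW.
    have [Bw /B1[Vw _ _]] := wz _ z0.
    rewrite scale0r add0r in Bw Vw.
    exists w; split => //; apply: negOm; first exact: Vw.1.
    have tz : t *: u + w = z by rewrite /w addrC subrK.
    move: E; rewrite tz rz sub0r => /eqP; rewrite eqr_oppLR => /eqP ->.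
    by rewrite oppr_lt0 mulr_gt0// (lt_trans c0).
  have := @tang z ((Num.sqrt (sqnorm (grad rho z)))^-1 *: grad rho z) bz.
  rewrite dotZr => h; have {h} : (Num.sqrt (sqnorm (grad rho z)))^-1 * f z = 0.
    by apply: h; exists U0, rho; split => //; exact: Vz.1.
  move=> /eqP; rewrite mulf_eq0 invr_eq0 sqrtr_eq0 => /orP[|/eqP//].
  rewrite le_eqVlt ltNge sqnorm_ge0 orbF => /eqP s0; exfalso.
  move/negP : gz; apply; apply/eqP/rowP => j; rewrite [RHS]mxE; apply/eqP.
  rewrite -sqrf_eq0 eq_le sqr_ge0 andbT -s0; exact: sqnorm_ge_coord.
have nR : \forall y \near x, `|rho y| < c * (r1 / (2 * N)).
  apply: (@near_lt _ _ (fun y => `|rho y|)); first exact: for_continuous_norm (crho _ Vx).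
  by rewrite rhox normr0 mulr_gt0// divr_gt0// mulr_gt0.
have /nbhs_ballP[r2 /= r20 h2] := nR.
pose r := Num.min (r1 / 4) (r2 / 2).
have r0 : 0 < r by rewrite lt_min !divr_gt0.
have hr1 y : `|y - x| <= r -> `|y - x| < r1 / 2.
  rewrite le_min => /andP[h _]; apply: le_lt_trans h _; lra.
exists r, (L / c); split => //.
- by rewrite divr_ge0// ltW.
- by move=> y /= /hr1 yr; have [] : [/\ V y, c < 'D_u rho y & `|'D_u f y| < L] by apply: B1; lra.
move=> y yr ry.
have yr1 := hr1 _ yr.
have rhoy : `|rho y| < c * (r1 / (2 * N)).
  apply: h2; rewrite -ball_normE /ball_ /= distrC.
  move: yr; rewrite le_min => /andP[_ h]; apply: le_lt_trans h _; lra.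
(* rho has become nonnegative after the length h *)
pose h := `|rho y| / c.
have ny0 : 0 < `|rho y| by rewrite normr_gt0 lt_eqF.
have h0 : 0 < h by rewrite divr_gt0.
have hN : h * N < r1 / 2.
  have : h < r1 / (2 * N) by rewrite /h ltr_pdivrMr// mulrC.
  by rewrite -(ltr_pM2r N0) invfM mulrA mulfVK ?gt_eqF.
have B2 s : 0 <= s <= h -> `|s *: u + y - x| < r1.
  move=> /andP[s0 sh]; rewrite -addrA (le_lt_trans (ler_normD _ _))//.
  rewrite [r1]splitr ltrD// normrZ ger0_norm// (le_lt_trans _ hN)//.
  by rewrite ler_pM// ltW.
have [|s /andP[s0 sh] E] := @MVT_line _ _ rho y u h h0.
  by move=> s /B2/B1[Vs _ _]; exact: (Ck_differentiable hrho1 Vs).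
have [_ Ds _] : [/\ V (s *: u + y), c < 'D_u rho (s *: u + y) & `|'D_u f (s *: u + y)| < L].
  by apply/B1/B2; rewrite !ltW.
have rh : 0 <= rho (h *: u + y).
  have : c * h <= 'D_u rho (s *: u + y) * h by rewrite ler_pM2r// ltW.
  rewrite -E {1}/h mulrC divfK ?gt_eqF// (ltr0_norm ry); lra.
have cL : {within `[0, h], continuous (fun s => rho (s *: u + y))}.
  apply: continuous_in_subspaceT => a /set_mem /=; rewrite in_itv/= => ah.
  apply: (@continuous_comp _ _ _ (fun a : R => a *: u + y) rho).
    by apply: cvgD; [exact: scalel_continuous|exact: cvg_cst].
  by have [Va _ _] := B1 _ (B2 _ ah); exact: crho.
have [|a ah ra] := @IVT _ _ 0 h 0 (ltW h0) cL.
  by rewrite scale0r add0r ge_min (ltW ry)/= le_max rh orbT.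
rewrite in_itv/= in ah; have /andP[a0 ah'] := ah.
have {}a0 : 0 < a.
  rewrite lt_neqAle a0 andbT; apply/eqP => a00.
  by move: ra ry; rewrite -a00 scale0r add0r => ->; rewrite ltxx.
have B3 (t : R) : 0 <= t <= a -> `|t *: u + y - x| < r1.
  by move=> /andP[t0 ta]; apply: B2; rewrite t0 (le_trans ta).
have [|t /andP[t0 ta] Ef] := @MVT_line _ _ f y u a a0.
  by move=> t /B3/B1[Vt _ _]; exact: (Ck_differentiable hf Vt).
have [_ _ Lt] : [/\ V (t *: u + y), c < 'D_u rho (t *: u + y) & `|'D_u f (t *: u + y)| < L].
  by apply/B1/B3; rewrite !ltW.
have fz : f (a *: u + y) = 0 by apply: onlevel => //; exact: B2.
move: Ef; rewrite fz sub0r => /eqP; rewrite eqr_oppLR => /eqP fE'.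
rewrite -/(f y) fE' normrN normrM (ger0_norm (ltW a0)) mulrAC -mulrA.
by rewrite ler_pM// ltW.
Qed.

End local_flux.

Section boundary_flux.
Context {R : realType} {d : nat}.
Notation mR := (measurableTypeR R).
Notation E := 'rV[R]_d.
Variables (Om U : set E) (J : E -> E).
Hypotheses (oOm : open Om) (oU : open U) (OmU : closure Om `<=` U).
Hypothesis hJ : forall i, Ck 1 U (component J i).
Implicit Types (x y v n : E) (b : E -> R).
Hypothesis tang : forall x n, boundary Om x -> outer_normal Om x n ->
  dot (J x) n = 0.

Lemma dominated_integral0 (g : nat -> E -> R) (h : E -> R) (M C : R) :
  0 <= M -> 0 <= C ->
  (forall k, measurable_fun setT (fun s : d.-tuple mR => g k (row_of_tuple s))) ->
  (forall y, g k y @[k --> \oo] --> h y) ->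
  (forall k y, `|g k y| <= C) -> (forall k y, M < `|y| -> g k y = 0) ->
  (forall k, \int[lebesgue_tuple d]_s (g k (row_of_tuple s))%:E = 0)%E ->
  (\int[lebesgue_tuple d]_s (h (row_of_tuple s))%:E = 0)%E.
Proof.
move=> M0 C0 mg gh gC g0 ig.
pose G := (fun _ : d.-tuple mR => C) \_ (tbox M).
have iG : (lebesgue_tuple d).-integrable setT (EFin \o G).
  apply: (@integrable_bounded_tbox _ _ _ _ (tbox M) _ C).
  - exact: measurable_tbox.
  - exact: tbox_finite.
  - by apply/(measurable_restrictT _ (@measurable_tbox R d M)); exact: measurable_cst.
  - by move=> s; rewrite /G patchE; case: ifP => _; rewrite ?normr0// ger0_norm.
  - by move=> s nb; rewrite /G patchE; case: ifPn => //; rewrite inE.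
have := @dominated_cvg _ _ _ (lebesgue_tuple d) setT measurableT
  (fun k s => (g k (row_of_tuple s))%:E) (fun s => (h (row_of_tuple s))%:E)
  (EFin \o G) _ _ _ iG _.
move=> H; have {}H : (\int[lebesgue_tuple d]_s (g k (row_of_tuple s))%:E)%E @[k --> \oo]
    --> (\int[lebesgue_tuple d]_s (h (row_of_tuple s))%:E)%E.
  apply: H => //.
  - by move=> k; exact/measurable_EFinP.
  - by move=> s _; apply: cvg_EFin; [exact: nearW|exact: gh].
  - move=> k s _; rewrite /= lee_fin /G patchE; case: ifPn => [_|]; first exact: gC.
    rewrite notin_setE => nb; rewrite g0 ?normr0// ltNge; apply/negP => hs.
    by apply: nb; have [_] := tbox_row s M0; apply.
apply: (@cvg_unique _ (@ereal_hausdorff R) _ _ _ _ H).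
have -> : (fun k => \int[lebesgue_tuple d]_s (g k (row_of_tuple s))%:E)%E = cst 0%E.
  by apply/funext => k; exact: ig.
exact: cvg_cst.
Qed.

(** The fields [step (- k rho) b J] have compact support in [rho <= 0], hence no total
    divergence. Their divergence is [step (- k rho)] times that of [b J], plus a term
    with the factor [k * dstep (- k rho) * (J . grad rho)], which lives where
    [0 < - rho < 1 / k] and is bounded by [flux_density_le]. By dominated convergence it
    disappears in the limit, without any integral over the boundary. *)
Lemma no_net_boundary x n : boundary Om x -> outer_normal Om x n ->
  exists2 r, 0 < r &
  forall b, Ck 1 setT b -> (forall y, r < `|y - x| -> b y = 0) -> no_net Om J b.
Proof.
move=> bx [U0 [rho [oU0 U0x hrho OmE [grad0 _]]]].
have [r [K [r0 K0 CV fK]]] := flux_density_le oOm oU OmU hJ tang bx oU0 U0x hrho OmE grad0.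
exists r => // b hb b0.
set C := [set y : E | `|y - x| <= r] in CV.
pose V := U0 `&` U; have oV : open V by exact: openI.
have nC y : ~ C y -> r < `|y - x| by move=> /negP; rewrite -ltNge.
have hrho1 : Ck 1 V rho.
  by apply: (@Ck_sub _ _ _ 1 U0) (Ck_pred hrho) => y [].
have hJV i : Ck 1 V (component J i) by apply: (@Ck_sub _ _ _ 1 U) (hJ i) => y [].
pose M := r + `|x|; have M0 : 0 <= M by rewrite addr_ge0// ltW.
have b0M y : M < `|y| -> b y = 0 by move=> /norm_gt_dist; exact: b0.
pose F y := b y *: J y.
have hF i : Ck 1 setT (component F i).
  rewrite component_scale; apply: (Ck1_cutoff oV (@closed_dist_le _ _ x r) CV hb).
    by move=> y /nC; exact: b0.
  exact: hJV.
have F0 y : M < `|y| -> F y = 0 by move=> /b0M; rewrite /F => ->; rewrite scale0r.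
pose q (k : nat) y := - (k.+1%:R * rho y) : R.
have hq k : Ck 1 V (q k).
  exact: (Ck1N oV (Ck1M oV (Ck1_cst oV (k.+1%:R : R)) hrho1)).
pose h k y := step (q k y).
have hh k : Ck 1 V (h k) := Ck1_comp oV (hq k) Ck1_step (fun _ _ => I).
pose G k y := h k y *: F y.
have hG k i : Ck 1 setT (component (G k) i).
  have -> : component (G k) i = fun y => b y * (h k y * component J i y).
    by apply/funext => y; rewrite /component !mxE mulrCA.
  apply: (Ck1_cutoff oV (@closed_dist_le _ _ x r) CV hb).
    by move=> y /nC; exact: b0.
  exact: (Ck1M oV (hh k) (hJV i)).
have G0 k y : M < `|y| -> G k y = 0 by move=> /F0; rewrite /G => ->; rewrite scaler0.
have GE k y : C y -> divergence (G k) y =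
    h k y * divergence F y + b y * (- (k.+1%:R * dstep (q k y)) * dot (J y) (grad rho y)).
  move=> /CV Vy; rewrite divergence_scale; last 2 first.
    by move=> i; exact: (Ck_derivable _ (hh k) Vy).
    by move=> i; exact: (Ck_derivable _ (hF i) (I : setT y)).
  congr (_ + _); rewrite /F dotZl; congr (_ * _).
  have -> : grad (h k) y = (- (k.+1%:R * dstep (q k y))) *: grad rho y.
    apply/rowP => i; rewrite !mxE.
    have drho := Ck_derivable (ebase i) hrho1 Vy.
    have E1 := derive_mul (derivable_cstf (k.+1%:R : R) y (ebase i)) drho.
    have E2 := derive_opp (derivable_mul (derivable_cstf (k.+1%:R : R) y (ebase i)) drho).
    have E3 := derive_comp1 (hq k) Ck1_step (fun _ _ => I) (ebase i) Vy.
    have [_ E4] := is_derive_step (q k y).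
    rewrite [LHS]E3 E4 [X in X * _]E2 E1 derive_cstf mulr0 addr0 /partial.
    by rewrite mulNr mulNr mulrAC.
  by rewrite dotZr.
have [C1 C10 hC1] := bounded_supp (fun y => divergence_continuous hF (I : setT y))
  (divergence_supp F0).
have [B B0 hB] := bounded_supp (fun y => Ck_continuous hb (I : setT y)) b0M.
have outC y : ~ C y -> F y = 0 /\ (\near y, F y = 0).
  move=> /nC ry; split; first by rewrite /F b0// scale0r.
  by apply: filterS (near_dist_gt ry) => z rz; rewrite /F b0// scale0r.
have outG k y : ~ C y -> divergence (G k) y = 0.
  move=> /outC[_ nF]; apply: divergence_near0.
  by apply: filterS nF => z Fz; rewrite /G Fz scaler0.
have OmC y : C y -> Om y <-> rho y < 0.
  move=> /CV[Uy _]; split => [Oy|ry].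
    by have : (Om `&` U0) y by []; rewrite OmE => -[].
  by have : ([set y | rho y < 0] `&` U0) y by []; rewrite -OmE => -[].
rewrite /no_net integral_mkcond.
(* pointwise limit of the divergences of G k *)
pose lim y := if y \in Om then divergence F y else 0.
transitivity (\int[lebesgue_tuple d]_s (lim (row_of_tuple s))%:E)%E.
  apply: eq_integral => s _; rewrite patchE /lim.
  have -> : (s \in row_of_tuple @^-1` Om) = (row_of_tuple s \in Om).
    by apply/idP/idP; rewrite !inE.
  by case: ifP.
apply: (@dominated_integral0 (fun k => divergence (G k)) lim M (C1 + B * (2 * K))) => //.
- by rewrite addr_ge0// !mulr_ge0.
- move=> k; rewrite -[setT]/(row_of_tuple @^-1` setT); apply: measurable_fun_row.
    exact: openT.
  by move=> y _; exact: (divergence_continuous (hG k) (I : setT y)).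
- move=> y; have [Cy|nCy] := pselect (C y); last first.
    have -> : lim y = 0.
      by rewrite /lim; case: ifP => // _; apply: divergence_near0; case: (outC _ nCy).
    have -> : (fun k => divergence (G k) y) = cst 0 by apply/funext => k; exact: outG.
    exact: cvg_cst.
  have [ry|ry] := ltP (rho y) 0.
    rewrite /lim mem_set; last exact/OmC.
    apply: cvg_near_cst.
    have : \forall k \near \oo, (- (rho y))^-1 <= k%:R :> R by exact: nbhs_infty_ger.
    apply: filterS => k hk; rewrite GE//.
    have k1 : 1 <= q k y.
      rewrite /q -mulrN -ler_pdivrMr ?oppr_gt0// mul1r (le_trans hk)//.
      by rewrite ler_nat.
    by rewrite /h step1// dstep1// mulr0 oppr0 mul0r mulr0 addr0 mul1r.
  have -> : lim y = 0.
    rewrite /lim; case: ifP => //; rewrite inE => /(OmC _ Cy).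
    by rewrite ltNge ry.
  have -> : (fun k => divergence (G k) y) = cst 0.
    apply/funext => k; rewrite GE//.
    have k0 : q k y <= 0 by rewrite /q oppr_le0 mulr_ge0.
    by rewrite /h step0// dstep0// mulr0 oppr0 !mul0r mulr0 addr0.
  exact: cvg_cst.
- move=> k y; have [Cy|/outG->] := pselect (C y); last first.
    by rewrite normr0 addr_ge0// !mulr_ge0.
  rewrite GE// (le_trans (ler_normD _ _))// lerD//.
    rewrite normrM -[C1]mul1r ler_pM//; exact: step_le1.
  rewrite normrM ler_pM//.
  have [ry|ry] := ltP (rho y) 0; last first.
    have k0 : q k y <= 0 by rewrite /q oppr_le0 mulr_ge0.
    by rewrite dstep0// mulr0 oppr0 mul0r normr0 mulr_ge0.
  rewrite normrM normrN normrM.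
  apply: (@le_trans _ _ (`|k.+1%:R| * `|dstep (q k y)| * (K * `|rho y|))).
    by rewrite ler_wpM2l ?mulr_ge0//; exact: fK.
  have -> : `|k.+1%:R| * `|dstep (q k y)| * (K * `|rho y|) = `|dstep (q k y) * q k y| * K.
    by rewrite normrM {3}/q normrN normrM; ring.
  by apply: ler_wpM2r => //; exact: dstepM_le.
- by move=> k; exact: (divergence_supp (G0 k)).
- by move=> k; exact: (integral_divergence_supp (hG k) (G0 k)).
Qed.

End boundary_flux.

Section global_flux.
Context {R : realType} {d : nat}.
Notation mR := (measurableTypeR R).
Notation E := 'rV[R]_d.
Variables (Om U : set E) (J : E -> E).
Hypotheses (oOm : open Om) (oU : open U) (OmU : closure Om `<=` U).
Hypothesis hJ : forall i, Ck 1 U (component J i).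
Implicit Types (x y v n : E) (b : E -> R).

Lemma Ck1_scaleU b i : Ck 1 setT b -> Ck 1 U (component (fun y => b y *: J y) i).
Proof.
move=> hb; rewrite component_scale; apply: (Ck1M oU) (hJ i).
exact: (@Ck_sub _ _ _ 1 setT).
Qed.

Lemma integrable_scale b M : Ck 1 setT b -> (forall y, M < `|y| -> b y = 0) ->
  integrable_rV Om (divergence (fun y => b y *: J y)).
Proof.
move=> hb b0; apply: (@integrable_compact_supp _ _ U Om _ M) => //.
- exact: open_measurable_row.
- by move=> x Ux; exact: (divergence_continuous (fun i => Ck1_scaleU i hb) Ux).
- move=> x _; apply: divergence_supp => y /b0 ->; exact: scale0r.
Qed.

Lemma no_net_split b psi M : Ck 1 setT b -> Ck 1 setT psi ->
  (forall y, M < `|y| -> b y = 0) ->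
  no_net Om J (fun y => b y * psi y) -> no_net Om J (fun y => b y * (1 - psi y)) ->
  no_net Om J b.
Proof.
move=> hb hpsi b0 h1 h2; rewrite /no_net.
have hb1 : Ck 1 setT (fun y => b y * psi y) := Ck1M openT hb hpsi.
have hb2 : Ck 1 setT (fun y => b y * (1 - psi y)) :=
  Ck1M openT hb (Ck1B openT (Ck1_cst openT (1 : R)) hpsi).
have i1 : integrable_rV Om (divergence (fun y => (b y * psi y) *: J y)).
  by apply: (integrable_scale (M := M) hb1) => y /b0 ->; rewrite mul0r.
have i2 : integrable_rV Om (divergence (fun y => (b y * (1 - psi y)) *: J y)).
  by apply: (integrable_scale (M := M) hb2) => y /b0 ->; rewrite mul0r.
have mOm := @open_measurable_row R d Om oOm.
transitivity (\int[lebesgue_tuple d]_(s in row_of_tuple @^-1` Om)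
   ((divergence (fun y => (b y * psi y)%R *: J y) (row_of_tuple s))%:E +
    (divergence (fun y => (b y * (1 - psi y))%R *: J y) (row_of_tuple s))%:E))%E.
  apply: eq_integral => s /set_mem Oms; congr EFin.
  have Us : U (row_of_tuple s) by apply: OmU; exact: subset_closure.
  rewrite /divergence -big_split; apply: eq_bigr => i _.
  have E1 := derive_add (Ck_derivable (ebase i) (Ck1_scaleU i hb1) Us)
    (Ck_derivable (ebase i) (Ck1_scaleU i hb2) Us).
  rewrite -[RHS]E1 /partial; congr derive.
  by apply/funext => y; rewrite /component !mxE; ring.
rewrite integralD//.
by rewrite [X in (X + _)%E]h1 [X in (_ + X)%E]h2 adde0.
Qed.

Hypothesis bOm : forall x, boundary Om x -> exists n, outer_normal Om x n.
Hypothesis tang : forall x n, boundary Om x -> outer_normal Om x n ->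
  dot (J x) n = 0.

(** A boundary point is in the closure of the open set [Om] but not in [Om]. *)
Lemma no_net_local x : closure Om x -> exists r, 0 < r /\
  forall b, Ck 1 setT b -> (forall y, r < `|y - x| -> b y = 0) -> no_net Om J b.
Proof.
move=> clx; have [Ox|nOx] := pselect (Om x).
  by have [r r0 h] := no_net_interior oOm OmU hJ Ox; exists r.
have bx : boundary Om x by split => // /interior_subset.
have [n hn] := bOm bx.
by have [r r0 h] := no_net_boundary oOm oU OmU hJ tang bx hn; exists r.
Qed.

(** The closure of [Om], cut at norm [M], is covered by finitely many balls on which
    a small bump is [1]. Writing [b = b psi + b (1 - psi)] for these bumps in turn leaves
    a remainder that vanishes on [Om]. *)
Lemma no_net_compact b M : Ck 1 setT b -> (forall y, M < `|y| -> b y = 0) ->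
  no_net Om J b.
Proof.
pose P x (r : R) := closure Om x -> 0 < r /\
    forall b, Ck 1 setT b -> (forall y, r < `|y - x| -> b y = 0) -> no_net Om J b.
have /choice[r hr] : forall x, exists r, P x r.
  move=> x; have [/no_net_local[r hr]|nx] := pselect (closure Om x).
    by exists r => _.
  by exists 0 => clx; exfalso; exact: nx.
(* the bumps of the list l are peeled off one by one *)
have cover (l : seq E) : (forall x, x \in l -> closure Om x) ->
    forall b, Ck 1 setT b -> (forall y, M < `|y| -> b y = 0) ->
    (forall y, Om y -> b y != 0 -> exists2 x, x \in l & bump x (r x) y = 1) ->
    no_net Om J b.
  elim: l => [_ b' hb b0 hy|x l IH lOm b' hb b0 hy].
    apply: integral0_eq => s Oms; rewrite divergence_near0//.
    have : nbhs (row_of_tuple s) Om by exact: open_nbhs_nbhs.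
    apply: filterS => y Oy; have [->|/(hy _ Oy)[]//] := eqVneq (b' y) 0.
    exact: scale0r.
  have [r0 hx] := hr x (lOm x (mem_head _ _)).
  have hpsi := Ck1_bump x (r x).
  apply: (no_net_split hb hpsi b0).
    apply: hx; first exact: (Ck1M openT hb hpsi).
    by move=> y /(bump0 r0) ->; rewrite mulr0.
  apply: IH.
  - by move=> z zl; apply: lOm; rewrite in_cons zl orbT.
  - exact: (Ck1M openT hb (Ck1B openT (Ck1_cst openT (1 : R)) hpsi)).
  - by move=> y /b0 ->; rewrite mul0r.
  - move=> y Oy; rewrite mulf_eq0 negb_or => /andP[by0 psi1].
    have [z zl hz] := hy y Oy by0; exists z => //; move: zl.
    rewrite in_cons => /predU1P[zx|//].
    by move: psi1; rewrite -zx hz subrr eqxx.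
move=> hb b0.
pose K := [set x : E | `|x| <= M] `&` closure Om.
have cK : compact K.
  by apply: compact_closedI; [exact: compact_norm_le|exact: closed_closure].
move: (cK); rewrite compact_cover => /(_ E (closure Om)
  (fun x => [set y | 2 * sqnorm (y - x) < r x ^+ 2]))[].
- move=> x _; apply: (open_comp (f := fun y : E => 2 * sqnorm (y - x))
    (D := [set t : R | t < r x ^+ 2])).
    have h2 : Ck 1 setT (fun y => 2 * sqnorm (y - x)).
      exact: (Ck1M openT (Ck1_cst openT (2 : R)) (Ck1_sqnorm x)).
    by move=> y _; exact: (Ck_continuous h2 (I : setT y)).
  exact: open_lt.
- move=> x [_ clx]; exists x => //=; rewrite subrr.
  have -> : sqnorm (0 : E) = 0.
    by rewrite /sqnorm /dot big1// => i _; rewrite mxE mul0r.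
  by rewrite mulr0 exprn_gt0//; case: (hr x clx).
move=> D' D'Om KD'; apply: (cover (finmap.enum_fset D') _ b hb b0).
  by move=> x /D'Om /set_mem.
move=> y Oy by0; have Ky : K y.
  split; last exact: subset_closure.
  by rewrite /= leNgt; apply: contra by0 => /b0 ->.
have [x xD' hx] := KD' _ Ky; exists x => //.
apply: bump1; last exact: ltW.
by have /D'Om/set_mem/hr[] := xD'.
Qed.

(** Multiplying [J] by the bumps [bump 0 k], which expand to the constant [1], gives
    fields of compact support; their divergences are dominated by
    [|div J| + 8 * sum_i |J_i|] and converge to that of [J]. *)
Lemma divergence_tangential : integrable_rV Om (divergence J) ->
  (forall i, integrable_rV Om (component J i)) ->
  integral_rV Om (divergence J) = 0.
Proof.
move=> idiv iJ.
have mOm := @open_measurable_row R d Om oOm.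
pose g (k : nat) y := divergence (fun y => bump 0 k.+1%:R y *: J y) y.
have gE k y : Om y -> g k y = bump 0 k.+1%:R y * divergence J y +
    dot (J y) (grad (bump 0 k.+1%:R) y).
  move=> Oy; have Uy : U y by apply: OmU; exact: subset_closure.
  apply: divergence_scale => i.
    exact: (Ck_derivable _ (Ck1_bump 0 k.+1%:R) (I : setT y)).
  exact: (Ck_derivable _ (hJ i) Uy).
have supp k y : (k.+1%:R : R) < `|y| -> bump 0 k.+1%:R y = 0 :> R.
  by move=> ky; apply: bump0; rewrite ?subr0.
pose G (s : d.-tuple mR) : R := `|divergence J (row_of_tuple s)| +
  \sum_i 8 * `|component J i (row_of_tuple s)|.
have iG : (lebesgue_tuple d).-integrable (row_of_tuple @^-1` Om) (EFin \o G).
  have -> : EFin \o G = (fun s => `|(divergence J (row_of_tuple s))%:E| +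
    \sum_i 8%:E * `|(component J i (row_of_tuple s))%:E|)%E.
    by apply/funext => s; rewrite /G /= EFinD sumEFin.
  apply: integrableD => //; first exact: (integrable_abse idiv).
  apply: integrable_sum => // i _; apply: integrableZl => //.
  exact: (integrable_abse (iJ i)).
have H : (\int[lebesgue_tuple d]_(s in row_of_tuple @^-1` Om) (g k (row_of_tuple s))%:E)%E
  @[k --> \oo] -->
  (\int[lebesgue_tuple d]_(s in row_of_tuple @^-1` Om) (divergence J (row_of_tuple s))%:E)%E.
  apply: (@dominated_cvg _ _ _ _ _ mOm _ _ (EFin \o G)) => //.
  - move=> k; apply/measurable_EFinP; apply: (measurable_funS _ _ (measurable_fun_row oU _)).
    + exact: open_measurable_row.
    + by move=> y Oy; apply: OmU; exact: subset_closure.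
    + move=> y Uy.
      exact: (divergence_continuous (fun i => Ck1_scaleU i (Ck1_bump 0 k.+1%:R)) Uy).
  - move=> s Os; apply: cvg_EFin; first exact: nearW.
    apply: cvg_near_cst; set y := row_of_tuple s.
    have : \forall k \near \oo, 2 * sqnorm y <= k%:R :> R by exact: nbhs_infty_ger.
    apply: filterS => k hk; rewrite /= gE//.
    have hy : 2 * sqnorm y <= k.+1%:R ^+ 2.
      apply: (le_trans hk); rewrite expr2 -[leLHS]mulr1 ler_pM ?ler0n ?ler01 ?ler_nat//.
      by rewrite ler1n.
    rewrite bump1 ?subr0// mul1r /dot big1 ?addr0// => i _.
    by rewrite [grad _ _ _ _]mxE partial_bump0// mulr0.
  - move=> k s Os; rewrite /= lee_fin gE// /G (le_trans (ler_normD _ _))// lerD//.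
      by rewrite normrM -[leRHS]mul1r ler_wpM2r// bump_le1.
    rewrite (le_trans (ler_norm_sum _ _ _))// ler_sum// => i _.
    rewrite [grad _ _ _ _]mxE normrM mulrC ler_wpM2r// partial_bump_le//.
    by rewrite ler1n.
have G0 k : (\int[lebesgue_tuple d]_(s in row_of_tuple @^-1` Om)
    (g k (row_of_tuple s))%:E)%E = 0%E.
  exact: (no_net_compact (Ck1_bump 0 k.+1%:R) (supp k)).
rewrite /integral_rV /Rintegral (_ : (\int[_]_(_ in _) _)%E = 0%E)//.
apply: (@cvg_unique _ (@ereal_hausdorff R) _ _ _ _ H).
rewrite (_ : (fun _ => _) = cst 0%E); first exact: cvg_cst.
by apply/funext => k; exact: G0.
Qed.

End global_flux.

(** * Conservation laws on spatial domains *)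

Section spacetime.
Context {R : realType} {d : nat}.
Notation E := 'rV[R]_d.
Implicit Types (t : R) (x : E) (W : set (R * E)).

(** Time and space derivatives of [f] are directional derivatives of this single
    function on space-time. *)
Definition unc {X : Type} (f : R -> E -> X) (z : R * E) : X := f z.1 z.2.

Lemma dtE (X : normedModType R) (f : R -> E -> X) t x :
  dt f t x = 'D_(1, 0) (unc f) (t, x).
Proof.
rewrite /dt derive1E.
apply: (@derive_affine _ _ _ _ (fun s : R => (s, x)) (unc f)) => h.
by congr pair; rewrite /= ?scaler0 add0r.
Qed.

Lemma partialE (f : R -> E -> R) i t x :
  partial i (f t) x = 'D_(0, ebase i) (unc f) (t, x).
Proof.
apply: (@derive_affine _ _ _ _ (fun y : E => (t, y)) (unc f)) => h.
by congr pair; rewrite /= ?scaler0 add0r.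
Qed.

Lemma slice_differentiable t x : differentiable (fun y : E => (t, y)) x.
Proof. by apply: differentiable_pair. Qed.

Lemma open_slice W t : open W -> open [set x | W (t, x)].
Proof.
move=> oW; apply: (@open_comp _ _ (fun y : E => (t, y)) W) oW => x _.
exact/differentiable_continuous/slice_differentiable.
Qed.

Lemma Ck_slice k W (f : R -> E -> R) t : Ck k W (unc f) ->
  Ck k [set x | W (t, x)] (f t).
Proof.
move=> hf.
apply: (@Ck_affine _ _ _ _ (fun y : E => (t, y)) (fun y => (0, y)) k W (unc f)) hf.
  by move=> x; exact: slice_differentiable.
by move=> h e x; congr pair; rewrite /= ?scaler0 add0r.
Qed.

Lemma derivable_time W (f : R -> E -> R) t x : Ck 1 W (unc f) -> W (t, x) ->
  derivable (f^~ x) t 1.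
Proof.
move=> hf Wtx.
have LE (h : R) : (h *: 1 + t, x) = h *: ((1 : R), (0 : E)) + (t, x) :> R * E.
  by congr pair; rewrite /= ?scaler0 add0r.
have [_ h] := growth_affine (L := fun s : R => (s, x)) (unc f) LE.
by apply: h; exact: (Ck_derivable _ hf).
Qed.

End spacetime.
Arguments open_slice {R d W} t _.

Section conservation.
Context {R : realType} {d : nat}.
Notation mR := (measurableTypeR R).
Notation E := 'rV[R]_d.
Variables (D : spatial_domain R d) (T : R).
Hypothesis hD : regular_domain D.
Variable W : set (R * E).
Hypotheses (oW : open W)
  (WD : forall t x, 0 < t < T -> closure (region D) x -> W (t, x)).
Implicit Types (t : R) (x : E).

Lemma measurable_cell : measurable (row_of_tuple @^-1` (cell D) : set (d.-tuple mR)).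
Proof.
case: D hD => [Om|L] /=; last by move=> _; exact: measurable_cell_torus.
by move=> [oOm _ _ _]; exact: open_measurable_row.
Qed.

Lemma cell_region : cell D `<=` region D.
Proof. by case: D => [Om|L] x. Qed.

Lemma cell_bounded : bounded_domain D -> exists2 M, 0 <= M & forall x, cell D x -> `|x| <= M.
Proof.
case: D => [Om|L] /=.
  move=> [M [_ hM]]; exists (`|M| + 1); first by rewrite addr_ge0.
  by move=> x Ox; apply: hM => //; rewrite (le_lt_trans (ler_norm _))// ltrDl.
by move=> _; exists `|L| => // x; exact: cell_torus_le.
Qed.

Lemma integrable_cell t (g : E -> R) : bounded_domain D -> 0 < t < T ->
  (forall x, W (t, x) -> {for x, continuous g}) -> integrable_rV (cell D) g.
Proof.
move=> /cell_bounded[M M0 hM] tT cg.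
apply: (@integrable_compact_supp _ _ [set x | W (t, x)] _ _ M) => //.
- exact: open_slice.
- by move=> x cx; apply: WD => //; apply: closure_subset cx; exact: cell_region.
- exact: measurable_cell.
- by move=> x /hM; rewrite leNgt => /negP.
Qed.

(** The time derivative is continuous, hence bounded, on the compact product of
    a time interval and the closure of the domain. *)
Lemma bounded_dominated (e : R -> E -> R) : bounded_domain D ->
  Ck 1 W (unc e) -> dominated_density D T e.
Proof.
move=> bD he t tT; split.
  apply: (integrable_cell bD tT) => x Wx.
  exact: (Ck_continuous (Ck_slice t he) Wx).
have [M M0 hM] := cell_bounded bD.
have [d0 d00 hd0] : exists2 d0, 0 < d0 & forall s, `|s - t| <= d0 -> 0 < s < T.
  move/andP: tT => [t0 tT].
  exists (Num.min t (T - t) / 2); first by rewrite divr_gt0// lt_min t0 subr_gt0.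
  move=> s; rewrite ler_distl => /andP[h1 h2].
  have m1 : Num.min t (T - t) <= t by rewrite ge_min lexx.
  have m2 : Num.min t (T - t) <= T - t by rewrite ge_min lexx orbT.
  by apply/andP; split; lra.
(* d0 is half the distance of t to the ends of the time interval *)
pose K := [set s : R | `|s - t| <= d0] `*` ([set x : E | `|x| <= M] `&` closure (region D)).
have cK : compact K.
  apply: compact_setX; last first.
    by apply: compact_closedI; [exact: compact_norm_le|exact: closed_closure].
  rewrite (_ : mkset _ = `[t - d0, t + d0]%classic); first exact: segment_compact.
  by apply/seteqP; split => s /=; rewrite in_itv/= ler_distl.
have KW z : K z -> W z.
  by case: z => s x [/= sd [_ clx]]; apply: WD => //; exact: hd0.
have cde z : K z -> {for z, continuous (fun z => 'D_((1, 0) : R * E) (unc e) z)}.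
  by move=> /KW Wz; exact: (Ck_continuous (Ck_derive ((1, 0) : R * E) he) Wz).
have [C C0 hC] := compact_le cK cde.
exists (fun _ => C).
  by apply: (integrable_cell bD tT) => x _; exact: cst_continuous.
have : \forall s \near t, `|s - t| < d0.
  apply: (@near_lt _ _ (fun s => `|s - t|)); last by rewrite subrr normr0.
  exact: dist_continuous.
apply: filterS => s sd x cx; rewrite dtE; apply: hC; split; first exact: ltW.
split; first exact: hM.
by apply: subset_closure; exact: cell_region.
Qed.

Lemma bounded_integrable_flux (J : R -> E -> E) : bounded_domain D ->
  (forall i, Ck 1 W (fun z => J z.1 z.2 0 i)) -> integrable_flux D T J.
Proof.
move=> bD hJ t i tT; apply: (integrable_cell bD tT) => x Wx.
exact: (Ck_continuous (Ck_slice (f := fun t x => J t x 0 i) t (hJ i)) Wx).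
Qed.

Lemma is_derive_space_integral (e : R -> E -> R) t : Ck 1 W (unc e) ->
  dominated_density D T e -> 0 < t < T ->
  is_derive t 1 (fun s => space_integral D (e s)) (space_integral D (dt e t)).
Proof.
move=> he de tT.
have [_ [G iG hG]] := de t tT.
have : \forall s \near t, 0 < s < T /\ forall x, cell D x -> `|dt e s x| <= G x.
  apply: filterI => //.
  have : t \in `]0, T[ by rewrite in_itv.
  by move=> /near_in_itvoo; apply: filterS => s; rewrite in_itv.
move=> /nbhs_ballP[r /= r0 hr].
pose I : set R := `]t - r, t + r[%classic.
have It : I t by rewrite /I /= in_itv /=; apply/andP; split; lra.
have hI s : I s -> 0 < s < T /\ forall x, cell D x -> `|dt e s x| <= G x.
  by rewrite /I /= in_itv/= -ltr_distl distrC => sr; apply: hr.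
pose f (s : R) (y : d.-tuple mR) := e s (row_of_tuple y).
have intf s : I s -> (lebesgue_tuple d).-integrable (row_of_tuple @^-1` cell D)
    (EFin \o f s).
  by move=> /hI[sT _]; have [] := de s sT.
have derf s y : I s -> (row_of_tuple @^-1` cell D) y -> derivable (f ^~ y) s 1.
  move=> /hI[sT _] cy; apply: (derivable_time he); apply: WD => //.
  by apply: subset_closure; exact: cell_region.
have G0 (y : d.-tuple mR) : 0 <= `|G (row_of_tuple y)| by [].
have iG' : (lebesgue_tuple d).-integrable (row_of_tuple @^-1` cell D)
    (EFin \o (fun y => `|G (row_of_tuple y)|)).
  exact: (integrable_norm iG).
have G_ub s y : I s -> (row_of_tuple @^-1` cell D) y ->
    `|partial1of2 f s y| <= `|G (row_of_tuple y)|.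
  by move=> /hI[_ h] cy; rewrite (le_trans (h _ cy))// ler_norm.
have h1 := derivable_under_integral measurable_cell It intf derf G0 iG' G_ub.
have h2 := differentiation_under_integral measurable_cell It intf derf G0 iG' G_ub.
apply: DeriveDef; first exact: h1.
by rewrite -derive1E; exact: h2.
Qed.

Section flux.
Variables (J : R -> E -> E).
Hypothesis hJ : forall i, Ck 1 W (fun z => J z.1 z.2 0 i).
Hypothesis pJ : Defs.periodic D T J.
Hypothesis nJ : no_flux D T J.
Hypothesis iJ : integrable_flux D T J.

Lemma Ck1_flux_slice t i : Ck 1 [set x | W (t, x)] (component (J t) i).
Proof. exact: (Ck_slice (f := fun t x => J t x 0 i) t (hJ i)). Qed.

(** For an open domain the field is tangential to the boundary. On the torus the
    fluxes through opposite faces of the cell cancel by periodicity. *)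
Lemma space_integral_divergence t : 0 < t < T ->
  integrable_rV (cell D) (divergence (J t)) -> space_integral D (divergence (J t)) = 0.
Proof.
move=> tT; have oWt := open_slice t oW.
case: D hD WD pJ nJ (iJ (t := t)) => [Om|L] /=.
  move=> [oOm _ _ bOm] WOm _ nOm iOm idiv.
  apply: (divergence_tangential oOm oWt _ (Ck1_flux_slice t) bOm) => //.
  - by move=> x clx; exact: WOm.
  - by move=> x n bx hn; exact: nOm.
  - by move=> i; exact: iOm.
move=> L0 WL per _ _ idiv.
have WT : [set x | W (t, x)] = setT.
  apply/seteqP; split => // x _; apply: WL => //; exact: subset_closure.
have hJt i : Ck 1 setT (component (J t) i) by rewrite -WT; exact: Ck1_flux_slice.
have mc := @measurable_cell_torus R d L.
rewrite /space_integral /integral_rV /Rintegral.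
rewrite (_ : (\int[_]_(_ in _) _)%E = 0%E)//.
under eq_integral => s _ do rewrite /divergence -sumEFin.
rewrite integral_sum//.
  apply: big1 => i _; apply: integral_partial_periodic => //.
  by move=> x; rewrite /component per.
move=> i; apply: (@integrable_compact_supp _ _ setT _ (partial i (component (J t) i)) `|L|) => //.
- exact: openT.
- by move=> x _; exact: (Ck1_partial_continuous (hJt i) (I : setT x)).
- by move=> x /cell_torus_le; rewrite leNgt => /negP.
Qed.

(** All three energy balances are brought into this form. The hypotheses concern
    one open set [W] of space-time on which every field is regular. *)
Lemma conservation (e : R -> E -> R) : Ck 1 W (unc e) -> dominated_density D T e ->
  (forall t x, 0 < t < T -> region D x -> dt e t x = - divergence (J t) x) ->
  conserved T (fun t => space_integral D (e t)).
Proof.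
move=> he de balance t tT.
have dJ x : cell D x -> divergence (J t) x = - dt e t x.
  by move=> /cell_region rx; rewrite balance// opprK.
have [_ [G iG hG]] := de t tT.
have idiv : integrable_rV (cell D) (divergence (J t)).
  apply: (le_integrable measurable_cell _ _ iG).
    apply/measurable_EFinP.
    apply: (measurable_funS _ _ (measurable_fun_row (open_slice t oW) _)).
      apply: open_measurable_row; exact: (open_slice t oW).
    - move=> s cs; apply: WD => //.
      by apply: subset_closure; exact: cell_region.
    - by move=> x Wx; exact: (divergence_continuous (Ck1_flux_slice t) Wx).
  move=> s cs; rewrite lee_fin (dJ _ cs) normrN.
  by rewrite (le_trans (nbhs_singleton hG _ cs))// ler_norm.
have h := is_derive_space_integral he de tT.
suff h0 : space_integral D (dt e t) = 0 by rewrite h0 in h.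
rewrite -oppr0 -(space_integral_divergence tT idiv) /space_integral /integral_rV.
rewrite -mulN1r -RintegralZl//; last exact: measurable_cell.
by apply: eq_Rintegral => s /set_mem cs; rewrite dJ// mulN1r opprK.
Qed.

End flux.
End conservation.

(** * Fields along a solution *)

Section vector_components.
Context {R : realType} {d : nat} {V : normedModType R}.
Implicit Types (F : V -> 'rV[R]_d).

Lemma derive_component F v x j : derivable F x v ->
  'D_v F x 0 j = 'D_v (fun y => F y 0 j) x.
Proof. by move=> /(@derive_mx _ _ 1 d F x v) ->; rewrite mxE. Qed.

Lemma Ck_component k U F j : open U -> Ck k U F -> Ck k U (fun y => F y 0 j).
Proof.
move=> oU; elim: k F => [|k IH] F.
  rewrite !Ck0E => h x Ux.
  apply: (@continuous_comp _ _ _ F (fun M : 'rV[R]_d => M 0 j)); first exact: h.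
  exact: coord_continuous.
rewrite !CkS => -[h1 h2]; split=> [x Ux|v].
  apply: (@differentiable_comp _ _ _ _ F (fun M : 'rV[R]_d => M 0 j)).
    exact: h1.
  exact: differentiable_coord.
apply: (@Ck_ext_open _ _ _ _ _ (fun y => 'D_v F y 0 j)) => //; last exact: IH.
by move=> x Ux; apply: derive_component; exact/diff_derivable/h1.
Qed.

End vector_components.

Section state.
Context {R : realType} {d : nat}.
Notation E := 'rV[R]_d.
Variables (W : set (R * E)) (phi theta : R -> E -> R).
Hypotheses (oW : open W) (hphi : Ck 2 W (unc phi)) (htheta : Ck 2 W (unc theta))
  (theta_gt0 : forall z, W z -> 0 < unc theta z).

Definition state (z : R * E) : R * E * R :=
  (phi z.1 z.2, grad (phi z.1) z.2, theta z.1 z.2).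

Let dir (i : 'I_1 + 'I_d + 'I_1) : R * E * R :=
  match i with
  | inl (inl _) => ((1, 0), 0)
  | inl (inr j) => ((0, ebase j), 0)
  | inr _ => ((0, 0), 1)
  end.

Let coor (i : 'I_1 + 'I_d + 'I_1) (z : R * E) : R :=
  match i with
  | inl (inl _) => unc phi z
  | inl (inr j) => 'D_(0, ebase j) (unc phi) z
  | inr _ => unc theta z
  end.

Let stateE z : \sum_i coor i z *: dir i = state z.
Proof.
rewrite !big_sumType !big_ord1 /=.
have h (F : 'I_d -> E) : \sum_j ((0 : R, F j, 0 : R) : R * E * R) = (0, \sum_j F j, 0).
  elim/big_rec2: _ => // j y1 y2 _ ->.
  by rewrite -[LHS]/((0 + 0, F j + y1, 0 + 0)) !addr0.
rewrite (eq_bigr (fun j => (0, 'D_(0, ebase j) (unc phi) z *: ebase j, 0) : R * E * R)); last first.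
  move=> j _; set k := 'D__ _ _.
  by rewrite -[LHS]/((k * 0, k *: ebase j, k * 0) : R * E * R) !mulr0.
rewrite h -[LHS]/((unc phi z * 1 + 0 + unc theta z * 0,
  unc phi z *: 0 + \sum_j 'D_(0, ebase j) (unc phi) z *: ebase j + unc theta z *: 0,
  unc phi z * 0 + 0 + unc theta z * 1)).
rewrite mulr1 !mulr0 !addr0 add0r mulr1 !scaler0 addr0 add0r /state.
congr (_, _); congr (_, _).
apply/rowP => j; rewrite summxE mxE (bigD1 j)//= big1 ?addr0.
  by rewrite !mxE !eqxx mulr1; case: z => t x; rewrite partialE.
by move=> k kj; rewrite !mxE eqxx eq_sym (negbTE kj) mulr0.
Qed.

Let hcoor i : Ck 1 W (coor i).
Proof.
case: i => [[a|j]|a]; [exact: (Ck_pred hphi)|exact: (Ck_derive (0, ebase j) hphi)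
  |exact: (Ck_pred htheta)].
Qed.

Variable g : R * E * R -> R.
Hypothesis hg : Ck 1 [set z : R * E * R | 0 < z.2] g.

Let Wdom z : W z -> [set z : R * E * R | 0 < z.2] (\sum_i coor i z *: dir i).
Proof. by rewrite stateE => /theta_gt0. Qed.

Lemma Ck1_state : Ck 1 W (fun z => g (state z)).
Proof.
have -> : (fun z => g (state z)) = (fun z => g (\sum_i coor i z *: dir i)).
  by apply/funext => z; rewrite stateE.
exact: (Ck1_comp_coordinates oW hcoor hg Wdom).
Qed.

(** The three groups of terms are the derivatives of [g] in the phase, in the
    gradient and in the temperature. *)
Lemma derive_state v z : W z -> 'D_v (fun z => g (state z)) z =
  'D_v (unc phi) z * 'D_((1, 0), 0) g (state z) +
  \sum_j 'D_v (fun z => 'D_(0, ebase j) (unc phi) z) z * 'D_((0, ebase j), 0) g (state z) +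
  'D_v (unc theta) z * 'D_((0, 0), 1) g (state z).
Proof.
move=> Wz.
have -> : (fun z => g (state z)) = (fun z => g (\sum_i coor i z *: dir i)).
  by apply/funext => y; rewrite stateE.
rewrite (derive_comp_coordinates hcoor hg Wdom v Wz) stateE.
by rewrite !big_sumType !big_ord1.
Qed.

End state.

Section phase_temperature.
Context {R : realType} {d : nat}.
Notation E := 'rV[R]_d.
Variables (W : set (R * E)) (phi theta : R -> E -> R).
Hypotheses (oW : open W) (hphi : Ck 1 W (unc phi)) (htheta : Ck 1 W (unc theta))
  (theta_gt0 : forall z, W z -> 0 < unc theta z).

Lemma Ck1_phase_temperature (kappa : R -> R -> R) :
  Ck 1 [set z : R * R | 0 < z.2] (fun z => kappa z.1 z.2) ->
  Ck 1 W (fun z => kappa (unc phi z) (unc theta z)).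
Proof.
move=> hk.
pose b (i : bool) : R * R := if i then (1, 0) else (0, 1).
pose c (i : bool) z := if i then unc phi z else unc theta z.
have cE z : \sum_i c i z *: b i = (unc phi z, unc theta z).
  rewrite big_bool /c /b.
  rewrite -[LHS]/((unc phi z * 1 + unc theta z * 0, unc phi z * 0 + unc theta z * 1)).
  by rewrite !mulr1 !mulr0 addr0 add0r.
have hc i : Ck 1 W (c i) by case: i; [exact: hphi|exact: htheta].
have Wd z : W z -> [set z : R * R | 0 < z.2] (\sum_i c i z *: b i).
  by rewrite cE => /theta_gt0.
have -> : (fun z => kappa (unc phi z) (unc theta z)) =
    (fun z => (fun w => kappa w.1 w.2) (\sum_i c i z *: b i)).
  by apply/funext => z; rewrite cE.
exact: (Ck1_comp_coordinates oW hc hk Wd).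
Qed.

End phase_temperature.

Section divergence_rules.
Context {R : realType} {d : nat}.
Notation E := 'rV[R]_d.
Implicit Types (F G : E -> E) (x : E).

Lemma divergenceD U F G x : (forall i, Ck 1 U (component F i)) ->
  (forall i, Ck 1 U (component G i)) -> U x ->
  divergence (fun y => F y + G y) x = divergence F x + divergence G x.
Proof.
move=> hF hG Ux; rewrite /divergence -big_split; apply: eq_bigr => i _.
have Eq := derive_add (Ck_derivable (ebase i) (hF i) Ux) (Ck_derivable (ebase i) (hG i) Ux).
rewrite -[RHS]Eq.
have -> : component (fun y => F y + G y) i = (fun y => component F i y + component G i y).
  by apply/funext => y; rewrite /component mxE.
by [].
Qed.

Lemma divergenceZ U F x (k : R) : (forall i, Ck 1 U (component F i)) -> U x ->
  divergence (fun y => k *: F y) x = k * divergence F x.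
Proof.
move=> hF Ux; rewrite (@divergence_scale _ _ (fun _ => k)).
- rewrite (_ : grad _ _ = 0) ?[dot _ 0]big1 ?addr0// => [i _|]; first by rewrite mxE mulr0.
  by apply/rowP => i; rewrite !mxE /partial derive_cstf.
- by move=> i; exact: derivable_cstf.
- by move=> i; exact: (Ck_derivable _ (hF i) Ux).
Qed.

Lemma divergenceB U F G x : (forall i, Ck 1 U (component F i)) ->
  (forall i, Ck 1 U (component G i)) -> U x ->
  divergence (fun y => F y - G y) x = divergence F x - divergence G x.
Proof.
move=> hF hG Ux; rewrite /divergence -sumrB; apply: eq_bigr => i _.
have Eq := derive_sub (Ck_derivable (ebase i) (hF i) Ux) (Ck_derivable (ebase i) (hG i) Ux).
rewrite -[RHS]Eq.
have -> : component (fun y => F y - G y) i = (fun y => component F i y - component G i y).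
  by apply/funext => y; rewrite /component !mxE.
by [].
Qed.

Lemma Ck1_componentB U F G i : open U -> Ck 1 U (component F i) ->
  Ck 1 U (component G i) -> Ck 1 U (component (fun y => F y - G y) i).
Proof.
move=> oU hF hG.
have -> : component (fun y => F y - G y) i = (fun y => component F i y - component G i y).
  by apply/funext => y; rewrite /component !mxE.
exact: (Ck1B oU hF hG).
Qed.

Lemma Ck1_componentD U F G i : open U -> Ck 1 U (component F i) ->
  Ck 1 U (component G i) -> Ck 1 U (component (fun y => F y + G y) i).
Proof.
move=> oU hF hG.
have -> : component (fun y => F y + G y) i = (fun y => component F i y + component G i y).
  by apply/funext => y; rewrite /component mxE.
exact: (Ck1D oU hF hG).
Qed.

Lemma divergence_mul U (f : E -> R) F x : Ck 1 U f ->
  (forall i, Ck 1 U (component F i)) -> U x ->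
  divergence (fun y => f y *: F y) x = f x * divergence F x + dot (F x) (grad f x).
Proof.
move=> hf hF Ux; apply: divergence_scale => i; first exact: (Ck_derivable _ hf Ux).
exact: (Ck_derivable _ (hF i) Ux).
Qed.

Lemma Ck1_component_scale U (f : E -> R) F i : open U -> Ck 1 U f ->
  Ck 1 U (component F i) -> Ck 1 U (component (fun y => f y *: F y) i).
Proof.
move=> oU hf hF.
have -> : component (fun y => f y *: F y) i = (fun y => f y * component F i y).
  by apply/funext => y; rewrite /component mxE.
exact: (Ck1M oU hf hF).
Qed.

End divergence_rules.

Section energy.
Context {R : realType} {d : nat}.
Notation E := 'rV[R]_d.
Variables (psi : R -> E -> R -> R) (kappa : R -> R -> R).
Hypotheses (hpsi : Ck 2 [set z : R * E * R | 0 < z.2]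
              (fun z => psi z.1.1 z.1.2 z.2))
  (hkappa : Ck 1 [set z : R * R | 0 < z.2] (fun z => kappa z.1 z.2)).
Variables (W : set (R * E)) (phi theta : R -> E -> R).
Hypotheses (oW : open W) (hphi : Ck 2 W (unc phi)) (htheta : Ck 2 W (unc theta))
  (theta_gt0 : forall z, W z -> 0 < unc theta z).

Let Psi (z : R * E * R) := psi z.1.1 z.1.2 z.2.
Let S := state phi theta.

Lemma dpsi_dphiE t x : dpsi_dphi psi phi theta t x = 'D_((1, 0), 0) Psi (S (t, x)).
Proof.
rewrite /dpsi_dphi derive1E.
apply: (@derive_affine _ _ _ _ (fun a : R => ((a, grad (phi t) x), theta t x)) Psi) => h.
rewrite -[RHS]/((h * 1 + phi t x, h *: 0 + grad (phi t) x, h * 0 + theta t x)).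
by rewrite scaler0 mulr0 !add0r.
Qed.

Lemma dpsi_dthetaE t x : dpsi_dtheta psi phi theta t x = 'D_((0, 0), 1) Psi (S (t, x)).
Proof.
rewrite /dpsi_dtheta derive1E.
apply: (@derive_affine _ _ _ _ (fun a : R => ((phi t x, grad (phi t) x), a)) Psi) => h.
rewrite -[RHS]/((h * 0 + phi t x, h *: 0 + grad (phi t) x, h * 1 + theta t x)).
by rewrite scaler0 mulr0 !add0r.
Qed.

Lemma dpsi_dgradE t x j :
  dpsi_dgrad psi phi theta t x 0 j = 'D_((0, ebase j), 0) Psi (S (t, x)).
Proof.
rewrite /dpsi_dgrad mxE.
apply: (@derive_affine _ _ _ _ (fun w : E => ((phi t x, w), theta t x)) Psi) => h.
rewrite -[RHS]/((h * 0 + phi t x, h *: ebase j + grad (phi t) x, h * 0 + theta t x)).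
by rewrite mulr0 !add0r.
Qed.

Let hPsi := hpsi : Ck 2 [set z : R * E * R | 0 < z.2] Psi.

Lemma Ck1_free_energy : Ck 1 W (unc (free_energy psi phi theta)).
Proof. exact: (Ck1_state oW hphi htheta theta_gt0 (Ck_pred hPsi)). Qed.

Lemma Ck1_entropy : Ck 1 W (unc (entropy psi phi theta)).
Proof.
have -> : unc (entropy psi phi theta) = fun z => - 'D_((0, 0), 1) Psi (S z).
  by apply/funext => -[t x]; rewrite /unc /entropy dpsi_dthetaE.
exact: (Ck1N oW (Ck1_state oW hphi htheta theta_gt0
  (Ck_derive (((0, 0), 1) : R * E * R) hPsi))).
Qed.

Lemma Ck1_internal_energy : Ck 1 W (unc (internal_energy psi phi theta)).
Proof.
exact: (Ck1D oW Ck1_free_energy (Ck1M oW (Ck_pred htheta) Ck1_entropy)).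
Qed.

Lemma Ck1_dpsi_dgrad j : Ck 1 W (fun z => dpsi_dgrad psi phi theta z.1 z.2 0 j).
Proof.
have -> : (fun z => dpsi_dgrad psi phi theta z.1 z.2 0 j) =
    fun z => 'D_((0, ebase j), 0) Psi (S z).
  by apply/funext => -[t x]; exact: dpsi_dgradE.
exact: (Ck1_state oW hphi htheta theta_gt0 (Ck_derive (((0, ebase j), 0) : R * E * R) hPsi)).
Qed.

Lemma Ck1_partial (f : R -> E -> R) i : Ck 2 W (unc f) ->
  Ck 1 W (fun z => partial i (f z.1) z.2).
Proof.
move=> hf; have -> : (fun z => partial i (f z.1) z.2) = fun z => 'D_(0, ebase i) (unc f) z.
  by apply/funext => -[t x]; exact: partialE.
exact: (Ck_derive ((0, ebase i) : R * E) hf).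
Qed.

Lemma Ck1_dt (f : R -> E -> R) : Ck 2 W (unc f) -> Ck 1 W (unc (dt f)).
Proof.
move=> hf; have -> : unc (dt f) = fun z => 'D_(1, 0) (unc f) z.
  by apply/funext => -[t x]; exact: dtE.
exact: (Ck_derive ((1, 0) : R * E) hf).
Qed.

Lemma Ck1_heat_flux j : Ck 1 W (fun z => heat_flux kappa phi theta z.1 z.2 0 j).
Proof.
have -> : (fun z => heat_flux kappa phi theta z.1 z.2 0 j) =
    fun z => kappa (unc phi z) (unc theta z) * partial j (theta z.1) z.2.
  by apply/funext => z; rewrite /heat_flux !mxE.
apply: (Ck1M oW _ (Ck1_partial j htheta)).
exact: (Ck1_phase_temperature oW (Ck_pred hphi) (Ck_pred htheta) theta_gt0 hkappa).
Qed.

Section at_point.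
Variables (t : R) (x : E).
Hypothesis Wtx : W (t, x).
Let U := [set y | W (t, y)].
Let oU : open U := open_slice t oW.
Let Ux : U x := Wtx.

(** Gibbs relation. The rate of temperature drops out of the rate of
    [psi + theta s] because [s] is minus the temperature derivative of [psi]. By symmetry
    of second derivatives the rate of the gradient of the phase is the gradient of its
    rate, and Leibniz' rule makes the work of [dpsi_dgrad] a divergence. *)
Lemma dt_internal_energy :
  dt (internal_energy psi phi theta) t x =
  divergence (fun y => dt phi t y *: dpsi_dgrad psi phi theta t y) x
  - dt phi t x * chem_pot psi phi theta t x
  + theta t x * dt (entropy psi phi theta) t x.
Proof.
have hs := Ck1_entropy; have hf := Ck1_free_energy.
have h1 := Ck_pred htheta.
have E1 := derive_mul (Ck_derivable ((1, 0) : R * E) h1 Wtx)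
  (Ck_derivable ((1, 0) : R * E) hs Wtx).
have E2 := derive_add (Ck_derivable ((1, 0) : R * E) hf Wtx)
  (Ck_derivable ((1, 0) : R * E) (Ck1M oW h1 hs) Wtx).
have E3 := @derive_state R d W phi theta hphi htheta theta_gt0 Psi (Ck_pred hPsi)
  ((1, 0) : R * E) (t, x) Wtx.
have udt : unc (dt phi) = (fun z => 'D_((1, 0) : R * E) (unc phi) z).
  by apply/funext => -[s y]; exact: dtE.
have comm j := derive_comm ((1, 0) : R * E) ((0, ebase j) : R * E) oW hphi Wtx.
rewrite dtE [LHS]E2 E1 [X in X + _]E3.
rewrite (@divergence_mul _ _ U (dt phi t) (dpsi_dgrad psi phi theta t)); last 3 first.
- exact: (Ck_slice t (Ck1_dt hphi)).
- move=> i; exact: (Ck_slice (f := fun t x => dpsi_dgrad psi phi theta t x 0 i) t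
    (Ck1_dpsi_dgrad i)).
- exact: Wtx.
have -> : dot (dpsi_dgrad psi phi theta t x) (grad (dt phi t) x) =
    \sum_j 'D_(1, 0) (fun z => 'D_(0, ebase j) (unc phi) z) (t, x) *
           'D_((0, ebase j), 0) Psi (S (t, x)).
  apply: eq_bigr => j _; rewrite dpsi_dgradE [grad _ _ _ _]mxE partialE mulrC.
  suff -> : 'D_(0, ebase j) (unc (dt phi)) (t, x) =
      'D_(1, 0) (fun z => 'D_(0, ebase j) (unc phi) z) (t, x) by [].
  apply: (etrans _ (esym (comm j))).
  exact: (congr1 (fun F => 'D_(0, ebase j) F (t, x)) udt).
rewrite /chem_pot dpsi_dphiE (dtE (entropy _ _ _)) (dtE phi).
have sE : unc (entropy psi phi theta) (t, x) = - 'D_((0, 0), 1) Psi (S (t, x)).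
  by rewrite -dpsi_dthetaE.
rewrite sE /unc /=.
ring.
Qed.

Lemma Ck1_heat_flux_slice i : Ck 1 U (component (heat_flux kappa phi theta t) i).
Proof.
exact: (Ck_slice (f := fun t x => heat_flux kappa phi theta t x 0 i) t (Ck1_heat_flux i)).
Qed.

(** Leibniz' rule for [q / theta], where [q] is parallel to the gradient of the
    temperature. *)
Lemma divergence_entropy_flux :
  theta t x * divergence (entropy_flux kappa phi theta t) x =
  divergence (heat_flux kappa phi theta t) x - heat_dissipation kappa phi theta t x.
Proof.
have th0 : theta t x != 0 by rewrite gt_eqF//; exact: (theta_gt0 Wtx).
have hth : Ck 1 U (theta t) := Ck_slice t (Ck_pred htheta).
have U0 y : U y -> theta t y != 0 by move=> Uy; rewrite gt_eqF//; exact: (theta_gt0 Uy).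
rewrite (@divergence_mul _ _ U (fun y => (theta t y)^-1)); last 3 first.
- exact: (Ck1V oU U0 hth).
- exact: Ck1_heat_flux_slice.
- exact: Wtx.
have -> : grad (fun y => (theta t y)^-1) x = (- theta t x ^- 2) *: grad (theta t) x.
  apply/rowP => i; rewrite !mxE /partial.
  exact: (deriveV th0 (Ck_derivable (ebase i) hth Ux)).
rewrite dotZr /heat_flux dotZl /heat_dissipation /sqnorm.
by set D := divergence _ x; set q := dot _ _; set k := kappa _ _; field.
Qed.

End at_point.
End energy.

(** * Local energy balances *)

(** The letters stand for: [a] and [w], time and convective derivative of the phase;
    [fr], friction; [m], chemical potential; [s], [st], entropy and its rate; [g],
    convective derivative of the temperature [th]; [dsu] and [dq], divergence of the
    entropy and of the heat flux; [hd], heat dissipation; [X], divergence of the work of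
    the microscopic stress. *)
Lemma energy_algebra_A1 (R : realType) (a w fr m s g th st dsu dq hd X : R) :
  a + w = 0 -> - (fr * w) * w = m * w + s * g ->
  th * (st + dsu) = dq - hd + (w ^+ 2 * fr + hd) ->
  X - a * m + th * st = - (th * dsu + s * g - dq - X).
Proof. by move=> /eqP; rewrite addr_eq0 => /eqP ->; lra. Qed.

Lemma energy_algebra_A2 (R : realType) (a w fr m th st dq hd X : R) :
  a + w = 0 -> - (fr * w) * w = m * w ->
  th * st = dq - hd + (w ^+ 2 * fr + hd) ->
  X - a * m + th * st = - (- dq - X).
Proof. by move=> /eqP; rewrite addr_eq0 => /eqP ->; lra. Qed.

(** With respect to the first case, [y] is the derivative of the phase along [v], [k]
    the rate of the kinetic energy, [A], [P], [L] the products of [v] with the inertial,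
    pressure and viscous forces, and [G] the square of the velocity gradient. *)
Lemma energy_algebra_A3 (R : realType)
    (a w y fr m s g th st dsv dq hd X k A P nu L G : R) :
  a + w = 0 -> - (fr * (w - y)) * (w - y) = m * (w - y) ->
  k + A + P = - (m * y) + nu * L - s * g ->
  th * (st + dsv) = dq - hd + ((w - y) ^+ 2 * fr + nu * G + hd) ->
  X - a * m + th * st + k =
  - (th * dsv + s * g + A + P - dq - X - nu * (G + L)).
Proof. by move=> /eqP; rewrite addr_eq0 => /eqP ->; lra. Qed.

Arguments energy_algebra_A1 {R a w fr m s g th st dsu dq hd X}.
Arguments energy_algebra_A2 {R a w fr m th st dq hd X}.
Arguments energy_algebra_A3 {R a w y fr m s g th st dsv dq hd X k A P nu L G}.

Section balances.
Context {R : realType} {d : nat}.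
Notation E := 'rV[R]_d.
Variables (psi : R -> E -> R -> R) (eta kappa : R -> R -> R).
Hypotheses (hpsi : Ck 2 [set z : R * E * R | 0 < z.2]
              (fun z => psi z.1.1 z.1.2 z.2))
  (hkappa : Ck 1 [set z : R * R | 0 < z.2] (fun z => kappa z.1 z.2)).
Variables (D : spatial_domain R d) (T : R) (W : set (R * E)).
Variables (phi theta : R -> E -> R).
Hypotheses (oW : open W) (hphi : Ck 2 W (unc phi)) (htheta : Ck 2 W (unc theta))
  (theta_gt0 : forall z, W z -> 0 < unc theta z).
Hypothesis WD : forall t x, 0 < t < T -> region D x -> W (t, x).

Local Notation s := (entropy psi phi theta).
Local Notation q := (heat_flux kappa phi theta).
Local Notation P := (dpsi_dgrad psi phi theta).

Let slice (f : R -> E -> R) t : Ck 1 W (unc f) -> Ck 1 [set y | W (t, y)] (f t).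
Proof. exact: Ck_slice. Qed.

Let hs : Ck 1 W (unc s) := Ck1_entropy hpsi oW hphi htheta theta_gt0.
Let hth : Ck 1 W (unc theta) := Ck_pred htheta.

Lemma Ck1_working j : Ck 1 W (fun z => (dt phi z.1 z.2 *: P z.1 z.2) 0 j).
Proof.
have -> : (fun z => (dt phi z.1 z.2 *: P z.1 z.2) 0 j) =
    (fun z => unc (dt phi) z * P z.1 z.2 0 j) by apply/funext => z; rewrite mxE.
exact: (Ck1M oW (Ck1_dt hphi) (Ck1_dpsi_dgrad hpsi oW hphi htheta theta_gt0 j)).
Qed.

Lemma Ck1_working_slice t j :
  Ck 1 [set y | W (t, y)] (component (fun y => dt phi t y *: P t y) j).
Proof.
exact: (Ck_slice (f := fun t y => (dt phi t y *: P t y) 0 j) t (Ck1_working j)).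
Qed.

Let hq t j : Ck 1 [set y | W (t, y)] (component (q t) j).
Proof. exact: (Ck1_heat_flux_slice hkappa oW hphi htheta theta_gt0 t j). Qed.

Section A1.
Variables (u : R -> E -> E).
Hypothesis hu : forall i, Ck 1 W (fun z => u z.1 z.2 0 i).

Lemma Ck1_velocity_slice t i : Ck 1 [set y | W (t, y)] (component (u t) i).
Proof. exact: (Ck_slice (f := fun t y => u t y 0 i) t (hu i)). Qed.

Lemma Ck1_convected_slice (f : R -> E -> R) t i : Ck 1 W (unc f) ->
  Ck 1 [set y | W (t, y)] (component (fun y => f t y *: u t y) i).
Proof.
by move=> /(slice t) hf; apply: (Ck1_component_scale (open_slice t oW) hf);
  exact: Ck1_velocity_slice.
Qed.

Lemma divergence_convected_heat t x : W (t, x) ->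
  divergence (fun y => (theta t y * s t y) *: u t y) x =
  theta t x * divergence (fun y => s t y *: u t y) x
  + s t x * dot (u t x) (grad (theta t) x).
Proof.
move=> Wtx.
have -> : (fun y => (theta t y * s t y) *: u t y) =
    (fun y => theta t y *: (s t y *: u t y)).
  by apply/funext => y; rewrite scalerA.
rewrite (@divergence_mul _ _ [set y | W (t, y)] (theta t)).
- by rewrite dotZl.
- exact: slice.
- by move=> i; exact: Ck1_convected_slice.
- exact: Wtx.
Qed.

Lemma Ck1_energy_flux_A1 i :
  Ck 1 W (fun z => energy_flux_A1 psi kappa phi theta u z.1 z.2 0 i).
Proof.
have -> : (fun z => energy_flux_A1 psi kappa phi theta u z.1 z.2 0 i) =
    (fun z => unc theta z * unc s z * u z.1 z.2 0 i - q z.1 z.2 0 i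
              - (dt phi z.1 z.2 *: P z.1 z.2) 0 i).
  by apply/funext => z; rewrite /energy_flux_A1 !mxE.
have h1 := Ck1M oW (Ck1M oW hth hs) (hu i).
have h2 := Ck1_heat_flux hkappa oW hphi htheta theta_gt0 i.
exact: (Ck1B oW (Ck1B oW h1 h2) (Ck1_working i)).
Qed.

(** Multiplying the force balance by [u] shows that the friction power equals the
    working of the chemical potential and of the thermal force, which thus cancel against
    the friction part of the entropy production. *)
Lemma balance_A1 (Delta : R -> E -> R) t x :
  solves_A1 D T psi eta kappa phi theta u Delta ->
  0 < t < T -> region D x ->
  dt (internal_energy psi phi theta) t x =
  - divergence (energy_flux_A1 psi kappa phi theta u t) x.
Proof.
move=> /(_ t x) h tT rx; have Wtx := WD tT rx.
have [eq1 /(congr1 (dot (u t x))) eq2 eq3 eq4] := h tT rx.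
move: eq2; rewrite (dotC _ (_ + _)) dotDl !dotZl dotZr !(dotC _ (u t x)) => eq2.
have Uc := Ck1_convected_slice.
have dJ : divergence (energy_flux_A1 psi kappa phi theta u t) x =
    divergence (fun y => (theta t y * s t y) *: u t y) x - divergence (q t) x
    - divergence (fun y => dt phi t y *: P t y) x.
  have h1 i := Ck1_convected_slice (f := fun t y => theta t y * s t y) t i (Ck1M oW hth hs).
  have E1 := divergenceB h1 (hq t) Wtx.
  have h2 i := Ck1_componentB (open_slice t oW) (h1 i) (hq t i).
  have E2 := divergenceB h2 (Ck1_working_slice t) Wtx.
  exact: (etrans E2 (congr1 (fun X => X - _) E1)).
rewrite dJ divergence_convected_heat// (dt_internal_energy hpsi oW hphi htheta theta_gt0 Wtx).
have eq5 := divergence_entropy_flux hkappa oW hphi htheta theta_gt0 Wtx.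
rewrite eq4 eq5 real_normK ?num_real// in eq3.
exact: (energy_algebra_A1 eq1 eq2 eq3).
Qed.

End A1.

Section A2.
Variables (u : R -> E -> E).

Lemma Ck1_energy_flux_A2 i :
  Ck 1 W (fun z => energy_flux_A2 psi kappa phi theta z.1 z.2 0 i).
Proof.
have -> : (fun z => energy_flux_A2 psi kappa phi theta z.1 z.2 0 i) =
    (fun z => - q z.1 z.2 0 i - (dt phi z.1 z.2 *: P z.1 z.2) 0 i).
  by apply/funext => z; rewrite /energy_flux_A2 !mxE.
have h2 := Ck1_heat_flux hkappa oW hphi htheta theta_gt0 i.
exact: (Ck1B oW (Ck1N oW h2) (Ck1_working i)).
Qed.

Lemma balance_A2 (Delta : R -> E -> R) t x :
  solves_A2 D T psi eta kappa phi theta u Delta ->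
  0 < t < T -> region D x ->
  dt (internal_energy psi phi theta) t x =
  - divergence (energy_flux_A2 psi kappa phi theta t) x.
Proof.
move=> /(_ t x) h tT rx; have Wtx := WD tT rx.
have [eq1 /(congr1 (dot (u t x))) eq2 eq3 eq4] := h tT rx.
move: eq2; rewrite !dotZr => eq2.
have h0 i : Ck 1 [set y | W (t, y)] (component (fun _ : E => 0 : E) i).
  have -> : component (fun _ : E => 0 : E) i = (fun _ => 0).
    by apply/funext => y; rewrite /component mxE.
  exact: (Ck1_cst (open_slice t oW) (0 : R)).
have dJ : divergence (energy_flux_A2 psi kappa phi theta t) x =
    - divergence (q t) x - divergence (fun y => dt phi t y *: P t y) x.
  have E1 := divergenceB h0 (hq t) Wtx.
  have h2 i := Ck1_componentB (open_slice t oW) (h0 i) (hq t i).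
  have E2 := divergenceB h2 (Ck1_working_slice t) Wtx.
  have d0 : divergence (fun _ : E => 0 : E) x = 0.
    apply: big1 => i _; have -> : component (fun _ : E => 0 : E) i = (fun _ => 0).
      by apply/funext => y; exact: mxE.
    exact: derive_cstf.
  have E1' := etrans E1 (etrans (congr1 (fun X => X - _) d0) (sub0r _)).
  have -> : energy_flux_A2 psi kappa phi theta t =
      (fun y => 0 - q t y - dt phi t y *: P t y).
    by apply/funext => y; rewrite sub0r.
  exact: (etrans E2 (congr1 (fun X => X - _) E1')).
rewrite dJ (dt_internal_energy hpsi oW hphi htheta theta_gt0 Wtx).
have eq5 := divergence_entropy_flux hkappa oW hphi htheta theta_gt0 Wtx.
rewrite eq4 eq5 real_normK ?num_real// in eq3.
exact: (energy_algebra_A2 eq1 eq2 eq3).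
Qed.

End A2.

Section A3.
Variables (nu : R) (u v : R -> E -> E) (p : R -> E -> R).
Hypothesis hv : Ck 2 W (unc v).
Hypothesis hp : Ck 1 W (unc p).

Let vc (i : 'I_d) t x : R := v t x 0 i.
Let hvc i : Ck 2 W (unc (vc i)) := Ck_component i oW hv.
Let hvc1 i : Ck 1 W (unc (vc i)) := Ck_pred (hvc i).

Lemma Ck1_kinetic_energy : Ck 1 W (unc (kinetic_energy v)).
Proof.
have h i : Ck 1 W (fun z => unc (vc i) z * unc (vc i) z) := Ck1M oW (hvc1 i) (hvc1 i).
exact: (Ck1M oW (Ck1_cst oW (2^-1 : R)) (Ck1_sum oW h)).
Qed.

Lemma derive_kinetic z w : W z -> 'D_w (unc (kinetic_energy v)) z =
  \sum_i unc (vc i) z * 'D_w (unc (vc i)) z.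
Proof.
move=> Wz.
have dv i := Ck_derivable w (hvc1 i) Wz.
have E1 i := derive_mul (dv i) (dv i).
have E2 := derive_sumr (fun i => derivable_mul (dv i) (dv i)).
have dS : derivable (fun y => \sum_i unc (vc i) y * unc (vc i) y) z w.
  exact: (Ck_derivable w (Ck1_sum oW (fun i => Ck1M oW (hvc1 i) (hvc1 i))) Wz).
have E3 := derive_mul (derivable_cstf (2^-1 : R) z w) dS.
rewrite [LHS]E3 derive_cstf mulr0 addr0 E2 mulr_sumr; apply: eq_bigr => i _.
by rewrite E1; move: (unc (vc i) z) ('D_w (unc (vc i)) z) => a b; field.
Qed.

Lemma dt_kinetic t x : W (t, x) -> dt (kinetic_energy v) t x = dot (v t x) (dt v t x).
Proof.
move=> Wtx; rewrite dtE derive_kinetic//; apply: eq_bigr => i _.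
rewrite dtE derive_component//; exact: (Ck_derivable _ (Ck_pred hv) Wtx).
Qed.

(** The double sum over components and directions is taken in the other order. *)
Lemma dot_grad_kinetic t x : W (t, x) ->
  dot (v t x) (grad (kinetic_energy v t) x) = dot (v t x) (advection (v t) (v t) x).
Proof.
move=> Wtx; rewrite /dot.
under eq_bigr => i _.
  rewrite [grad _ _ _ _]mxE partialE derive_kinetic// mulr_sumr.
  over.
rewrite exchange_big /=; apply: eq_bigr => j _.
rewrite [advection _ _ _ _ _]mxE /dot mulr_sumr; apply: eq_bigr => i _.
rewrite [grad _ _ _ _]mxE (partialE (vc j)) mulrCA//.
Qed.

Lemma Ck1_viscous_work j : Ck 1 W (fun z => viscous_work nu v z.1 z.2 0 j).
Proof.
have -> : (fun z => viscous_work nu v z.1 z.2 0 j) =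
    (fun z => nu * \sum_i unc (vc i) z * partial j (vc i z.1) z.2).
  apply/funext => z; rewrite /viscous_work mxE summxE; congr (_ * _).
  by apply: eq_bigr => i _; rewrite !mxE.
have h i : Ck 1 W (fun z => unc (vc i) z * partial j (vc i z.1) z.2) :=
  Ck1M oW (hvc1 i) (Ck1_partial j (hvc i)).
exact: (Ck1M oW (Ck1_cst oW (nu : R)) (Ck1_sum oW h)).
Qed.

(** By Leibniz' rule viscous heating and the power of the viscous force add up to
    a flux. *)
Lemma divergence_viscous_work t x : W (t, x) ->
  divergence (viscous_work nu v t) x =
  nu * (sqnorm_grad (v t) x + dot (v t x) (laplacian (v t) x)).
Proof.
move=> Wtx; set U := [set y | W (t, y)].
have oU : open U := open_slice t oW.
have hvs i : Ck 1 U (vc i t) := Ck_slice t (hvc1 i).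
have hg i j : Ck 1 U (component (grad (vc i t)) j).
  have -> : component (grad (vc i t)) j = partial j (vc i t).
    by apply/funext => y; rewrite /component mxE.
  exact: (Ck_slice (f := fun t x => partial j (vc i t) x) t (Ck1_partial j (hvc i))).
have hvg i j := Ck1_component_scale oU (hvs i) (hg i j).
have hS j : Ck 1 U (component (fun y => \sum_i vc i t y *: grad (vc i t) y) j).
  have -> : component (fun y => \sum_i vc i t y *: grad (vc i t) y) j =
     (fun y => \sum_i component (fun y => vc i t y *: grad (vc i t) y) j y).
    by apply/funext => y; rewrite /component summxE.
  exact: (Ck1_sum oU (fun i => hvg i j)).
rewrite [LHS](divergenceZ nu hS Wtx); congr (_ * _).
rewrite /sqnorm_grad /dot -big_split /=.
transitivity (\sum_i divergence (fun y => vc i t y *: grad (vc i t) y) x).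
  rewrite /divergence exchange_big; apply: eq_bigr => j _ /=.
  have E1 := derive_sumr (fun i => Ck_derivable (ebase j) (hvg i j) Wtx).
  rewrite -[RHS]E1 /partial; congr (derive _ _ _).
  by apply/funext => y; rewrite /component summxE.
apply: eq_bigr => i _; rewrite (divergence_mul (hvs i) (hg i) Wtx).
have -> : laplacian (v t) x 0 i = divergence (grad (vc i t)) x by rewrite mxE.
exact: addrC.
Qed.

Lemma Ck1_energy_flux_A3 i :
  Ck 1 W (fun z => energy_flux_A3 psi kappa nu phi theta v p z.1 z.2 0 i).
Proof.
have -> : (fun z => energy_flux_A3 psi kappa nu phi theta v p z.1 z.2 0 i) =
    (fun z => (unc theta z * unc s z + unc (kinetic_energy v) z + unc p z) * v z.1 z.2 0 i
       - q z.1 z.2 0 i - (dt phi z.1 z.2 *: P z.1 z.2) 0 i - viscous_work nu v z.1 z.2 0 i).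
  by apply/funext => z; rewrite /energy_flux_A3 !mxE.
have h1 := Ck1M oW (Ck1D oW (Ck1D oW (Ck1M oW hth hs) Ck1_kinetic_energy) hp) (hvc1 i).
have h2 := Ck1_heat_flux hkappa oW hphi htheta theta_gt0 i.
exact: (Ck1B oW (Ck1B oW (Ck1B oW h1 h2) (Ck1_working i)) (Ck1_viscous_work i)).
Qed.

(** The force balance of the phase is multiplied by the relative velocity [u - v],
    the momentum equation by [v]; the power [m * y] of the capillary force is exchanged
    between them. *)
Lemma balance_A3 (Delta : R -> E -> R) t x :
  solves_A3 D T psi eta kappa nu phi theta u v p Delta ->
  0 < t < T -> region D x ->
  dt (internal_energy psi phi theta) t x + dt (kinetic_energy v) t x =
  - divergence (energy_flux_A3 psi kappa nu phi theta v p t) x.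
Proof.
move=> /(_ t x) h tT rx; have Wtx := WD tT rx.
have [eq1 /(congr1 (dot (u t x - v t x))) eq2 [/(congr1 (dot (v t x))) eqm div0] eq3 eq4]
  := h tT rx.
move: eq2; rewrite !dotZr dotBl => eq2.
have dotDr a b c : dot a (b + c) = dot a b + dot a c :> R.
  by rewrite dotC dotDl !(dotC _ a).
have dotNr a b : dot a (- b) = - dot a b :> R by rewrite dotC dotNl dotC.
rewrite !dotDr !dotNr !dotZr -dt_kinetic// -dot_grad_kinetic// in eqm.
set U := [set y | W (t, y)].
have oU : open U := open_slice t oW.
have hvs i : Ck 1 U (component (v t) i) := Ck1_velocity_slice hvc1 t i.
have hks := slice t Ck1_kinetic_energy; have hps := slice t hp.
have h1 i := Ck1_convected_slice (f := fun t y => theta t y * s t y) hvc1 t i (Ck1M oW hth hs).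
have h2 i := Ck1_convected_slice hvc1 t i Ck1_kinetic_energy.
have h3 i := Ck1_convected_slice hvc1 t i hp.
have h4 i : Ck 1 U (component (viscous_work nu v t) i).
  exact: (Ck_slice (f := fun t y => viscous_work nu v t y 0 i) t (Ck1_viscous_work i)).
have dJ : divergence (energy_flux_A3 psi kappa nu phi theta v p t) x =
    divergence (fun y => (theta t y * s t y) *: v t y) x
    + divergence (fun y => kinetic_energy v t y *: v t y) x
    + divergence (fun y => p t y *: v t y) x - divergence (q t) x
    - divergence (fun y => dt phi t y *: P t y) x - divergence (viscous_work nu v t) x.
  have E1 := divergenceD h1 h2 Wtx.
  have h12 i := Ck1_componentD oU (h1 i) (h2 i).
  have E2 := divergenceD h12 h3 Wtx.
  have h123 i := Ck1_componentD oU (h12 i) (h3 i).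
  have E3 := divergenceB h123 (hq t) Wtx.
  have h5 i := Ck1_componentB oU (h123 i) (hq t i).
  have E4 := divergenceB h5 (Ck1_working_slice t) Wtx.
  have h6 i := Ck1_componentB oU (h5 i) (Ck1_working_slice t i).
  have E5 := divergenceB h6 h4 Wtx.
  have -> : energy_flux_A3 psi kappa nu phi theta v p t =
      (fun y => (theta t y * s t y) *: v t y + kinetic_energy v t y *: v t y
        + p t y *: v t y - q t y - dt phi t y *: P t y - viscous_work nu v t y).
    by apply/funext => y; rewrite /energy_flux_A3 !scalerDl.
  exact: (etrans E5 (congr1 (fun X => X - _) (etrans E4 (congr1 (fun X => X - _)
    (etrans E3 (congr1 (fun X => X - _) (etrans E2 (congr1 (fun X => X + _) E1)))))))).
have E6 := divergence_mul hks hvs Wtx; have E7 := divergence_mul hps hvs Wtx.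
rewrite div0 mulr0 add0r in E6; rewrite div0 mulr0 add0r in E7.
rewrite dJ (divergence_convected_heat hvc1 Wtx) E6 E7 (divergence_viscous_work Wtx).
rewrite (dt_internal_energy hpsi oW hphi htheta theta_gt0 Wtx).
have eq5 := divergence_entropy_flux hkappa oW hphi htheta theta_gt0 Wtx.
rewrite eq4 eq5 real_normK ?num_real// dotBl in eq3.
exact: (energy_algebra_A3 eq1 eq2 eqm eq3).
Qed.

End A3.

End balances.

(** * Conservation of the total energy *)

Section periodicity.
Context {R : realType} {d : nat}.
Notation E := 'rV[R]_d.

Lemma grad_shift (f : E -> R) (a x : E) : (forall y, f (y + a) = f y) ->
  grad f (x + a) = grad f x.
Proof.
move=> fa; apply/rowP => i; rewrite !mxE /partial.
have LE (h : R) : h *: ebase i + x + a = h *: ebase i + (x + a) by rewrite addrA.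
have E1 := derive_affine (L := fun y => y + a) f LE.
exact: (etrans (esym E1) (congr1 (fun g => 'D_(ebase i) g x) (funext fa))).
Qed.

(** Periodicity is used at times near [t]. *)
Lemma dt_shift (W : normedModType R) (T : R) (f : R -> E -> W) (a x : E) t :
  (forall t y, 0 < t < T -> f t (y + a) = f t y) -> 0 < t < T ->
  dt f t (x + a) = dt f t x.
Proof.
move=> fa tT; rewrite /dt !derive1E; apply: near_eq_derive.
have : t \in `]0, T[ by rewrite in_itv.
by move=> /near_in_itvoo; apply: filterS => s; rewrite in_itv => sT; exact: fa.
Qed.

Variables (D : spatial_domain R d) (T : R).
Variables (psi : R -> E -> R -> R) (kappa : R -> R -> R) (nu : R).
Variables (phi theta : R -> E -> R) (u v : R -> E -> E) (p : R -> E -> R).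
Hypotheses (pphi : Defs.periodic D T phi) (ptheta : Defs.periodic D T theta).

Lemma periodic_energy_flux_A2 :
  Defs.periodic D T (energy_flux_A2 psi kappa phi theta).
Proof.
move: pphi ptheta; case: D => [Om//|L] hphi hth t x i tT.
have e1 := hphi t x i tT; have e2 := hth t x i tT.
have gphi := grad_shift x (fun y => hphi t y i tT).
have gth := grad_shift x (fun y => hth t y i tT).
have dphi := dt_shift x (fun s y => hphi s y i) tT.
have qE := f_equal3 (fun a c g => kappa a c *: g) e1 e2 gth.
have PE := f_equal3 (fun a g c => grad (fun w => psi a w c) g) e1 gphi e2.
exact: (f_equal3 (fun q a P => - q - a *: P) qE dphi PE).
Qed.

Lemma periodic_heat_content : Defs.periodic D T
  (fun t x => theta t x * entropy psi phi theta t x).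
Proof.
move: pphi ptheta; case: D => [Om//|L] hphi hth t x i tT.
have e1 := hphi t x i tT; have e2 := hth t x i tT.
have gphi := grad_shift x (fun y => hphi t y i tT).
exact: (f_equal3 (fun a g c => c * - derive1 (psi a g) c) e1 gphi e2).
Qed.

Lemma periodic_energy_flux_A1 : Defs.periodic D T u ->
  Defs.periodic D T (energy_flux_A1 psi kappa phi theta u).
Proof.
move: periodic_energy_flux_A2 periodic_heat_content; case: D => [Om//|L] h2 hs hu t x i tT.
have E2 := h2 t x i tT; have E3 := hs t x i tT; have E4 := hu t x i tT.
have h (c : R) (w : E) y : c *: w - heat_flux kappa phi theta t y
    - dt phi t y *: dpsi_dgrad psi phi theta t y
   = c *: w + energy_flux_A2 psi kappa phi theta t y := esym (addrA _ _ _).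
exact: (etrans (h _ _ _) (etrans (f_equal3 (fun c w f => c *: w + f) E3 E4 E2)
  (esym (h _ _ _)))).
Qed.

Lemma periodic_energy_flux_A3 : Defs.periodic D T v -> Defs.periodic D T p ->
  Defs.periodic D T (energy_flux_A3 psi kappa nu phi theta v p).
Proof.
move: periodic_energy_flux_A2 periodic_heat_content; case: D => [Om//|L] h2 hs hv hp t x i tT.
have E2 := h2 t x i tT; have E3 := hs t x i tT; have E4 := hv t x i tT.
have E5 := hp t x i tT.
have gv j : grad (component (v t) j) (x + L 0 i *: ebase i) = grad (component (v t) j) x.
  by apply: grad_shift => y; rewrite /component hv.
have E6 : viscous_work nu v t (x + L 0 i *: ebase i) = viscous_work nu v t x.
  by congr (nu *: _); apply: eq_bigr => j _; rewrite gv E4.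
have h (c : R) (w z : E) y : c *: w - heat_flux kappa phi theta t y
    - dt phi t y *: dpsi_dgrad psi phi theta t y - z
   = c *: w + energy_flux_A2 psi kappa phi theta t y - z.
  exact: (congr1 (fun X => X - z) (esym (addrA _ _ _))).
have E7 := congr1 (fun w => 2^-1 * sqnorm w) E4.
have E8 := f_equal3 (fun a b c => a + b + c) E3 E7 E5.
have E9 := f_equal3 (fun c w f => c *: w + f) E8 E4 E2.
exact: (etrans (h _ _ _ _) (etrans (f_equal2 (fun a b => a - b) E9 E6)
  (esym (h _ _ _ _)))).
Qed.

Hypotheses (nP : no_flux D T (dpsi_dgrad psi phi theta))
  (nq : no_flux D T (heat_flux kappa phi theta)).

Lemma no_flux_A2 : no_flux D T (energy_flux_A2 psi kappa phi theta).
Proof.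
move=> t x n tT bx hn.
by rewrite /energy_flux_A2 dotBl dotNl nq// dotZl nP// mulr0 !oppr0 addr0.
Qed.

(** Each summand of the energy flux contains one of the fields with vanishing normal
    component. *)
Lemma no_flux_A1 : no_flux D T u ->
  no_flux D T (energy_flux_A1 psi kappa phi theta u).
Proof.
move=> nu' t x n tT bx hn.
by rewrite /energy_flux_A1 !dotBl dotZl nu'// nq// dotZl nP// !mulr0 !subr0.
Qed.

Lemma no_flux_A3 : no_flux D T v -> no_flux D T (viscous_work nu v) ->
  no_flux D T (energy_flux_A3 psi kappa nu phi theta v p).
Proof.
move=> nv nw t x n tT bx hn.
by rewrite /energy_flux_A3 3!dotBl dotZl nv// nq// dotZl nP// nw// !mulr0 !subr0.
Qed.

End periodicity.

Section solution_domain.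
Context {R : realType} {d : nat}.
Notation E := 'rV[R]_d.
Variables (D : spatial_domain R d) (T : R).

(** Used repeatedly, to find one domain on which all fields of a solution are regular. *)
Lemma smooth_fieldP (W : normedModType R) k (f : R -> E -> W) (U : set (R * E)) :
  smooth_field k D T f -> open U ->
  (forall t x, 0 < t < T -> closure (region D) x -> U (t, x)) ->
  exists V, [/\ open V, V `<=` U,
    (forall t x, 0 < t < T -> closure (region D) x -> V (t, x)) & Ck k V (unc f)].
Proof.
move=> [_ [V [oV DV hV]]] oU DU; exists (V `&` U); split.
- exact: openI.
- by move=> z [].
- by move=> t x tT cx; split; [exact: DV|exact: DU].
- by apply: (@Ck_sub _ _ _ k V) hV => z [].
Qed.

(** Positivity of the temperature persists on a neighbourhood, which keeps the
    arguments of the material functions in their domain of regularity. *)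
Lemma admissible_domain psi kappa (phi theta : R -> E -> R) :
  admissible_state D T psi kappa phi theta ->
  exists W, [/\ open W,
    (forall t x, 0 < t < T -> closure (region D) x -> W (t, x)),
    Ck 2 W (unc phi), Ck 2 W (unc theta) & forall z, W z -> 0 < unc theta z].
Proof.
move=> [sphi sth th0 _ _].
have [|V1 [oV1 _ DV1 h1]] := smooth_fieldP sphi openT; first by [].
have [V2 [oV2 V21 DV2 h2]] := smooth_fieldP sth oV1 DV1.
exists [set z | V2 z /\ 0 < unc theta z]; split.
- rewrite openE => z [Vz tz].
  have n1 : \forall y \near z, V2 y by exact: open_nbhs_nbhs.
  have n2 := near_gt (Ck_continuous h2 Vz) tz.
  by apply: filterS2 n1 n2 => y.
- by move=> t x tT cx; split; [exact: DV2|exact: th0].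
- by apply: (@Ck_sub _ _ _ 2 V1) h1 => z [/V21].
- by apply: (@Ck_sub _ _ _ 2 V2) h2 => z [].
- by move=> z [].
Qed.

Lemma dominated_densityD (e f : R -> E -> R) (W : set (R * E)) : regular_domain D ->
  (forall t x, 0 < t < T -> closure (region D) x -> W (t, x)) ->
  Ck 1 W (unc e) -> Ck 1 W (unc f) ->
  dominated_density D T e -> dominated_density D T f ->
  dominated_density D T (fun t x => e t x + f t x).
Proof.
move=> hD WD he hf de df t tT.
have [ie [G iG hG]] := de t tT; have [jf [H iH hH]] := df t tT.
have mc := measurable_cell hD.
split; first exact: (integrableD mc ie jf).
exists (fun x => G x + H x); first exact: (integrableD mc iG iH).
have nT : \forall s \near t, 0 < s < T.
  have : t \in `]0, T[ by rewrite in_itv.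
  by move=> /near_in_itvoo; apply: filterS => s; rewrite in_itv.
apply: filterS3 nT hG hH => s sT Gs Hs x cx.
have Wsx : W (s, x) by apply: WD => //; apply: subset_closure; exact: cell_region.
have Eq := derive_add (Ck_derivable ((1, 0) : R * E) he Wsx)
  (Ck_derivable ((1, 0) : R * E) hf Wsx).
have -> : dt (fun t x => e t x + f t x) s x = dt e s x + dt f s x.
  by rewrite (dtE e) (dtE f) dtE; exact: Eq.
by rewrite (le_trans (ler_normD _ _))// lerD// ?Gs// Hs.
Qed.

End solution_domain.

Theorem theorem2p8 (R : realType) (d : nat) (hd : d = 2%N \/ d = 3%N)
    (D : spatial_domain R d) (hD : regular_domain D) (T : R) (hT : 0 < T)
    (psi : R -> 'rV[R]_d -> R -> R)
    (hpsi : Ck 2 [set z : R * 'rV[R]_d * R | 0 < z.2]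
              (fun z => psi z.1.1 z.1.2 z.2))
    (eta kappa : R -> R -> R)
    (heta : Ck 1 [set z : R * R | 0 < z.2] (fun z => eta z.1 z.2))
    (hkappa : Ck 1 [set z : R * R | 0 < z.2] (fun z => kappa z.1 z.2))
    (eta_gt0 : forall a c, 0 < c -> 0 < eta a c)
    (kappa_gt0 : forall a c, 0 < c -> 0 < kappa a c)
    (nu : R) :
  [/\ (* (A1) *)
      forall (phi theta : R -> 'rV[R]_d -> R) (u : R -> 'rV[R]_d -> 'rV[R]_d)
        (Delta : R -> 'rV[R]_d -> R),
        admissible_state D T psi kappa phi theta ->
        smooth_field 1 D T u ->
        no_flux D T u ->
        solves_A1 D T psi eta kappa phi theta u Delta ->
        bounded_domain D \/
          (dominated_density D T (internal_energy psi phi theta) /\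
           integrable_flux D T (energy_flux_A1 psi kappa phi theta u)) ->
        conserved T (total_energy D psi phi theta),
      (* (A2) *)
      forall (phi theta : R -> 'rV[R]_d -> R) (u : R -> 'rV[R]_d -> 'rV[R]_d)
        (Delta : R -> 'rV[R]_d -> R),
        admissible_state D T psi kappa phi theta ->
        smooth_field 1 D T u ->
        no_flux D T u ->
        solves_A2 D T psi eta kappa phi theta u Delta ->
        bounded_domain D \/
          (dominated_density D T (internal_energy psi phi theta) /\
           integrable_flux D T (energy_flux_A2 psi kappa phi theta)) ->
        conserved T (total_energy D psi phi theta)
    & (* (A3) *)
      forall (phi theta : R -> 'rV[R]_d -> R)
        (u v : R -> 'rV[R]_d -> 'rV[R]_d) (p : R -> 'rV[R]_d -> R)
        (Delta : R -> 'rV[R]_d -> R),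
        admissible_state D T psi kappa phi theta ->
        smooth_field 1 D T u -> smooth_field 2 D T v -> smooth_field 1 D T p ->
        no_flux D T u -> no_flux D T v -> no_flux D T (viscous_work nu v) ->
        solves_A3 D T psi eta kappa nu phi theta u v p Delta ->
        bounded_domain D \/
          [/\ dominated_density D T (internal_energy psi phi theta),
              dominated_density D T (kinetic_energy v)
            & integrable_flux D T (energy_flux_A3 psi kappa nu phi theta v p)] ->
        conserved T (total_energy_A3 D psi phi theta v)].
Proof.
split=> [phi theta u Delta adm su nu' sol hb|phi theta u Delta adm su nu' sol hb|
    phi theta u v p Delta adm su sv sp nu' nv nw sol hb].
- have [[pphi _] [pth _] _ nP nq] := adm; have [pu _] := su.
  have [W0 [oW0 DW0 hphi0 hth0 th0]] := admissible_domain adm.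
  have [W [oW W0W DW hu]] := smooth_fieldP su oW0 DW0.
  have hphi := Ck_sub W0W hphi0; have hth := Ck_sub W0W hth0.
  have thW z (Wz : W z) := th0 z (W0W z Wz).
  have hui i := Ck_component i oW hu.
  have he := Ck1_internal_energy hpsi oW hphi hth thW.
  have hJ := Ck1_energy_flux_A1 hpsi hkappa oW hphi hth thW hui.
  have WD t x (tT : 0 < t < T) (rx : region D x) := DW t x tT (subset_closure rx).
  have [de iJ] : dominated_density D T (internal_energy psi phi theta) /\
      integrable_flux D T (energy_flux_A1 psi kappa phi theta u).
    case: hb => [bD|//]; split; first exact: (bounded_dominated hD oW DW bD he).
    exact: (bounded_integrable_flux hD oW DW bD hJ).
  exact: (conservation hD oW DW hJ (periodic_energy_flux_A1 psi kappa pphi pth pu)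
    (no_flux_A1 nP nq nu') iJ he de
    (fun t x => balance_A1 hpsi hkappa oW hphi hth thW WD hui sol)).
- have [[pphi _] [pth _] _ nP nq] := adm.
  have [W [oW DW hphi hth thW]] := admissible_domain adm.
  have he := Ck1_internal_energy hpsi oW hphi hth thW.
  have hJ := Ck1_energy_flux_A2 hpsi hkappa oW hphi hth thW.
  have WD t x (tT : 0 < t < T) (rx : region D x) := DW t x tT (subset_closure rx).
  have [de iJ] : dominated_density D T (internal_energy psi phi theta) /\
      integrable_flux D T (energy_flux_A2 psi kappa phi theta).
    case: hb => [bD|//]; split; first exact: (bounded_dominated hD oW DW bD he).
    exact: (bounded_integrable_flux hD oW DW bD hJ).
  exact: (conservation hD oW DW hJ (periodic_energy_flux_A2 psi kappa pphi pth)
    (no_flux_A2 nP nq) iJ he de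
    (fun t x => balance_A2 hpsi hkappa oW hphi hth thW WD sol)).
have [[pphi _] [pth _] _ nP nq] := adm; have [pv _] := sv; have [pp _] := sp.
have [W0 [oW0 DW0 hphi0 hth0 th0]] := admissible_domain adm.
have [W1 [oW1 W10 DW1 hv1]] := smooth_fieldP sv oW0 DW0.
have [W [oW W1W DW hp]] := smooth_fieldP sp oW1 DW1.
have W0W z (Wz : W z) := W10 z (W1W z Wz).
have hphi := Ck_sub W0W hphi0; have hth := Ck_sub W0W hth0.
have hv := Ck_sub W1W hv1.
have thW z (Wz : W z) := th0 z (W0W z Wz).
have he := Ck1_internal_energy hpsi oW hphi hth thW.
have hk := Ck1_kinetic_energy oW hv.
have hJ := Ck1_energy_flux_A3 hpsi hkappa oW hphi hth thW nu hv hp.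
have WD t x (tT : 0 < t < T) (rx : region D x) := DW t x tT (subset_closure rx).
have [de dk iJ] : [/\ dominated_density D T (internal_energy psi phi theta),
    dominated_density D T (kinetic_energy v) &
    integrable_flux D T (energy_flux_A3 psi kappa nu phi theta v p)].
  case: hb => [bD|//]; split; first exact: (bounded_dominated hD oW DW bD he).
    exact: (bounded_dominated hD oW DW bD hk).
  exact: (bounded_integrable_flux hD oW DW bD hJ).
pose tot t x := internal_energy psi phi theta t x + kinetic_energy v t x.
have htot : Ck 1 W (unc tot) := Ck1D oW he hk.
have dtot : dominated_density D T tot := dominated_densityD hD DW he hk de dk.
have bal t x : 0 < t < T -> region D x ->
    dt tot t x = - divergence (energy_flux_A3 psi kappa nu phi theta v p t) x.
  move=> tT rx; have Wtx := WD t x tT rx.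
  have Eq := derive_add (Ck_derivable ((1, 0) : R * 'rV[R]_d) he Wtx)
    (Ck_derivable ((1, 0) : R * 'rV[R]_d) hk Wtx).
  rewrite -(balance_A3 hpsi hkappa oW hphi hth thW WD hv hp sol tT rx).
  by rewrite (dtE (internal_energy _ _ _)) (dtE (kinetic_energy v)) dtE; exact: Eq.
have cons := conservation hD oW DW hJ
  (periodic_energy_flux_A3 psi kappa nu pphi pth pv pp) (no_flux_A3 p nP nq nv nw)
  iJ htot dtot bal.
move=> t tT; apply: (near_eq_is_derive _ (cons t tT)).
have : t \in `]0, T[ by rewrite in_itv.
move=> /near_in_itvoo; apply: filterS => s; rewrite in_itv => sT.
have [ie _] := de s sT; have [ik _] := dk s sT.
exact: (RintegralD (measurable_cell hD) ie ik).
Qed.
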